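(* Let $Z(t),t\in\mathbb R^d$, $d\ge1$, with values in $[-\infty,\infty)$, be such that the associated max-stable process $\zeta_Z$ is stationary with unit Gumbel marginals, and suppose that $$\mathbb P\Bigl\{\int_{\mathbb R^d}e^{Z(t)}\lambda(dt)<\infty\Bigr\}=1,$$ where $\lambda$ is the Lebesgue measure on $\mathbb R^d$. i) For any $\delta>0$, $$\mathcal H_Z^\delta=\mathbb E\left\{\frac{\sup_{t\in\delta\mathbb Z^d}e^{\Theta(t)}}{\delta^d\int_{\mathbb R^d}e^{\Theta(s)}\mu_\delta(ds)}\right\}\in(0,\infty),$$ where $\mu_\delta$ is the counting measure on $\delta\mathbb Z^d$. Moreover, if further the finite dimensional distributions of $\Theta$ (at distinct points different from the origin) are absolutely continuous, then $$\mathcal H_Z^\delta=\frac1{\delta^d}\mathbb P\Bigl\{\sup_{t\in\delta\mathbb Z^d}\Theta(t)=0\Bigr\}.$$ ii) For $\delta=0$, if $\zeta_Z$ has cadlag sample paths, then $$\mathcal H_Z^0\ge\mathbb E\left\{\frac{\sup_{t\in\mathbb R^d}e^{\Theta(t)}}{\int_{\mathbb R^d}e^{\Theta(s)}\lambda(ds)}\right\}\in(0,\infty).$$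
   Context: $e^{-\infty}=0$. The associated max-stable process is $\zeta_Z(t)=\max_{i\ge1}(P_i+Z_i(t))$, $t\in\mathbb R^d$, where $\sum_i\varepsilon_{P_i}$ is a Poisson point process on $\mathbb R$ with intensity $e^{-x}dx$ and $Z_i$ are independent copies of $Z$, independent of the point process. Unit Gumbel marginals means $\mathbb E\{e^{Z(t)}\}=1$ for all $t$. Stationary means that the finite dimensional distributions of $\zeta_Z(\cdot-h)$ and $\zeta_Z$ coincide for every $h\in\mathbb R^d$. Generalised Pickands constant: for $\delta\ge0$, $$\mathcal H_Z^\delta=\lim_{T\to\infty}\frac1{T^d}\mathbb E\Bigl\{\sup_{t\in\delta\mathbb Z^d\cap[0,T]^d}e^{Z(t)}\Bigr\},$$ with the convention $0\mathbb Z^d=\mathbb R^d$. In the case $\delta=0$ the assumption that $\zeta_Z$ has cadlag sample paths is equivalent to $\mathbb E\{\sup_{t\in K}e^{Z(t)}\}<\infty$ for all compact $K\subset\mathbb R^d$. $\Theta=\Theta_0$ is defined as follows ($0$ is the origin of $\mathbb R^d$): $V_0$ has the conditional law of $Z$ given $Z(0)>-\infty$; $V_0^{[0]}$ is its tilt, with law $\mathbb P\{V_0^{[0]}\in A\}=\mathbb E\{e^{V_0(0)-\ln\mathbb E\{e^{V_0(0)}\}}\mathbb I\{V_0\in A\}\}$ for $A$ in the $\sigma$-field generated by the evaluation maps; and $\Theta(t)=V_0^{[0]}(t)-V_0^{[0]}(0)$, $t\in\mathbb R^d$, so $\Theta(0)=0$ almost surely.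
   Formalization: In ii) Z and Θ are also assumed to have cadlag sample paths almost surely (not only ζ_Z): they are otherwise fixed only in law, and changing Θ at an independent random point alters the supremum over R^d, so the claim would fail. *)

(* Defs.v *)
From HB Require Import structures.
From mathcomp Require Import all_boot all_order all_algebra finmap.
From mathcomp Require Import all_classical all_reals all_analysis.
From mathcomp Require Import measurable_realfun.

Set Implicit Arguments.
Unset Strict Implicit.
Unset Printing Implicit Defensive.

Import Order.TTheory GRing.Theory Num.Theory.
Import numFieldNormedType.Exports.

Local Open Scope classical_set_scope.
Local Open Scope ring_scope.

(** R^n is [n.-tuple R], with the product sigma-algebra; its Lebesgue measure
    is obtained by transporting [lebesgue_measure \x nu] along
    [(x, t) |-> x :: t]. *)
Section lebesgue_tuple.
Context {R : realType}.
Local Open Scope ereal_scope.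

Section lebesgue_cons.
Variables (n : nat) (nu : {sigma_finite_measure set (n.-tuple R) -> \bar R}).

Definition pair_cons (p : R * n.-tuple R) : n.+1.-tuple R :=
  [tuple of p.1 :: p.2].

Lemma measurable_pair_cons : measurable_fun setT pair_cons.
Proof. exact: measurable_cons. Qed.

Definition lebesgue_cons : set (n.+1.-tuple R) -> \bar R :=
  pushforward (lebesgue_measure \x nu) pair_cons.

Let lebesgue_cons0 : lebesgue_cons set0 = 0.
Proof. by rewrite /lebesgue_cons /pushforward preimage_set0 measure0. Qed.

Let lebesgue_cons_ge0 A : 0 <= lebesgue_cons A.
Proof. by rewrite /lebesgue_cons /pushforward; apply: measure_ge0. Qed.

Let lebesgue_cons_sigma_additive : semi_sigma_additive lebesgue_cons.
Proof.
move=> F mF tF mUF; rewrite /lebesgue_cons /pushforward preimage_bigcup.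
apply: measure_semi_sigma_additive.
- by move=> k; rewrite -[X in measurable X]setTI; exact: measurable_pair_cons.
- apply/trivIsetP => /= i j _ _ ij; rewrite -preimage_setI.
  by move/trivIsetP : tF => /(_ _ _ _ _ ij) ->//; rewrite preimage_set0.
- by rewrite -preimage_bigcup -[X in measurable X]setTI;
    exact: measurable_pair_cons.
Qed.

HB.instance Definition _ := isMeasure.Build _ _ _ lebesgue_cons
  lebesgue_cons0 lebesgue_cons_ge0 lebesgue_cons_sigma_additive.

Let lebesgue_cons_sigma_finite : sigma_finite setT lebesgue_cons.
Proof.
have /sigma_finiteP[F [TF ndF Foo]] := sigma_finiteT (@lebesgue_measure R).
have /sigma_finiteP[G [TG ndG Goo]] := sigma_finiteT nu.
exists (fun k => (@tnth n.+1 R ^~ ord0) @^-1` F k `&`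
                 (fun t : n.+1.-tuple R => [tuple of behead t]) @^-1` G k).
  apply/esym; rewrite -subTset => t _.
  have : (setT : set R) (tnth t ord0) by [].
  rewrite TF => -[k _ Fk].
  have : (setT : set (n.-tuple R)) [tuple of behead t] by [].
  rewrite TG => -[l _ Gl]; exists (maxn k l) => //; split.
    by have /subsetPset := ndF _ _ (leq_maxl k l); exact.
  by have /subsetPset := ndG _ _ (leq_maxr k l); exact.
move=> k; have [mF Fk] := Foo k; have [mG Gk] := Goo k; split.
  apply: measurableI; rewrite -[X in measurable X]setTI.
    exact: measurable_tnth.
  exact: measurable_behead.
rewrite /lebesgue_cons /pushforward (_ : _ @^-1` _ = F k `*` G k).
  by rewrite product_measure1E// lte_mul_pinfty// ge0_fin_numE.
apply/seteqP; split=> -[x t] /= [Fx Gt]; split => //=.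
  by rewrite [t](_ : _ = [tuple of behead (pair_cons (x, t))])//;
    exact: val_inj.
by rewrite [X in G k X](_ : _ = t)//; exact: val_inj.
Qed.

HB.instance Definition _ := Measure_isSigmaFinite.Build _ _ _
  lebesgue_cons lebesgue_cons_sigma_finite.

End lebesgue_cons.

Fixpoint lebesgue_tuple (n : nat) :
    {sigma_finite_measure set (n.-tuple R) -> \bar R} :=
  match n return {sigma_finite_measure set (n.-tuple R) -> \bar R} with
  | 0%N => dirac [tuple]
  | m.+1 => lebesgue_cons (lebesgue_tuple m)
  end.

End lebesgue_tuple.

Section euclidean.
Context {R : realType} {d : nat}.
Implicit Types (t h s : d.-tuple R) (f : d.-tuple R -> \bar R).

Definition origin : d.-tuple R := [tuple 0 | j < d].

Definition translate h t : d.-tuple R := [tuple tnth t j - tnth h j | j < d].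

Definition cube (T : R) : set (d.-tuple R) :=
  [set t | forall j, 0 <= tnth t j <= T].

(** [delta Z^d], with the convention [0 Z^d = R^d]. *)
Definition lattice (delta : R) : set (d.-tuple R) :=
  if delta == 0 then setT
  else [set t | forall j, exists z : int, tnth t j = delta * z%:~R].

Lemma measurable_lattice delta : measurable (lattice delta).
Proof.
rewrite /lattice; case: ifPn => // _.
rewrite (_ : [set t | _] = \bigcap_(j : 'I_d) \bigcup_(z : int)
    ((@tnth d R ^~ j) @^-1` [set delta * z%:~R])); last first.
  apply/seteqP; split=> t /= tz j; first by move=> _; have [z] := tz j; exists z.
  by have [z _] := tz j Logic.I; exists z.
apply: fin_bigcap_measurable => // j _.
apply: countable_bigcupT_measurable; first exact: countableP.
by move=> z; rewrite -[X in measurable X]setTI; exact: measurable_tnth.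
Qed.

Definition lattice_measure (delta : R) : {measure set (d.-tuple R) -> \bar R} :=
  mrestr counting (measurable_lattice delta).

(** Cadlag functions of a d-dimensional parameter: around each [t] there are
    2^d open-or-closed orthants, and [f] must have a limit at [t] in each of
    them, the one in the orthant [s >= t] being [f t]. *)
Definition orthant t (up : 'I_d -> bool) : set (d.-tuple R) :=
  [set s | forall j, if up j then tnth t j <= tnth s j else tnth s j < tnth t j].

Definition orthant_nbhs t (up : 'I_d -> bool) : set_system (d.-tuple R) :=
  filter_from [set e : R | 0 < e]
    (fun e => orthant t up `&` [set s | forall j, `|tnth s j - tnth t j| < e]).

(** Limits are taken in [-oo, +oo[, i.e. [expeR \o f] has limits in [0, +oo[. *)
Definition cadlag f := forall t up, exists l : \bar R,
  [/\ l != +oo%E, f s @[s --> orthant_nbhs t up] --> l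
    & (forall j, up j) -> l = f t].

End euclidean.
Arguments origin {R d}.

Section processes.
Context {R : realType} {I : Type}.
Implicit Types A : set (I -> \bar R).
Local Open Scope ereal_scope.

Definition eval_sigma : set (set (I -> \bar R)) :=
  <<s [set A | exists t (B : set (\bar R)),
         measurable B /\ A = [set f | B (f t)]] >>.

Definition path_event {Omega : Type} (X : I -> Omega -> \bar R) A : set Omega :=
  [set w | A (X^~ w)].

Definition process_sigma {Omega : Type} (X : I -> Omega -> \bar R) :
  set (set Omega) := path_event X @` eval_sigma.

Definition measurable_process d (Omega : measurableType d)
  (X : I -> Omega -> \bar R) := forall t, measurable_fun setT (X t).

Definition same_law d (Omega : measurableType d) (P : probability Omega R)
    (X : I -> Omega -> \bar R)
    d' (Omega' : measurableType d') (P' : probability Omega' R)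
    (X' : I -> Omega' -> \bar R) :=
  forall A, eval_sigma A -> P (path_event X A) = P' (path_event X' A).

End processes.

Section point_process.
Context {R : realType} d (Omega : measurableType d) (P : probability Omega R).
Local Open Scope ereal_scope.

Definition independent_fields (F : nat -> set (set Omega)) :=
  forall (J : {fset nat}) (E : nat -> set Omega),
    (forall k, k \in J -> F k (E k)) ->
    P (\bigcap_(k in [set` J]) E k) = \prod_(k <- J) P (E k).

Definition count_points (p : nat -> Omega -> R) (B : set R) (w : Omega) : \bar R :=
  counting [set i | B (p i w)].

(** [\sum_i dirac (p i)] is a Poisson point process with intensity [Lambda];
    [poisson_pmf] is not used because it is not a pmf at rate 0. *)
Definition poisson_process (Lambda : set R -> \bar R) (p : nat -> Omega -> R) :=
  (forall i, measurable_fun setT (p i)) /\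
  forall n (B : 'I_n -> set R) (m : 'I_n -> nat),
    (forall k, measurable (B k)) -> trivIset setT B ->
    (forall k, Lambda (B k) < +oo) ->
    P (\bigcap_k [set w | count_points p (B k) w = (m k)%:R%:E]) =
    \prod_k (fine (Lambda (B k)) ^+ m k / (m k)`!%:R
             * expR (- fine (Lambda (B k))))%:E.

Definition exp_intensity (B : set R) : \bar R :=
  \int[lebesgue_measure]_(x in B) (expR (- x))%:E.

End point_process.

Section max_stable.
Context {R : realType} {I : Type}.
Local Open Scope ereal_scope.

Definition max_stable {Omega : Type} (p : nat -> Omega -> R)
    (Zi : nat -> I -> Omega -> \bar R) (t : I) (w : Omega) : \bar R :=
  ereal_sup [set (p i w)%:E + Zi i t w | i in [set: nat]].

(** Field 0 is generated by the labelled points [p], not only by the point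
    measure: otherwise the labelling could depend on the [Zi]. *)
Definition max_stable_ingredients
    d (Omega : measurableType d) (P : probability Omega R)
    (Z : I -> Omega -> \bar R)
    d' (Omega' : measurableType d') (P' : probability Omega' R)
    (p : nat -> Omega' -> R) (Zi : nat -> I -> Omega' -> \bar R) :=
  [/\ poisson_process P' exp_intensity p,
      forall i, measurable_process (Zi i),
      forall i, same_law P' (Zi i) P Z
    & independent_fields P' (fun k =>
        if k is i.+1 then process_sigma (Zi i)
        else process_sigma (fun i w => (p i w)%:E))].

End max_stable.

Section random_fields.
Context {R : realType} {d : nat}.
Context dO (Omega : measurableType dO) (P : probability Omega R).
Implicit Types (X Z Theta : d.-tuple R -> Omega -> \bar R).
Local Open Scope ereal_scope.

Definition stationary X :=
  forall (h : d.-tuple R) n (t : n.-tuple (d.-tuple R))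
    (B : set (n.-tuple (\bar R))), measurable B ->
  P [set w | B [tuple X (translate h (tnth t i)) w | i < n]] =
  P [set w | B [tuple X (tnth t i) w | i < n]].

Definition cadlag_paths X := {ae P, forall w, cadlag (X^~ w)}.

Definition pickands_mean Z (delta T : R) : \bar R :=
  (T ^- d)%:E *
  \int[P]_w ereal_sup [set expeR (Z t w) | t in lattice delta `&` cube T].

Definition pickands Z (delta : R) : \bar R :=
  lim (pickands_mean Z delta T @[T --> +oo%R]).

Definition conditioned_at_origin dO' (Omega' : measurableType dO')
    (P' : probability Omega' R) (X : d.-tuple R -> Omega' -> \bar R) Z :=
  forall A, eval_sigma A ->
    P' (path_event X A) =
    P (path_event Z A `&` [set w | -oo < Z origin w]) /
    P [set w | -oo < Z origin w].

Definition tilted_at_origin dO' (Omega' : measurableType dO')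
    (P' : probability Omega' R) (X : d.-tuple R -> Omega' -> \bar R)
    (V : d.-tuple R -> Omega -> \bar R) :=
  forall A, eval_sigma A ->
    P' (path_event X A) =
    \int[P]_w (expeR (V origin w - lne (\int[P]_u expeR (V origin u)))
               * (\1_(path_event V A) w)%:E).

(** Since the values lie in [-oo, +oo[, absolute continuity is domination by
    the image of Lebesgue measure in [(\bar R)^n]; it forces the values to be
    almost surely finite. *)
Definition abs_continuous_fdd Theta :=
  forall n (t : n.-tuple (d.-tuple R)), uniq t -> origin \notin t ->
  forall B : set (n.-tuple (\bar R)), measurable B ->
    lebesgue_tuple n [set x | B [tuple (tnth x i)%:E | i < n]] = 0 ->
    P [set w | B [tuple Theta (tnth t i) w | i < n]] = 0.

End random_fields.

Definition spectral_increment (R : realType) (d : nat) (Omega : Type)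
    (V : d.-tuple R -> Omega -> \bar R) (t : d.-tuple R) (w : Omega) : \bar R :=
  (V t w - V origin w)%E.

(* Main.v *)
Require Import Defs.
From HB Require Import structures.
From mathcomp Require Import all_boot all_order all_algebra finmap.
From mathcomp Require Import all_classical all_reals all_analysis.
From mathcomp Require Import measurable_realfun.

(** Write [y = exp Z], let [mu] be either Lebesgue measure or the counting
    measure of the lattice [L], and [D] the integral of [y] for [mu]. The theorem
    rests on one identity, [theta_transfer]: for every [h] and every nonnegative
    functional [F] of a path,
      E F(Theta) = E (y(h) F(Z(h + .) - Z(h))),
    that is, rooting [Z] at any point [h], under the tilt by [y(h)], gives the
    law of [Theta]. It holds because the distribution functions of the max-stable
    process are [exp (- E max_i exp (- x_i) y(t_i))] ([max_stable_cdf], from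
    the avoidance probability of a marked Poisson process, [void_probability]),
    so that stationarity makes [E max_i c_i y(t_i + h)] independent of [h].
    Right differentiating in one of the [c_i] gives the law of the increments
    of [Z] from [t_i] under the tilt by [y(t_i)] ([tilted_cdf_unique],
    [tilted_law_shift]).

    In the discrete case, the lattice sums of [y] are finite: the integral of [y]
    is the average of the lattice sums over the points of a cell, so they are
    finite for almost all origins, and the tilted probability that they are
    infinite does not depend on the origin ([theta_lsum_finite]). One can then
    write [sup_C y] as the sum over [s] of [y(s) sup_C y / D] and root [Z] at
    each [s] in turn; the ratio of the supremum to [D] does not change when [y]
    is multiplied by a constant. If [C] is the part of [L] in a large cube, a
    point [s] deep inside contributes about [E (sup exp Theta / D(Theta))] and
    the points outside contribute little, because the tails of the lattice
    sum vanish ([mean_psup_ge], [mean_psup_le], [lattice_pickands_cvg]). Since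
    there is one lattice point per volume [delta ^ d], this gives the formula
    for the constant. For the second formula, exchange the roles of the root and
    of [s] in the mean of [exp (Theta s) / D] on the event that [Theta] is
    maximal at the root ([peak_exchange]): the probability of this event is the mean of
    [sup exp Theta / D] times the number of maximisers, which is one if ties
    have probability zero ([peak_probability]).

    In the continuous case, cadlag paths reduce suprema to countable sets and
    allow the integral of [exp Theta] to be replaced by a measurable functional
    of the path ([path_integral]). The mean of the supremum over a cube is finite
    because the max-stable process is bounded on it, while its distribution
    function there is [exp (- exp (- x) E sup y)] ([mean_psup_finite]). It is
    also invariant under shifts, hence subadditive in the cube, and the limit
    exists ([continuous_pickands_cvg]). The lower bound is the argument of the
    discrete case for the points deep inside the cube
    ([mean_psup_ge_volume], [path_share_le_limit]). *)

Set Implicit Arguments.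
Unset Strict Implicit.

Import Order.TTheory GRing.Theory Num.Theory.
Import numFieldNormedType.Exports.

Local Open Scope classical_set_scope.
Local Open Scope ring_scope.
Local Open Scope ereal_scope.

(** * Integration and measurability *)

Section measure_tools.
Context {R : realType}.
Import HBNNSimple.

(** A simple function below [f] is below [g] once it is set to zero on the null
    set. *)
Lemma ge0_ae_le_integral d (T : measurableType d)
    (mu : {measure set T -> \bar R}) (f g : T -> \bar R) :
  (forall x, 0 <= f x) -> (forall x, 0 <= g x) ->
  {ae mu, forall x, f x <= g x} -> \int[mu]_x f x <= \int[mu]_x g x.
Proof.
move=> f0 g0 [N [mN N0 fgN]].
rewrite ge0_integralTE// (ge0_integralTE _ g0).
apply: ge_ereal_sup => _ [h /= hf <-].
pose h' := proj_nnsfun h (measurableC mN).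
have -> : sintegral mu h = sintegral mu h'.
  have := @integral_nnsfun _ _ _ mu _ measurableT h.
  have := @integral_nnsfun _ _ _ mu _ measurableT h'.
  rewrite !patch_setT => <- <-; apply: ge0_ae_eq_integral => //.
  - exact/measurable_EFinP.
  - exact/measurable_EFinP.
  - by move=> x _; rewrite lee_fin.
  - by move=> x _; rewrite lee_fin.
  exists N; split => // x /= xh; apply: contrapT => Nx; apply: xh => _.
  by rewrite /h' /= mindicE mem_set//= mulr1.
apply: ereal_sup_ubound; exists h' => //= x.
rewrite /h' /= mindicE; have [/set_mem xN|/negP xN] := boolP (x \in ~` N).
  rewrite mulr1 (le_trans (hf x))// leNgt; apply/negP => gf.
  by apply: xN; apply: fgN => /=; rewrite leNgt gf.
by rewrite mulr0.
Qed.

Lemma ge0_ae_eq_integralT d (T : measurableType d)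
    (mu : {measure set T -> \bar R}) (f g : T -> \bar R) :
  (forall x, 0 <= f x) -> (forall x, 0 <= g x) ->
  {ae mu, forall x, f x = g x} -> \int[mu]_x f x = \int[mu]_x g x.
Proof.
move=> f0 g0 fg; apply/eqP; rewrite eq_le; apply/andP; split;
  apply: ge0_ae_le_integral => //; apply: filterS fg => x -> //.
Qed.

Lemma countable_enumeration (I : Type) (D : set I) : D !=set0 -> countable D ->
  exists e : nat -> I, range e = D.
Proof.
move=> [i0 Di0] /countable_injP[f finj].
have /choice[e eP] : forall n, exists i,
    D i /\ ((exists j, D j /\ f j = n) -> f i = n).
  move=> n; have [[j [Dj fjn]]|nj] := pselect (exists j, D j /\ f j = n).
    by exists j.
  by exists i0.
exists e; apply/seteqP; split => [_ [n _ <-]|i Di]; first by case: (eP n).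
have [De fe] := eP (f i); exists (f i) => //.
by apply: finj; rewrite ?inE//; apply: fe; exists i.
Qed.

Lemma countable_bigcup_measurable d (T : measurableType d) (I : Type)
    (D : set I) (F : I -> set T) : countable D ->
  (forall i, D i -> measurable (F i)) -> measurable (\bigcup_(i in D) F i).
Proof.
move=> cD mF; have [D0|/set0P D0] := eqVneq D set0.
  by rewrite D0 bigcup_set0.
have [e De] := countable_enumeration D0 cD.
rewrite -De bigcup_image; apply: bigcupT_measurable => n; apply: mF.
by rewrite -De; exists n.
Qed.

Lemma measurable_ereal_sup_countable d (T : measurableType d) (I : Type)
    (D : set I) (f : I -> T -> \bar R) : countable D ->
  (forall i, D i -> measurable_fun setT (f i)) ->
  measurable_fun setT (fun w => ereal_sup [set f i w | i in D]).
Proof.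
move=> cD mf; apply: (measurability _ (ErealGenOInfty.measurableE R)) => //.
move=> _ [_ [x ->] <-]; rewrite setTI.
rewrite (_ : _ @^-1` _ = \bigcup_(i in D) (f i @^-1` `]x%:E, +oo[)).
  apply: countable_bigcup_measurable => // i Di.
  by rewrite -[X in measurable X]setTI; apply: mf => //; exact: emeasurable_itv.
apply/seteqP; split => w /=; rewrite in_itv/= andbT.
  by move=> /ereal_sup_gt[_ [i Di <-] xf]; exists i => //=; rewrite in_itv/= andbT.
move=> [i Di]; rewrite /= in_itv/= andbT => /lt_le_trans; apply.
by apply: ereal_sup_ubound; exists i.
Qed.

Lemma measurable_expeR d (T : measurableType d) (f : T -> \bar R) :
  measurable_fun setT f -> measurable_fun setT (fun x => expeR (f x)).
Proof.
move=> mf.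
rewrite (_ : (fun _ => _) = (fun x => maxe (er_map expR (f x)) 0)).
  apply: measurable_maxe => //.
  apply: (@measurableT_comp _ _ _ _ _ _ (er_map expR)) => //.
  exact: (@measurable_er_map _ T R expR (@measurable_expR R)).
apply/funext => x; case: (f x) => [r| |] //=.
  by apply/esym/max_idPl; rewrite lee_fin expR_ge0.
by apply/esym/max_idPr.
Qed.

Lemma measurable_inve d (T : measurableType d) (f : T -> \bar R) :
  (forall x, 0 <= f x) ->
  measurable_fun setT f -> measurable_fun setT (fun x => (f x)^-1).
Proof.
move=> f0 mf; apply: (measurability _ (ErealGenOInfty.measurableE R)) => //.
move=> _ [_ [x ->] <-]; rewrite setTI.
have [x0|x0] := leP 0%R x; last first.
  rewrite (_ : _ @^-1` _ = setT)//; apply/seteqP; split => // w _ /=.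
  by rewrite in_itv/= andbT (@lt_le_trans _ _ 0) ?lte_fin ?inve_ge0.
rewrite (_ : _ @^-1` _ = f @^-1` `]-oo, (x%:E)^-1[).
  by rewrite -[X in measurable X]setTI; apply: mf => //; exact: emeasurable_itv.
apply/seteqP; split => w /=; rewrite !in_itv/= ?andbT inve_pgt ?inE ?lee_fin//.
Qed.

(** The image measure, packaged with the measurability of the map, which
    unification cannot guess from [pushforward mu f] alone. *)
Definition image_measure d d' (T : measurableType d) (T' : measurableType d')
    (mu : {measure set T -> \bar R}) (f : T -> T')
    (mf : measurable_fun setT f) : {measure set T' -> \bar R}.
Proof. refine (pushforward mu f : {measure set T' -> \bar R}); exact: mf. Defined.

Lemma image_measureE d d' (T : measurableType d) (T' : measurableType d')
    (mu : {measure set T -> \bar R}) (f : T -> T')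
    (mf : measurable_fun setT f) A : image_measure mu mf A = mu (f @^-1` A).
Proof. by []. Qed.

Lemma ge0_integral_image_measure d d' (T : measurableType d)
    (T' : measurableType d') (mu : {measure set T -> \bar R}) (f : T -> T')
    (mf : measurable_fun setT f) (g : T' -> \bar R) :
  measurable_fun setT g -> (forall y, 0 <= g y) ->
  \int[image_measure mu mf]_y g y = \int[mu]_x g (f x).
Proof.
move=> mg g0; rewrite (@ge0_integral_pushforward _ _ _ _ R _ mf mu setT g)//.
Qed.

End measure_tools.

(** * Lebesgue measure on tuples *)

Section lebesgue_translation.
Context {R : realType}.

Definition tshift d (h t : d.-tuple R) : d.-tuple R :=
  [tuple (tnth t j + tnth h j)%R | j < d].

Definition topp d (t : d.-tuple R) : d.-tuple R := [tuple (- tnth t j)%R | j < d].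

Lemma tnth_tshift d (h t : d.-tuple R) j :
  tnth (tshift h t) j = (tnth t j + tnth h j)%R.
Proof. by rewrite tnth_mktuple. Qed.

Lemma tnth_translate d (h t : d.-tuple R) j :
  tnth (translate h t) j = (tnth t j - tnth h j)%R.
Proof. by rewrite tnth_mktuple. Qed.

Lemma tnth_topp d (t : d.-tuple R) j : tnth (topp t) j = (- tnth t j)%R.
Proof. by rewrite tnth_mktuple. Qed.

Lemma tnth_origin d j : tnth (@origin R d) j = 0%R.
Proof. by rewrite tnth_mktuple. Qed.

Definition tE := (tnth_tshift, tnth_translate, tnth_topp, tnth_origin).

Lemma translateN d (h : d.-tuple R) : translate (topp h) = tshift h.
Proof. by apply/funext => t; apply: eq_from_tnth => j; rewrite !tE opprK. Qed.

Lemma tshiftN d (h : d.-tuple R) : tshift (topp h) = translate h.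
Proof. by apply/funext => t; apply: eq_from_tnth => j; rewrite !tE. Qed.

Lemma tshiftK d (h : d.-tuple R) : cancel (tshift h) (translate h).
Proof. by move=> t; apply: eq_from_tnth => j; rewrite !tE addrK. Qed.

Lemma translateK d (h : d.-tuple R) : cancel (translate h) (tshift h).
Proof. by move=> t; apply: eq_from_tnth => j; rewrite !tE subrK. Qed.

Lemma tshift_origin d (h : d.-tuple R) : tshift h origin = h.
Proof. by apply: eq_from_tnth => j; rewrite !tE add0r. Qed.

Lemma measurable_translate d (h : d.-tuple R) :
  measurable_fun setT (translate h).
Proof.
apply/measurable_fun_tnthP => j.
rewrite (_ : _ \o _ = (fun t => tnth t j - tnth h j)%R).
  apply: measurable_funB => //; exact: measurable_tnth.
by apply/funext => t /=; rewrite tE.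
Qed.

Lemma measurable_tshift d (h : d.-tuple R) : measurable_fun setT (tshift h).
Proof. by rewrite -translateN; exact: measurable_translate. Qed.

Lemma lebesgue_measure_translate (a : R) (A : set R) : measurable A ->
  lebesgue_measure ((fun x => x - a)%R @^-1` A) = lebesgue_measure A.
Proof.
have mphi : measurable_fun setT
    ((fun x : R => x - a)%R : measurableTypeR R -> measurableTypeR R).
  exact: measurable_funB.
move=> mA; apply/esym.
rewrite -(image_measureE lebesgue_measure mphi).
apply: lebesgue_measure_unique; last exact: mA.
move=> _ [[x y] /= _ <-].
rewrite (image_measureE lebesgue_measure mphi).
transitivity (lebesgue_measure (`]x + a, y + a]%classic%R : set R)).
  rewrite !lebesgue_measure_itv /= !lte_fin ltrD2r.
  by case: ifP => // _; rewrite -!EFinB opprD addrACA subrr addr0.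
by congr lebesgue_measure; apply/seteqP; split => z /=;
  rewrite !in_itv/= ltrBrDr lerBlDr.
Qed.

Lemma ge0_integral_lebesgue_translate (a : R) (f : R -> \bar R) :
  measurable_fun setT f -> (forall x, 0 <= f x) ->
  \int[lebesgue_measure]_x f (x - a)%R = \int[lebesgue_measure]_x f x.
Proof.
move=> mf f0.
have mphi : measurable_fun setT
    ((fun x : R => x - a)%R : measurableTypeR R -> measurableTypeR R).
  exact: measurable_funB.
rewrite -(ge0_integral_image_measure lebesgue_measure mphi mf f0).
apply: eq_measure_integral => A mA _.
rewrite (image_measureE lebesgue_measure mphi).
by first [exact: lebesgue_measure_translate | exact/esym/lebesgue_measure_translate].
Qed.

Lemma ge0_integral_lebesgue_tupleS n (f : n.+1.-tuple R -> \bar R) :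
  measurable_fun setT f -> (forall t, 0 <= f t) ->
  \int[lebesgue_tuple n.+1]_t f t =
  \int[lebesgue_measure]_x \int[lebesgue_tuple n]_t f (pair_cons (x, t)).
Proof.
move=> mf f0.
have mp : measurable_fun setT
    (@pair_cons R n : measurableTypeR R * n.-tuple R -> _).
  exact: measurable_pair_cons.
transitivity (\int[image_measure (lebesgue_measure \x lebesgue_tuple n) mp]_t f t).
  by [].
rewrite ge0_integral_image_measure//.
apply: (@fubini_tonelli1 _ _ (measurableTypeR R) _ R lebesgue_measure
  (lebesgue_tuple n) (f \o @pair_cons R n)) => [|t]; last exact: f0.
exact: measurableT_comp mf mp.
Qed.

Lemma translate_pair_cons n (h : n.+1.-tuple R) x t :
  translate h (pair_cons (x, t)) =
  pair_cons (x - thead h, translate [tuple of behead h] t)%R.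
Proof.
apply: eq_from_tnth => j; rewrite tE.
case: (unliftP ord0 j) => [i ->|->]; last by rewrite /thead !tnth0.
rewrite !tnthS tE tnth_behead; congr (_ - tnth h _)%R.
by apply: val_inj; rewrite /= inordK// ltnS.
Qed.

(** By Tonelli, from the invariance in the first coordinate. *)
Lemma ge0_integral_lebesgue_tuple_translate d (h : d.-tuple R)
    (f : d.-tuple R -> \bar R) :
  measurable_fun setT f -> (forall x, 0 <= f x) ->
  \int[lebesgue_tuple d]_t f (translate h t) = \int[lebesgue_tuple d]_t f t.
Proof.
elim: d h f => [|d IH] h f mf f0.
  by apply: eq_integral => t _; rewrite [translate h t]tuple0 [t]tuple0.
have mfh x : measurable_fun setT (fun t => f (pair_cons (x, t))).
  apply: measurableT_comp => //.
  apply: (measurableT_comp (@measurable_pair_cons R d)) => //.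
have mF : measurable_fun setT (fun x =>
    \int[lebesgue_tuple d]_t f (pair_cons (x, t))).
  apply: (@measurable_fun_fubini_tonelli_F _ _ _ _ _ _ (f \o @pair_cons R d)) => [|t]; last exact: f0.
  by apply: measurableT_comp => //; exact: measurable_pair_cons.
rewrite (ge0_integral_lebesgue_tupleS mf f0).
rewrite (@ge0_integral_lebesgue_tupleS _ (fun t => f (translate h t)))//; last first.
  by apply: measurableT_comp => //; exact: measurable_translate.
rewrite -(ge0_integral_lebesgue_translate (thead h) mF); last first.
  by move=> x; exact: integral_ge0.
apply: eq_integral => x _.
under eq_integral do rewrite translate_pair_cons.
exact: (IH [tuple of behead h] (fun t => f (pair_cons (x - thead h, t)%R))).
Qed.

Lemma ge0_integral_lebesgue_tuple_tshift d (h : d.-tuple R)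
    (f : d.-tuple R -> \bar R) :
  measurable_fun setT f -> (forall x, 0 <= f x) ->
  \int[lebesgue_tuple d]_t f (tshift h t) = \int[lebesgue_tuple d]_t f t.
Proof. by rewrite -translateN; exact: ge0_integral_lebesgue_tuple_translate. Qed.

Lemma measurable_tuple_forall d (A : 'I_d -> set R) :
  (forall j, measurable (A j)) ->
  measurable [set t : d.-tuple R | forall j, A j (tnth t j)].
Proof.
move=> mA.
rewrite (_ : mkset _ = \bigcap_(j : 'I_d) ((@tnth d R ^~ j) @^-1` A j)).
  apply: fin_bigcap_measurable => // j _.
  rewrite -[X in measurable X]setTI; exact: measurable_tnth.
by apply/seteqP; split => t /= tA j; [move=> _|]; exact: tA.
Qed.

Lemma lebesgue_tuple_cube d (A : set R) : measurable A ->
  lebesgue_tuple d [set t | forall j, A (tnth t j)] = (lebesgue_measure A) ^+ d.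
Proof.
move=> mA; elim: d => [|d IH].
  by rewrite /= diracE mem_set// => -[].
rewrite expeS -IH /= /lebesgue_cons /pushforward.
rewrite -product_measure1E//; last exact: (@measurable_tuple_forall _ (fun=> A)).
congr product_measure1; apply/seteqP; split => -[x t] /=.
  move=> At; split; first exact: (At ord0).
  by move=> j; have := At (lift ord0 j); rewrite tnthS.
by move=> [Ax At] j; case: (unliftP ord0 j) => [i ->|->]; rewrite ?tnthS ?tnth0.
Qed.

(** This null set and the next one exclude ties between the values of an
    absolutely continuous field, and between these values and zero. *)
Lemma lebesgue_tuple_hyperplane0 :
  @lebesgue_tuple R 1 [set x | tnth x ord0 = 0%R] = 0.
Proof.
have := @lebesgue_tuple_cube 1 [set 0%R] (measurable_set1 _).
rewrite lebesgue_measure_set1 /expe /= => <-; congr (@lebesgue_tuple R 1 _).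
apply/seteqP; split => t /=; last exact.
by move=> t0 j; rewrite (ord1 j).
Qed.

Lemma lebesgue_tuple_diagonal :
  @lebesgue_tuple R 2 [set x | tnth x ord0 = tnth x (lift ord0 ord0)] = 0.
Proof.
rewrite /= {1}/lebesgue_cons /pushforward /product_measure1.
apply: integral0_eq => x _ /=.
have := @lebesgue_tuple_cube 1 [set x] (measurable_set1 _).
rewrite lebesgue_measure_set1 /expe /= => <-; congr (@lebesgue_tuple R 1 _).
apply/seteqP; split => t /=; rewrite xsectionE/= tnthS tnth0.
  by move=> xt j; rewrite (ord1 j).
by move=> /(_ ord0).
Qed.

End lebesgue_translation.

(** * Path space *)

Section path_space.
Context {R : realType} {I : Type}.

Definition cylinders : set (set (I -> \bar R)) :=
  [set A | exists t (B : set (\bar R)), measurable B /\ A = [set f | B (f t)]].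

(** With this sigma-algebra a process is a single random element, whose law is
    an image measure. *)
Definition path_space : Type := g_sigma_algebraType cylinders.

HB.instance Definition _ := Measurable.on path_space.

Lemma eval_sigmaE : @eval_sigma R I = (measurable : set (set path_space)).
Proof. by []. Qed.

Lemma measurable_eval (t : I) : measurable_fun setT (fun f : path_space => f t).
Proof.
move=> _ B mB; rewrite setTI; apply: sub_sigma_algebra.
by exists t, B.
Qed.

Lemma measurable_path d (Omega : measurableType d) (X : I -> Omega -> \bar R) :
  measurable_process X <->
  measurable_fun setT (fun w => X^~ w : path_space).
Proof.
split=> mX.
  apply: (@measurability _ _ Omega path_space setT _ cylinders erefl) => _ [_ [t [B [mB ->]]] <-].
  by rewrite (_ : _ `&` _ = setT `&` X t @^-1` B) //; exact: mX.
move=> t; exact: (measurableT_comp (measurable_eval t) mX).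
Qed.

Lemma path_event_measurable d (Omega : measurableType d)
    (X : I -> Omega -> \bar R) A : measurable_process X -> eval_sigma A ->
  measurable (path_event X A).
Proof.
move=> /measurable_path mX mA.
rewrite -[X in measurable X]setTI; exact: mX.
Qed.

End path_space.
Arguments path_space : clear implicits.

(** * The generating functional of a Poisson process *)

Section counting_points.
Context {R : realType}.

(** A finite set of indices is exhausted by an initial segment. *)
Lemma counting_sum_mem (S : set nat) (m : nat) :
  counting S = m%:R%:E :> \bar R ->
  \forall J \near \oo, (\sum_(j < J) (val j \in S))%N = m.
Proof.
rewrite /counting; case: ifPn => // /asboolP fS [] /eqP; rewrite eqr_nat => /eqP <-.
exists (\max_(i <- fset_set S) i.+1)%N => // J /= SJ.
have -> : fset_set S = [fset j in [seq j <- iota 0 J | j \in S]]%fset.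
  apply/fsetP => j; rewrite in_fset_set// !inE mem_filter mem_iota /= add0n.
  have [jS|//] := boolP (j \in S); rewrite /=; apply/esym.
  by apply: leq_trans SJ; apply: leq_bigmax_seq => //; rewrite in_fset_set.
rewrite card_fseq undup_id ?filter_uniq ?iota_uniq// size_filter.
rewrite -sum1_count [RHS]big_mkcond /= -(big_mkord xpredT (fun j => nat_of_bool (j \in S))).
rewrite /index_iota subn0; apply: eq_bigr => j _; by case: (_ \in _).
Qed.

Context d (Omega : measurableType d) (P : probability Omega R).
Variable p : nat -> Omega -> R.
Hypothesis mp : forall i, measurable_fun setT (p i).

Lemma measurable_count_points (B : set R) : measurable B ->
  measurable_fun setT (count_points p B).
Proof.
move=> mB.
have -> : count_points p B = fun w => \sum_(i <oo) (\1_B (p i w))%:E.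
  apply/funext => w; rewrite -ge0_integral_count; last first.
    by move=> k; rewrite lee_fin.
  transitivity (\int[counting]_i (\1_[set i | B (p i w)] i)%:E : \bar R).
    by rewrite integral_indic// setIT.
  by apply: eq_integral => i _; rewrite !indicE.
apply: ge0_emeasurable_sum => [k w _ _|k _]; first by rewrite lee_fin.
apply/measurable_EFinP; apply: measurableT_comp => //.
Qed.

End counting_points.

Section poisson_laplace.
Context {R : realType} d (Omega : measurableType d) (P : probability Omega R).
Variables (Lambda : set R -> \bar R) (p : nat -> Omega -> R).
Hypothesis poisson : poisson_process P Lambda p.
Variables (n : nat) (B : 'I_n -> set R).
Hypothesis mB : forall k, measurable (B k).
Hypothesis tB : trivIset setT B.
Hypothesis Bfin : forall k, Lambda (B k) < +oo.

Let mp i : measurable_fun setT (p i). Proof. by case: poisson. Qed.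

Let A k m := [set w | count_points p (B k) w = m%:R%:E].

Let mA k m : measurable (A k m).
Proof.
rewrite (_ : A k m = count_points p (B k) @^-1` [set m%:R%:E])//.
rewrite -[X in measurable X]setTI; apply: measurable_count_points => //.
Qed.

Let L k := fine (Lambda (B k)).

(** For [M] larger than the numbers of points in the cells, [X c M] is the product
    of the [c k] raised to these numbers. Its mean only involves the probabilities
    of the counts. *)
Let X (c : 'I_n -> R) M w : R :=
  (\prod_k \sum_(m < M) c k ^+ m * \1_(A k m) w)%R.

Let XE c M w : X c M w =
  (\sum_(f : {ffun 'I_n -> 'I_M})
     (\prod_k c k ^+ f k) * \1_(\bigcap_k A k (f k)) w)%R.
Proof.
rewrite /X bigA_distr_bigA; apply: eq_bigr => f _; rewrite big_split/=; congr (_ * _)%R.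
rewrite indicE; have [/set_mem wA|/negP wA] := boolP (w \in \bigcap_k A k (f k)).
  by rewrite big1// => k _; rewrite indicE mem_set//; exact: wA.
have [k wk] : exists k, ~ A k (f k) w.
  by apply/existsNP => h; apply: wA; rewrite inE => k _; exact: h.
by rewrite (bigD1 k)//= indicE memNset// mul0r.
Qed.

Let X_ge0 c M w : (forall k, 0 <= c k)%R -> (0 <= X c M w)%R.
Proof.
move=> c0; apply: prodr_ge0 => k _; apply: sumr_ge0 => m _.
by rewrite mulr_ge0// exprn_ge0.
Qed.

Let mX c M : measurable_fun setT (X c M).
Proof.
apply: (@measurable_prod _ _ _ setT) => k _.
apply: measurable_sum => m; apply: measurable_funM => //.
Qed.

Let mAf M (f : {ffun 'I_n -> 'I_M}) : measurable (\bigcap_k A k (f k)).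
Proof. by apply: fin_bigcap_measurable => // k _; exact: mA. Qed.

Let EX c M : (forall k, 0 <= c k)%R -> \int[P]_w (X c M w)%:E =
  (\prod_k (expR (- L k) * \sum_(m < M) (c k * L k) ^+ m / m`!%:R))%:E%R.
Proof.
move=> c0.
have EXf M' (f : {ffun 'I_n -> 'I_M'}) :
    \int[P]_w ((\prod_k c k ^+ f k) * \1_(\bigcap_k A k (f k)) w)%:E%R =
    (\prod_k (c k ^+ f k * (L k ^+ f k / (f k)`!%:R * expR (- L k))))%:E%R.
  under eq_integral do rewrite EFinM.
  rewrite ge0_integralZl//; last 2 first.
  - exact/measurable_EFinP/measurable_indic.
  - by rewrite lee_fin prodr_ge0// => k _; rewrite exprn_ge0.
  have PAf := proj2 poisson n B (fun k => f k) mB tB Bfin.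
  rewrite integral_indic// setIT [X in _ * X]PAf prodEFin -EFinM.
  by rewrite -[in LHS]big_split.
under eq_integral do rewrite XE -sumEFin.
rewrite ge0_integral_sum//; last 2 first.
- by move=> f; apply/measurable_EFinP; apply: measurable_funM.
- by move=> f w _; rewrite lee_fin mulr_ge0// prodr_ge0// => k _; rewrite exprn_ge0.
rewrite (eq_bigr _ (fun f _ => @EXf M f)).
rewrite sumEFin; congr EFin.
rewrite (eq_bigr (fun k => \sum_(m < M)
    c k ^+ m * (L k ^+ m / m`!%:R * expR (- L k))))%R; last first.
  move=> k _; rewrite mulr_sumr; apply: eq_bigr => m _.
  by rewrite exprMn mulrC !mulrA.
by rewrite bigA_distr_bigA.
Qed.

Let EX_cvg c : (forall k, 0 <= c k)%R ->
  \int[P]_w (X c M w)%:E @[M --> \oo] -->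
    (\prod_k expR (- ((1 - c k) * L k)))%:E%R.
Proof.
move=> c0; under eq_fun do rewrite EX//.
apply: cvg_EFin; first exact: nearW.
apply: (@cvg_big R^o _ _ _ _ (@mul_continuous _ )) => k _.
rewrite (_ : expR (- ((1 - c k) * L k)) =
    expR (- L k) * expR (c k * L k))%R; last first.
  by rewrite -expRD mulrBl mul1r opprB addrC.
apply: cvgMr.
have := @is_cvg_series_exp_coeff R (c k * L k).
rewrite /expR /series /=; under eq_fun do rewrite big_mkord; exact.
Qed.

Let F := \bigcap_k \bigcup_m A k m.

Let mF : measurable F.
Proof.
by apply: fin_bigcap_measurable => // k _; apply: bigcupT_measurable => m.
Qed.

Let A_sum k w m M (c : R) : A k m w -> (m < M)%N ->
  (\sum_(i < M) c ^+ i * \1_(A k i) w = c ^+ m)%R.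
Proof.
move=> wm mM; rewrite (bigD1 (Ordinal mM))//= indicE mem_set// mulr1 big1 ?addr0//.
move=> i im; rewrite indicE memNset ?mulr0//= => wi.
move: wm wi; rewrite /A/= => -> [] /eqP; rewrite eqr_nat => /eqP mi.
by move/eqP: im; apply; apply: val_inj.
Qed.

Let X_near c w : F w -> exists m : 'I_n -> nat,
  (forall k, A k (m k) w) /\
  \forall M \near \oo, X c M w = (\prod_k c k ^+ m k)%R.
Proof.
move=> wF; have /choice[m wm] : forall k, exists m, A k m w.
  by move=> k; have [m _] := wF k I; exists m.
exists m; split => //; exists (\max_k (m k).+1)%N => // M /= mM.
apply: eq_bigr => k _; apply: A_sum => //.
by apply: leq_trans mM; exact: leq_bigmax.
Qed.

(** With all weights equal to one the means of [X] tend to one, so that no mass is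
    lost at infinite counts. *)
Let F_ae : P F = 1.
Proof.
apply/eqP; rewrite eq_le probability_le1//=.
have c0 : forall k : 'I_n, (0 <= (fun=> 1 : R) k)%R by [].
have := EX_cvg c0; rewrite big1 => [|k _]; last by rewrite subrr mul0r oppr0 expR0.
move=> h; rewrite -(cvg_lim _ h)//; apply: lime_le; first by apply/cvg_ex; exists 1.
have -> : P F = \int[P]_w (\1_F w)%:E by rewrite integral_indic// setIT.
apply: nearW => M.
apply: ge0_le_integral => //.
- by move=> w _; rewrite lee_fin X_ge0.
- exact/measurable_EFinP.
- exact/measurable_EFinP/measurable_indic.
move=> w _; rewrite lee_fin indicE; have [/set_mem wF|/negP wF] := boolP (w \in F).
  rewrite -[leRHS](prodr_const_nat 1%R 0 0) /X.
  rewrite big_geq//; apply: prodr_ile1 => k _.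
  rewrite sumr_ge0/=; last by move=> m _; rewrite mulr_ge0// exprn_ge0.
  have [m _ wm] := wF k I; have [mM|Mm] := ltnP m M.
    by rewrite (A_sum _ wm)// expr1n.
  rewrite big1// => i _; rewrite indicE memNset ?mulr0//= => wi.
  move: wm wi; rewrite /A/= => -> [] /eqP; rewrite eqr_nat => /eqP mi.
  by have := ltn_ord i; rewrite -mi ltnNge Mm.
have [k wk] : exists k, forall m, ~ A k m w.
  apply: contrapT => /forallNP nk; apply: wF; rewrite inE => k _.
  by have /existsNP[m /contrapT wm] := nk k; exists m.
rewrite /X (bigD1 k)//= big1 ?mul0r// => m _.
by rewrite indicE memNset ?mulr0//; exact: wk.
Qed.

(** The factor that a point located at [x] contributes: [c k] if it falls into
    the cell [B k], and [1] outside all the cells. *)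
Definition cell_weight (c : 'I_n -> R) (x : R) : R :=
  (\prod_k (if x \in B k then c k else 1))%R.

Lemma cell_weight_ge0 c x : (forall k, 0 <= c k)%R -> (0 <= cell_weight c x)%R.
Proof. by move=> c0; apply: prodr_ge0 => k _; case: ifP. Qed.

Lemma cell_weight_le1 c x : (forall k, 0 <= c k <= 1)%R -> (cell_weight c x <= 1)%R.
Proof.
move=> c01; apply: prodr_ile1 => k _; case: ifP => _; first exact: c01.
by rewrite ler01 lexx.
Qed.

Lemma measurable_cell_weight c : measurable_fun setT (cell_weight c).
Proof.
apply: (@measurable_prod _ _ _ setT) => k _.
apply: measurable_fun_ifT => //; apply: (measurable_fun_bool true).
rewrite setTI (_ : _ @^-1` _ = B k)//.
apply/seteqP; split => x /=; first by move=> /set_mem.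
by move=> xB; exact: mem_set.
Qed.

Let Y_near c w : F w ->
  \forall M \near \oo, (\prod_(j < M) cell_weight c (p j w))%R = X c M w.
Proof.
move=> /(X_near c)[m [wm Xm]].
have : \forall M \near \oo, forall k, (\sum_(j < M) (val j \in [set i | B k (p i w)]))%N = m k.
  by apply: filter_forall => k; apply: (@counting_sum_mem R); exact: wm.
move: Xm; apply: filterS2 => M -> mE; rewrite exchange_big/=.
apply: eq_bigr => k _; rewrite -mE expr_sum; apply: eq_bigr => j _.
have -> : (val j \in [set i | B k (p i w)]) = (p j w \in B k).
  by apply/idP/idP; rewrite !inE.
by case: ifP.
Qed.

(** The generating functional of the process for a weight that is constant on
    finitely many cells: the product over the first points agrees in the end with
    [X], a sum over the possible counts. *)
Lemma poisson_cell_weight c : (forall k, 0 <= c k <= 1)%R ->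
  \int[P]_w (\prod_(j < M) cell_weight c (p j w))%:E%R @[M --> \oo] -->
    (\prod_k expR (- ((1 - c k) * fine (Lambda (B k)))))%:E%R.
Proof.
move=> c01; have c0 k : (0 <= c k)%R by case/andP: (c01 k).
have ndX w : {homo (fun M => (X c M w)%:E) : a b / (a <= b)%N >-> a <= b}.
  move=> a b ab; rewrite lee_fin; apply: ler_prod => k _.
  rewrite sumr_ge0/=; last by move=> m _; rewrite mulr_ge0// exprn_ge0.
  rewrite -(subnKC ab) big_split_ord/= lerDl sumr_ge0// => m _.
  by rewrite mulr_ge0// exprn_ge0.
pose f w := limn (fun M => (X c M w)%:E).
have Xf w : (X c M w)%:E @[M --> \oo] --> f w.
  exact: ereal_nondecreasing_is_cvgn.
have mf : measurable_fun setT f.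
  apply: (emeasurable_fun_cvg (fun M w => (X c M w)%:E)) => // M.
  exact/measurable_EFinP.
have If : \int[P]_w f w = (\prod_k expR (- ((1 - c k) * L k)))%:E%R.
  rewrite monotone_convergence//.
  - by apply/cvg_lim => //; exact: EX_cvg.
  - by move=> M; exact/measurable_EFinP.
  - by move=> M w _; rewrite lee_fin X_ge0.
rewrite -If.
have [] // := @dominated_convergence _ _ _ P setT measurableT
  (fun M w => (\prod_(j < M) cell_weight c (p j w))%:E%R) f (cst 1).
- move=> M; apply/measurable_EFinP; apply: (@measurable_prod _ _ _ setT) => j _.
  by apply: measurableT_comp => //; exact: measurable_cell_weight.
- exists (~` F); split; first exact: measurableC.
    by have := @probability_setC _ _ _ P F mF; rewrite F_ae subee.
  apply: subsetC => w wF _; apply: cvg_trans (Xf w).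
  apply: near_eq_cvg; apply: filterS (Y_near c wF).
  by move=> M ->.
- exact: finite_measure_integrable_cst.
- apply: aeW => w M _; rewrite abse_EFin lee_fin ger0_norm.
    by apply: prodr_ile1 => j _; rewrite cell_weight_ge0//= cell_weight_le1.
  by apply: prodr_ge0 => j _; exact: cell_weight_ge0.
Unshelve. all: by end_near. Qed.

End poisson_laplace.

Section marked_poisson.
Context {R : realType} d (Omega : measurableType d) (P : probability Omega R).
Variables (Lambda : set R -> \bar R) (p : nat -> Omega -> R).
Hypothesis poisson : poisson_process P Lambda p.
Context {I : Type}.
Variable Zi : nat -> I -> Omega -> \bar R.
Hypothesis mZi : forall i, measurable_process (Zi i).
Hypothesis indep : independent_fields P (fun k =>
  if k is i.+1 then process_sigma (Zi i)
  else process_sigma (fun i w => (p i w)%:E)).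
Variables (n : nat) (B : 'I_n -> set R).
Hypothesis mB : forall k, measurable (B k).
Hypothesis tB : trivIset setT B.
Hypothesis Bfin : forall k, Lambda (B k) < +oo.
Variables (E : nat -> 'I_n -> set Omega) (c : 'I_n -> R).
Hypothesis EZ : forall j k, process_sigma (Zi j) (E j k).
Hypothesis PE : forall j k, P (E j k) = (c k)%:E.

Let mp i : measurable_fun setT (p i). Proof. by case: poisson. Qed.

Let cell (o : option 'I_n) : set R :=
  if o is Some k then B k else ~` \bigcup_k B k.

Let mark j (o : option 'I_n) : set Omega := if o is Some k then E j k else setT.

Let weight (o : option 'I_n) : R := if o is Some k then c k else 1%R.

Let index (x : R) : option 'I_n := [pick k | x \in B k].

Let cell_index x o : cell o x <-> index x = o.
Proof.
rewrite /index; case: pickP => [k /set_mem Bk|nB].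
  case: o => [k'|]; split => //=.
  - move=> Bk'; congr Some; move/trivIsetP : tB => /(_ k k' Logic.I Logic.I).
    case: eqVneq => // kk' /(_ isT) BB.
    by have : (B k `&` B k') x by []; rewrite BB.
  - by case=> <-.
  - by move=> /(_ (ex_intro2 _ _ k Logic.I Bk)).
case: o => [k|]; split => //=.
  by move=> /mem_set; rewrite nB.
by move=> _ [k _] /mem_set; rewrite nB.
Qed.

Let weight_index x : cell_weight B c x = weight (index x).
Proof.
rewrite /cell_weight /index; case: pickP => [k Bk|nB]; last first.
  by rewrite big1// => k _; rewrite nB.
rewrite (bigD1 k)//= Bk big1 ?mulr1// => k' k'k; rewrite ifF//.
apply/negbTE/negP => /set_mem Bk'; move/set_mem: Bk => Bk.
by have /cell_index := Bk' : cell (Some k') x;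
  have /cell_index -> := Bk : cell (Some k) x; case => kk';
  rewrite kk' eqxx in k'k.
Qed.

Let mcell o : measurable (cell o).
Proof.
case: o => [k|] /=; first exact: mB.
by apply: measurableC; apply: fin_bigcup_measurable => // k _; exact: mB.
Qed.

Let mmark j o : measurable (mark j o).
Proof.
case: o => [k|] //=; have [A mA <-] := EZ j k.
exact: path_event_measurable.
Qed.

Lemma measurable_marked_point j :
  measurable [set w | forall k, B k (p j w) -> E j k w].
Proof.
rewrite (_ : mkset _ = \bigcap_(k : 'I_n) (~` (p j @^-1` B k) `|` E j k)).
  apply: fin_bigcap_measurable => // k _; apply: measurableU.
    by apply: measurableC; rewrite -[X in measurable X]setTI; exact: mp.
  exact: (mmark j (Some k)).
apply/seteqP; split => w /= wBE k.
  by move=> _; have [/wBE|] := pselect (B k (p j w)); [right|left].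
by case: (wBE k Logic.I).
Qed.

Section finitely_many_points.
Variable J : nat.

Let config (f : 'I_J -> option 'I_n) : set Omega :=
  \bigcap_(j : 'I_J) [set w | cell (f j) (p j w)].

Let mconfig f : measurable (config f).
Proof.
apply: fin_bigcap_measurable => // j _.
rewrite -[X in measurable X]setTI; exact: mp.
Qed.

Let configP f w : config f w <-> forall j : 'I_J, index (p j w) = f j.
Proof. by split=> [h j|h j _]; apply/cell_index; [exact: h|exact: h]. Qed.

Let sum_config (g : {ffun 'I_J -> option 'I_n} -> R) w :
  (\sum_f g f * \1_(config f) w = g [ffun j : 'I_J => index (p j w)])%R.
Proof.
rewrite (bigD1 [ffun j : 'I_J => index (p j w)])//= indicE mem_set; last first.
  by apply/configP => j; rewrite ffunE.
rewrite mulr1 big1 ?addr0// => f fw; rewrite indicE memNset ?mulr0//.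
move=> /configP wf; move/eqP : fw; apply; apply/ffunP => j.
by rewrite ffunE wf.
Qed.

(** The cells of the points are determined by the field of the points, so the
    marks prescribed in each cell are independent of them and of each other. *)
Let config_mark (f : 'I_J -> option 'I_n) :
  P (config f `&` \bigcap_(j : 'I_J) mark j (f j)) =
  P (config f) * (\prod_(j < J) weight (f j))%:E%R.
Proof.
pose f' j := if insub j is Some i then f i else None.
have f'E (j : 'I_J) : f' j = f j by rewrite /f' valK.
pose ev k := if k is j.+1 then mark j (f' j) else config f.
pose K := [fset k in iota 0 J.+1]%fset.
have := indep (J := K) (E := ev).
have -> : \bigcap_(k in [set` K]) ev k = config f `&` \bigcap_(j : 'I_J) mark j (f j).
  apply/seteqP; split => w /=.
    move=> wK; split; first by apply: (wK 0%N); rewrite /= !inE.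
    move=> j _; rewrite -f'E; apply: (wK j.+1).
    by rewrite /= !inE/= mem_iota/= add1n ltnS.
  move=> [w0 wm] [|j]; rewrite /= !inE//= mem_iota/= add1n ltnS => jJ.
  by have := wm (Ordinal jJ) Logic.I; rewrite /= -(f'E (Ordinal jJ)).
have -> : \prod_(k <- K) P (ev k) = \prod_(0 <= k < J.+1) P (ev k).
  apply: perm_big; apply: uniq_perm; rewrite ?fset_uniq ?iota_uniq//.
  by move=> k; rewrite /index_iota subn0 !inE.
rewrite big_nat_recl//= big_mkord => ->.
  congr (_ * _); rewrite -prodEFin; apply: eq_bigr => j _.
  by rewrite f'E; case: (f j) => [k|] /=; [exact: PE|exact: probability_setT].
move=> [_|j _] /=.
  exists (\bigcap_(j : 'I_J) [set g : nat -> \bar R | (EFin @` cell (f j)) (g j)]).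
    rewrite eval_sigmaE; apply: fin_bigcap_measurable => // j _.
    apply: sub_sigma_algebra; exists (j : nat), (EFin @` cell (f j)); split => //.
    by apply: measurable_image_EFin; exact: mcell.
  apply/seteqP; split => w /= wj j _.
    by have [x xj [xE]] := wj j Logic.I; rewrite /= -xE.
  by exists (p j w) => //; exact: wj.
case: (f' j) => [k|] /=; first exact: EZ.
by exists setT => //; rewrite eval_sigmaE; exact: measurableT.
Qed.

(** By conditioning on the cells of the first [J] points. *)
Lemma marked_points_finite :
  P (\bigcap_(j in [set j | (j < J)%N]) [set w | forall k, B k (p j w) -> E j k w]) =
  \int[P]_w (\prod_(j < J) cell_weight B c (p j w))%:E%R.
Proof.
set S := \bigcap_(j in _) _.
have SE f : config f `&` S = config f `&` \bigcap_(j : 'I_J) mark j (f j).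
  apply/seteqP; split => w [] wf wS; split => //.
    move=> j _; have := wS j (ltn_ord j).
    have /= := wf j Logic.I; case: (f j) => [k|]//= Bk; exact.
  move=> j /= jJ k Bk; have := wS (Ordinal jJ) Logic.I.
  have /configP/(_ (Ordinal jJ)) <- /= := wf.
  by have /cell_index -> : cell (Some k) (p j w) by [].
have mS : measurable S.
  by apply: bigcap_measurableType => j _; exact: measurable_marked_point.
have mSf (f : {ffun 'I_J -> option 'I_n}) : measurable (config f `&` S).
  rewrite SE; apply: measurableI => //.
  by apply: fin_bigcap_measurable => // j _; exact: mmark.
transitivity (\sum_(f : {ffun 'I_J -> option 'I_n}) P (config f `&` S)).
  have -> : P S = \int[P]_w (\1_S w)%:E by rewrite integral_indic// setIT.
  have S1 w : (\1_S w = \sum_(f : {ffun 'I_J -> option 'I_n})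
      \1_S w * \1_(config f) w :> R)%R by rewrite (sum_config (fun=> \1_S w) w).
  under eq_integral do rewrite S1 -sumEFin.
  rewrite ge0_integral_sum//; last first.
    by move=> f; apply/measurable_EFinP; apply: measurable_funM => //;
      exact: measurable_indic.
  apply: eq_bigr => f _; rewrite -[config f `&` S]setIT -integral_indic//.
  apply: eq_integral => w _; rewrite setIC indicI; congr EFin.
have c0 o : (0 <= weight o)%R.
  by case: o => [k|]//=; rewrite -lee_fin -(PE 0%N k).
rewrite (eq_bigr (fun f : {ffun 'I_J -> option 'I_n} =>
    P (config f) * (\prod_(j < J) weight (f j))%:E%R)); last first.
  by move=> f _; rewrite SE config_mark.
under [RHS]eq_integral.
  move=> w _; under eq_bigr do rewrite weight_index.
  rewrite (eq_bigr (fun j : 'I_J => weight ([ffun j : 'I_J => index (p j w)] j)));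
    last by move=> j _; rewrite ffunE.
  rewrite -(sum_config (fun f => \prod_(j < J) weight (f j))%R) -sumEFin.
  over.
rewrite ge0_integral_sum//; last 2 first.
- move=> f; apply/measurable_EFinP; apply: measurable_funM => //.
- by move=> f w _; rewrite lee_fin mulr_ge0// prodr_ge0.
apply: eq_bigr => f _; under [RHS]eq_integral do rewrite EFinM.
rewrite ge0_integralZl//; last 2 first.
- exact/measurable_EFinP/measurable_indic.
- by rewrite lee_fin prodr_ge0.
by rewrite integral_indic// setIT muleC.
Qed.

End finitely_many_points.

(** Each point carries an event that is drawn independently given its cell;
    the probability that none of the prescribed events fails is the generating
    functional of the points at the success probabilities. *)
Lemma marked_points :
  P (\bigcap_j [set w | forall k, B k (p j w) -> E j k w]) =
  (\prod_k expR (- ((1 - c k) * fine (Lambda (B k)))))%:E%R.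
Proof.
have c01 k : (0 <= c k <= 1)%R.
  by rewrite -!lee_fin -(PE 0%N k) measure_ge0 probability_le1//; exact: (mmark 0 (Some k)).
pose G j := [set w | forall k, B k (p j w) -> E j k w].
pose S J := \bigcap_(j in [set j | (j < J)%N]) G j.
have mS J : measurable (S J).
  by apply: bigcap_measurableType => j _; exact: measurable_marked_point.
have SG : \bigcap_j G j = \bigcap_J S J.
  apply/seteqP; split => w /= wG; first by move=> J _ j _; exact: wG.
  by move=> j _; apply: (wG j.+1) => //=.
rewrite [X in P X]SG.
have SP : P (S J) @[J --> \oo] --> P (\bigcap_J S J).
  apply: nonincreasing_cvg_mu => //.
  - by rewrite (le_lt_trans (probability_le1 _ _)) ?ltry.
  - exact: bigcap_measurableType.
  - move=> i j ij; apply/subsetPset => w wS k /= ki; apply: wS => /=.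
    exact: leq_trans ki ij.
apply: cvg_unique SP _ => //.
have := poisson_cell_weight poisson mB tB Bfin c01.
by under eq_fun do rewrite -marked_points_finite.
Qed.

End marked_poisson.

(** * Void probabilities of the marked process *)

Section exp_intensity.
Context {R : realType}.

(** Up to a factor, the intensity on the ray is a shifted exponential density. *)
Lemma exp_intensity_ray (a : R) : exp_intensity `[a, +oo[%classic = (expR (- a))%:E.
Proof.
have := @integral_exponential_pdf R 1%R ltr01.
have mpdf : measurable_fun setT (EFin \o @exponential_pdf R 1%R).
  by apply/measurable_EFinP; exact: measurable_exponential_pdf.
rewrite -(ge0_integral_lebesgue_translate a mpdf); last first.
  by move=> x; rewrite lee_fin exponential_pdf_ge0.
rewrite (_ : \int[_]_x _ = (expR a)%:E * exp_intensity `[a, +oo[%classic).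
  move=> aE; rewrite -[LHS]mul1e -expR0 -(addNr a) expRD EFinM -muleA aE.
  by rewrite mule1.
rewrite /exp_intensity -ge0_integralZl//; last first.
  by apply/measurable_EFinP; apply: measurable_funTS; exact: measurableT_comp.
rewrite [RHS]integral_mkcond.
apply: eq_integral => x _; rewrite /= /exponential_pdf !patchE.
have -> : (x - a \in `[0, +oo[%classic)%R = (x \in `[a, +oo[%classic).
  by apply/idP/idP; rewrite !inE/= !in_itv/= !andbT subr_ge0.
case: ifP => _ //.
by rewrite mul1r mulN1r opprB -EFinM expRD.
Qed.

Lemma exp_intensity_open_ray (a : R) :
  exp_intensity `]a, +oo[%classic = (expR (- a))%:E.
Proof.
rewrite -exp_intensity_ray /exp_intensity integral_itv_obnd_cbnd//.
apply: measurable_funTS; apply/measurable_EFinP; exact: measurableT_comp.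
Qed.

Lemma exp_intensity_fin (a : R) (B : set R) : measurable B ->
  (forall x, B x -> (a <= x)%R) -> exp_intensity B < +oo.
Proof.
move=> mB aB; apply: (@le_lt_trans _ _ (exp_intensity `[a, +oo[%classic)); last first.
  by rewrite exp_intensity_ray ltry.
apply: ge0_subset_integral => //.
- by apply: measurable_funTS; apply/measurable_EFinP; exact: measurableT_comp.
- by move=> x /aB; rewrite /= in_itv/= andbT.
Qed.

(** Rescaling the points [expR x] by [r] rescales the intensity by [r]. *)
Lemma integral_exceedance (r : R) : (0 <= r)%R ->
  \int[lebesgue_measure]_x
    ((\1_[set x : R | (1 < expR x * r)%R] x)%:E * (expR (- x))%:E) = r%:E.
Proof.
rewrite le_eqVlt => /predU1P[<-|r0].
  apply: integral0_eq => x _; rewrite indicE memNset ?mul0e//=.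
  by rewrite mulr0 ltr10.
have rE : expR (- - ln r)%R = r by rewrite opprK lnK// posrE.
rewrite -[in RHS]rE -exp_intensity_open_ray /exp_intensity.
rewrite [RHS]integral_mkcond; apply: eq_integral => x _.
rewrite patchE indicE.
have rx : (1 < expR x * r)%R = (- ln r < x)%R.
  by rewrite -[X in (expR x * X)%R]rE -expRD expR_gt1 opprK -ltrBlDr sub0r.
have -> : (x \in [set x | (1 < expR x * r)%R]) = (x \in `](- ln r)%R, +oo[%classic).
  by apply/idP/idP; rewrite !inE/= in_itv/= andbT rx.
by case: ifP => _; rewrite ?mul1e ?mul0e.
Qed.

End exp_intensity.

Section ereal_exp_limits.
Context {R : realType}.

(** The decreasing map [x |-> expeR (- x)], onto the nonnegative extended reals,
    exchanges suprema and infima. *)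
Lemma expeRN_limit (a b : nat -> \bar R) (l : \bar R) :
  (forall n, b n = expeR (- a n)) -> nondecreasing_seq a ->
  a @ \oo --> l -> b @ \oo --> expeR (- l).
Proof.
move=> bE nda al.
have ndb : nonincreasing_seq b.
  by move=> m n mn; rewrite !bE lee_expeR leeN2; exact: nda.
have -> : l = ereal_sup (range a).
  by rewrite -(cvg_lim _ al)//; apply/cvg_lim => //; exact: ereal_nondecreasing_cvgn.
rewrite (_ : expeR _ = ereal_inf (range b)); first exact: ereal_nonincreasing_cvgn.
apply/eqP; rewrite eq_le; apply/andP; split.
  apply: le_ereal_inf_tmp => _ [n _ <-]; rewrite bE lee_expeR leeN2.
  by apply: ereal_sup_ubound; exists n.
have [y yE] : exists y, expeR y = ereal_inf (range b).
  apply: expeR_total; apply: le_ereal_inf_tmp => _ [n _ <-].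
  by rewrite bE expeR_ge0.
rewrite -yE lee_expeR leeNr; apply: ge_ereal_sup => _ [n _ <-].
rewrite leeNr -lee_expeR yE -bE.
by apply: ereal_inf_lbound; exists n.
Qed.

End ereal_exp_limits.

Section max_stable_law.
Context {R : realType} {I : Type}.
Context d (Omega : measurableType d) (P : probability Omega R).
Variable Z : I -> Omega -> \bar R.
Hypothesis mZ : measurable_process Z.
Context d' (Omega' : measurableType d') (P' : probability Omega' R).
Variables (p : nat -> Omega' -> R) (Zi : nat -> I -> Omega' -> \bar R).
Hypothesis ingr : max_stable_ingredients P Z P' p Zi.

Section functional.
Variable y : path_space R I -> \bar R.
Hypothesis my : measurable_fun setT y.
Hypothesis y0 : forall f, 0 <= y f.
Hypothesis yfin : forall w, y (Z^~ w) < +oo.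
Import HBNNSimple.

Let yZ w := y (Z^~ w).

Let myZ : measurable_fun setT yZ.
Proof. by apply: (measurableT_comp my); apply/measurable_path. Qed.

Let mexceed (r : R) : measurable [set w | r%:E * yZ w <= 1].
Proof.
rewrite (_ : mkset _ = (fun w => r%:E * yZ w) @^-1` [set` `]-oo, 1]]).
  rewrite -[X in measurable X]setTI; apply: emeasurable_funM => //.
  exact: emeasurable_itv.
by apply/seteqP; split => w /=; rewrite in_itv.
Qed.

Let mexceed' (r : R) : measurable [set w | 1 < r%:E * yZ w].
Proof.
rewrite (_ : mkset _ = ~` [set w | r%:E * yZ w <= 1]); first exact: measurableC.
by apply/seteqP; split => w /=; rewrite ltNge => /negP.
Qed.

Let tail (g : R -> R) : \bar R := \int[lebesgue_measure]_x
  (P [set w | 1 < (g x)%:E * yZ w] * (expR (- x))%:E).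

(** For a simple [g], whether a mark exceeds the level depends on its point only
    through the cell where [g] takes a given value. *)
Let void_simple (g : {nnsfun R >-> R}) : (forall x, g x <= expR x)%R ->
  P' (\bigcap_j [set w | (g (p j w))%:E * y (Zi j ^~ w) <= 1]) = expeR (- tail g).
Proof.
move=> ge; have [poisson mZi lawZ indep] := ingr.
pose s : seq R := (fset_set (range g) `\ 0%R)%fset.
have sP v : v \in s = (v != 0%R) && (v \in range g).
  by rewrite !inE in_fset_set//.
pose n := size s; pose v (k : 'I_n) := s`_k.
have vs k : v k \in s by apply: mem_nth.
have v0 k : (0 < v k)%R.
  have := vs k; rewrite sP => /andP[vn0 /set_mem[x _ gx]].
  by rewrite lt_def vn0 -gx fun_ge0.
have vinj : injective v.
  by move=> k l /eqP; rewrite nth_uniq ?fset_uniq// => /eqP kl; exact: val_inj.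
have vsurj x : g x != 0%R -> exists k, g x = v k.
  move=> gx0; have gs : g x \in s by rewrite sP gx0 inE; exists x.
  by exists (Ordinal (etrans (index_mem _ _) gs)); rewrite /v/= nth_index.
pose B k := g @^-1` [set v k].
have mB k : measurable (B k) by rewrite -[X in measurable X]setTI; exact: measurable_funP.
have tB : trivIset setT B.
  apply/trivIsetP => k l _ _ kl; apply/seteqP; split => // x [] /= gk gl.
  by move: kl; rewrite (vinj k l) ?eqxx// -gk -gl.
have Bfin k : exp_intensity (B k) < +oo.
  apply: (exp_intensity_fin (a := ln (v k))) => // x /= gx.
  by rewrite -ler_expR lnK ?posrE// -gx; exact: ge.
pose E j k := [set w | (v k)%:E * y (Zi j ^~ w) <= 1].
pose c k := fine (P [set w | (v k)%:E * yZ w <= 1]).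
pose A k := [set f : path_space R I | (v k)%:E * y f <= 1].
have mA k : eval_sigma (A k).
  rewrite eval_sigmaE (_ : A k = (fun f => (v k)%:E * y f) @^-1` [set` `]-oo, 1]]).
    rewrite -[X in measurable X]setTI; apply: emeasurable_funM => //.
    exact: emeasurable_itv.
  by apply/seteqP; split => f /=; rewrite in_itv.
have EZ j k : process_sigma (Zi j) (E j k) by exists (A k).
have PE j k : P' (E j k) = (c k)%:E.
  rewrite -[LHS]/(P' (path_event (Zi j) (A k))) lawZ// /c fineK//.
  exact: fin_num_measure.
have := marked_points poisson mZi indep mB tB Bfin EZ PE.
rewrite (_ : \bigcap_j _ = \bigcap_j [set w | (g (p j w))%:E * y (Zi j ^~ w) <= 1]); last first.
  apply: eq_bigcapr => j _; apply/seteqP; split => w /= gE.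
    have [->|/vsurj[k gk]] := eqVneq (g (p j w)) 0%R; first by rewrite mul0e lee01.
    by rewrite gk; apply: gE.
  by move=> k gk; move: gE; rewrite gk.
move=> ->; rewrite -expR_sum -[LHS]/(expeR _%:E); congr expeR.
rewrite sumrN EFinN; congr (- _); rewrite /tail -sumEFin.
have c1 k : (0 <= 1 - c k)%R.
  by rewrite subr_ge0 -lee_fin /c fineK ?probability_le1// fin_num_measure.
rewrite [RHS](_ : _ = \int[lebesgue_measure]_x
    (\sum_(k < n) (\1_(B k) x * (1 - c k))%:E%R * (expR (- x))%:E)); last first.
  apply: eq_integral => x _; rewrite -ge0_sume_distrl; last first.
    by move=> k _; rewrite lee_fin mulr_ge0.
  congr (_ * _); rewrite sumEFin.
  have [gx0|/vsurj[k gk]] := eqVneq (g x) 0%R.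
    rewrite big1 ?gx0 => [|k _]; last first.
      rewrite indicE memNset ?mul0r// => /= gk.
      by have := v0 k; rewrite -gk gx0 ltxx.
    rewrite (_ : mkset _ = set0) ?measure0//; apply/seteqP; split => // w /=.
    by rewrite mul0e ltNge lee01.
  rewrite (bigD1 k)//= big1 => [|l lk]; last first.
    rewrite indicE memNset ?mul0r// => /= gl.
    by move: lk; rewrite (vinj l k) ?eqxx// -gl -gk.
  rewrite addr0 indicE mem_set// mul1r gk.
  rewrite (_ : mkset _ = ~` [set w | (v k)%:E * yZ w <= 1]); last first.
    by apply/seteqP; split => w /=; rewrite ltNge => /negP.
  rewrite probability_setC// EFinB /c fineK//.
  exact: fin_num_measure.
rewrite ge0_integral_sum//; last 2 first.
- move=> k; apply: emeasurable_funM; apply/measurable_EFinP.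
    by apply: measurable_funM => //; apply: measurable_indic; exact: mB.
  exact: measurableT_comp.
- by move=> k x _; rewrite mule_ge0// lee_fin ?expR_ge0// mulr_ge0.
apply: eq_bigr => k _.
under [RHS]eq_integral do rewrite -EFinM mulrC mulrA mulrC EFinM.
rewrite ge0_integralZl//; last 2 first.
- apply/measurable_EFinP; apply: measurable_funM; last first.
    by apply: measurable_indic; exact: mB.
  exact: measurableT_comp.
- by rewrite lee_fin.
rewrite EFinM; congr (_ * _).
rewrite fineK; last by rewrite ge0_fin_numE ?Bfin//; apply: integral_ge0 => x _; rewrite lee_fin expR_ge0.
rewrite /exp_intensity [LHS]integral_mkcond; apply: eq_integral => x _.
rewrite patchE indicE; case: ifP => _; first by rewrite mulr1.
by rewrite mulr0.
Qed.

Let exceed (g : R -> R) : set (measurableTypeR R * Omega) :=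
  [set xw | 1 < (g xw.1)%:E * yZ xw.2].

Let T (g : R -> R) (xw : measurableTypeR R * Omega) : \bar R :=
  (\1_(exceed g) xw)%:E * (expR (- xw.1))%:E.

Let T_ge0 g xw : 0 <= T g xw.
Proof. by rewrite mule_ge0// lee_fin// expR_ge0. Qed.

Let mT g : measurable_fun setT g -> measurable_fun setT (T g).
Proof.
move=> mg; apply: emeasurable_funM; apply/measurable_EFinP; last first.
  apply: measurableT_comp => //; apply: measurableT_comp => //.
apply: measurable_indic.
rewrite (_ : exceed g = (fun xw => (g xw.1)%:E * yZ xw.2) @^-1` [set` `]1, +oo[]).
  rewrite -[X in measurable X]setTI.
  apply: emeasurable_funM => //; last exact: emeasurable_itv.
    by apply/measurable_EFinP; exact: measurableT_comp.
  exact: measurableT_comp.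
by apply/seteqP; split => xw /=; rewrite in_itv/= andbT.
Qed.

Let tailE (g : R -> R) : measurable_fun setT g ->
  tail g = \int[lebesgue_measure \x P]_xw T g xw.
Proof.
move=> mg; rewrite (fubini_tonelli1 (T g))//; last exact: mT.
apply: eq_integral => x _; rewrite /fubini_F /T.
under eq_integral do rewrite /= muleC.
rewrite ge0_integralZl//; last first.
  apply/measurable_EFinP; rewrite (_ : (fun _ => _) = \1_[set w | 1 < (g x)%:E * yZ w]).
    by apply: measurable_indic; exact: mexceed'.
  by apply/funext => w; rewrite !indicE.
rewrite muleC; congr (_ * _); rewrite -[X in P X]setIT -integral_indic//.
Qed.

Let tail_expR : tail expR = \int[P]_w yZ w.
Proof.
rewrite tailE// fubini_tonelli2//; last exact: mT.
apply: eq_integral => w _; rewrite /fubini_G /T.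
have yw : yZ w \is a fin_num by rewrite ge0_fin_numE ?yfin//; exact: y0.
rewrite -[RHS](fineK yw) -integral_exceedance ?fine_ge0 ?y0//.
apply: eq_integral => x _; congr (_%:E * _); rewrite !indicE; congr ((nat_of_bool _)%:R).
have xyE : (1 < (expR x)%:E * yZ w) = (1 < expR x * fine (yZ w))%R.
  by rewrite -lte_fin EFinM fineK.
by apply/idP/idP; rewrite !inE /exceed/= xyE.
Qed.

(** The points of the process with mark [f] beyond level one are those with
    [expR p * y f > 1]; their number has mean [E y]. This is obtained for
    simple functions of [p] first, which then increase to [expR]. *)
Lemma void_probability :
  P' (\bigcap_j [set w | (expR (p j w))%:E * y (Zi j ^~ w) <= 1]) =
  expeR (- \int[P]_w yZ w).
Proof.
have [poisson mZi lawZ indep] := ingr.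
have mexp : measurable_fun setT (EFin \o @expR R).
  by apply/measurable_EFinP.
pose g := nnsfun_approx measurableT mexp.
have g_cvg x : (g n x)%:E @[n --> \oo] --> (expR x)%:E.
  apply: (@cvg_nnsfun_approx _ _ _ _ measurableT _ mexp) => // z _.
  by rewrite lee_fin expR_ge0.
have ndg x : nondecreasing_seq (fun n => g n x).
  by move=> m n mn; exact/lefP/nd_nnsfun_approx.
have g_le n x : (g n x <= expR x)%R.
  rewrite -lee_fin -(cvg_lim _ (g_cvg x))//.
  apply: lime_ge; first by apply/cvg_ex; exists (expR x)%:E.
  by exists n => // m /= nm; rewrite lee_fin; exact: ndg.
have gy x (r : \bar R) : 0 <= r ->
    (expR x)%:E * r <= 1 <-> forall n, (g n x)%:E * r <= 1.
  move=> r0; split => [h n|h].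
    by apply: le_trans h; rewrite lee_wpmul2r// lee_fin.
  case: r r0 h => [r| |] // r0 h.
    have gr : (g n x)%:E * r%:E @[n --> \oo] --> (expR x)%:E * r%:E.
      exact: cvgeZr.
    rewrite -(cvg_lim _ gr)//; apply: lime_le.
      by apply/cvg_ex; exists ((expR x)%:E * r%:E).
    exact: nearW.
  have [n gn] : exists n, (0 < g n x)%R.
    apply: contrapT => /forallNP gn; have : (expR x)%:E <= 0.
      rewrite -(cvg_lim _ (g_cvg x))//; apply: lime_le.
        by apply/cvg_ex; exists (expR x)%:E.
      by apply: nearW => n; rewrite lee_fin leNgt; apply/negP/gn.
    by rewrite lee_fin leNgt expR_gt0.
  by have := h n; rewrite gt0_muley ?lte_fin.
pose S n := \bigcap_j [set w | (g n (p j w))%:E * y (Zi j ^~ w) <= 1].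
have mS n : measurable (S n).
  apply: bigcap_measurableType => j _.
  rewrite (_ : mkset _ = (fun w => (g n (p j w))%:E * y (Zi j ^~ w)) @^-1` [set` `]-oo, 1]]).
    rewrite -[X in measurable X]setTI; apply: emeasurable_funM => //.
    - apply/measurable_EFinP; apply: measurableT_comp => //.
      by case: poisson.
    - by apply: (measurableT_comp my); apply/measurable_path.
    - exact: emeasurable_itv.
  by apply/seteqP; split => w /=; rewrite in_itv.
rewrite (_ : \bigcap_j _ = \bigcap_n S n); last first.
  apply/seteqP; split => w /= h.
    move=> n _ j _; have /gy := h j Logic.I; exact.
  by move=> j _; apply/gy => // n; exact: (h n Logic.I).
have SP : P' (S n) @[n --> \oo] --> P' (\bigcap_n S n).
  apply: nonincreasing_cvg_mu => //.
  - by rewrite (le_lt_trans (probability_le1 _ _)) ?ltry.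
  - exact: bigcap_measurableType.
  - move=> m n mn; apply/subsetPset => w wS j _; apply: le_trans (wS j Logic.I).
    by rewrite /= lee_wpmul2r// lee_fin; exact: ndg.
apply: cvg_unique SP _ => //.
have mono x w m n : (m <= n)%N -> T (g m) (x, w) <= T (g n) (x, w).
  move=> mn; rewrite lee_wpmul2r ?lee_fin ?expR_ge0// !indicE ler_nat.
  have [/set_mem h|//] := boolP ((x, w) \in exceed (g m)).
  rewrite mem_set//; apply: lt_le_trans h _.
  by rewrite lee_wpmul2r ?y0// lee_fin; exact: ndg.
apply: (@expeRN_limit _ (fun n => tail (g n))).
- by move=> n; rewrite -void_simple.
- move=> m n mn; rewrite !tailE//; apply: ge0_le_integral => //.
  - exact: mT.
  - exact: mT.
  by move=> [x w] _; exact: mono.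
rewrite -tail_expR tailE//.
under eq_fun do rewrite tailE//.
rewrite (_ : \int[_]_xw T expR xw =
  \int[lebesgue_measure \x P]_xw limn (fun n => T (g n) xw)); last first.
  apply: eq_integral => -[x w] _; apply/esym/cvg_lim => //.
  apply: cvgeZr => //.
  have [h|h] := pselect (exceed expR (x, w)); last first.
    rewrite indicE memNset//; apply: cvg_near_cst; apply: nearW => n.
    rewrite indicE memNset//; apply: contra_not h; rewrite /exceed/= => h.
    by apply: lt_le_trans h _; rewrite lee_wpmul2r ?y0// lee_fin.
  have [n0 hn] : exists n, exceed (g n) (x, w).
    apply: contrapT => /forallNP hn; move: h; rewrite /exceed/= ltNge => /negP; apply.
    by apply/gy => [|n]; rewrite ?y0// leNgt; apply/negP/hn.
  rewrite indicE mem_set//; apply: cvg_near_cst; exists n0 => // n /= n0n.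
  rewrite indicE mem_set//; apply: lt_le_trans hn _.
  by rewrite lee_wpmul2r ?y0// lee_fin; exact: ndg.
apply: cvg_monotone_convergence => //.
- by move=> n; exact: mT.
- by move=> [x w] _ m n mn; exact: mono.
Qed.

End functional.
End max_stable_law.

(** * Finite-dimensional laws of the max-stable process *)

Section density.
Context {R : realType} d (T : measurableType d) (mu : {measure set T -> \bar R}).
Import HBNNSimple.

Definition density (f : T -> \bar R) (mf : measurable_fun setT f)
  (f0 : forall x, 0 <= f x) : set T -> \bar R :=
  fun A => \int[mu]_(x in A) f x.

Section density_measure.
Variables (f : T -> \bar R) (mf : measurable_fun setT f) (f0 : forall x, 0 <= f x).

Let density0 : density mf f0 set0 = 0.
Proof. by rewrite /density integral_set0. Qed.

Let density_ge0 A : 0 <= density mf f0 A.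
Proof. by apply: integral_ge0 => x _. Qed.

Let density_additive : semi_sigma_additive (density mf f0).
Proof. exact: semi_sigma_additive_nng_induced. Qed.

HB.instance Definition _ := isMeasure.Build _ _ _ (density mf f0)
  density0 density_ge0 density_additive.

Lemma ge0_integral_density (g : T -> \bar R) : (forall x, f x < +oo) ->
  measurable_fun setT g -> (forall x, 0 <= g x) ->
  \int[density mf f0]_x g x = \int[mu]_x (f x * g x).
Proof.
move=> foo mg g0.
pose h := nnsfun_approx measurableT mg.
have hg x : (h n x)%:E @[n --> \oo] --> g x.
  exact: (@cvg_nnsfun_approx _ _ _ _ measurableT _ mg).
have ndh x : {homo (fun n => h n x) : m n / (m <= n)%N >-> (m <= n)%R}.
  by move=> m n mn; exact/lefP/nd_nnsfun_approx.
have ffin x : f x \is a fin_num by rewrite ge0_fin_numE.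
transitivity (limn (fun n => \int[density mf f0]_x (h n x)%:E)).
  rewrite -monotone_convergence//.
  - by apply: eq_integral => x _; apply/esym/cvg_lim.
  - by move=> n; exact/measurable_EFinP.
  - by move=> n x _; rewrite lee_fin.
  - by move=> x _ m n mn; rewrite lee_fin; exact: ndh.
transitivity (limn (fun n => \int[mu]_x (f x * (h n x)%:E))); last first.
  rewrite -monotone_convergence//.
  - apply: eq_integral => x _; apply/cvg_lim => //.
    exact: cvgeZl.
  - by move=> n; apply: emeasurable_funM => //; exact/measurable_EFinP.
  - by move=> n x _; rewrite mule_ge0// lee_fin.
  - by move=> x _ m n mn; rewrite lee_wpmul2l// lee_fin; exact: ndh.
congr (limn _); apply/funext => n.
have mh r : measurable (h n @^-1` [set r]).
  by rewrite -[X in measurable X]setTI; exact: measurable_funP.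
rewrite integralT_nnsfun sintegralE.
rewrite (eq_integral (fun x =>
  \sum_(r \in range (h n)) (r%:E * (f x * (\1_(h n @^-1` [set r]) x)%:E)))); last first.
  move=> x _; rewrite [in LHS]fimfunE -fsumEFin// ge0_mule_fsumr.
    by apply: eq_fsbigr => r _; rewrite EFinM muleCA.
  by move=> r; rewrite lee_fin; exact: nnfun_muleindic_ge0.
rewrite ge0_integral_fsum//; last 2 first.
- move=> r; apply: emeasurable_funM => //; apply: emeasurable_funM => //.
  by apply/measurable_EFinP; exact: measurable_indic.
- move=> r x _; rewrite muleCA -EFinM mule_ge0// lee_fin.
  exact: nnfun_muleindic_ge0.
apply: eq_fsbigr => r; rewrite inE => -[x _ hx].
rewrite ge0_integralZl//; last 3 first.
- apply: emeasurable_funM => //.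
  by apply/measurable_EFinP; exact: measurable_indic.
- by move=> z _; rewrite mule_ge0// lee_fin.
- by rewrite lee_fin -hx.
congr (_ * _); rewrite /= /density integral_mkcond; apply: eq_integral => z _.
by rewrite patchE indicE; case: ifP => _; rewrite ?mule1 ?mule0.
Qed.

End density_measure.
End density.

Section bigmax_tools.
Context {R : realType}.

Lemma measurable_bigmaxe d (T : measurableType d) (J : Type) (s : seq J)
    (h : J -> T -> \bar R) : (forall i, measurable_fun setT (h i)) ->
  measurable_fun setT (fun x => \big[maxe/0]_(i <- s) h i x).
Proof.
move=> mh; elim: s => [|i s IH].
  under eq_fun do rewrite big_nil.
  exact: measurable_cst.
under eq_fun do rewrite big_cons.
exact: measurable_maxe.
Qed.

Lemma bigmaxe_ge0 (J : Type) (s : seq J) (h : J -> \bar R) :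
  0 <= \big[maxe/0]_(i <- s) h i.
Proof.
by elim: s => [|i s IH]; rewrite ?big_nil// big_cons le_max IH orbT.
Qed.

Lemma bigmaxe_lty (J : Type) (s : seq J) (h : J -> \bar R) :
  (forall i, h i < +oo) -> \big[maxe/0]_(i <- s) h i < +oo.
Proof. by move=> hoo; elim/big_ind : _ => // x y xoo yoo; rewrite gt_max xoo. Qed.

End bigmax_tools.

Section max_stable_cdf.
Context {R : realType} {I : Type}.
Context d (Omega : measurableType d) (P : probability Omega R).
Variable Z : I -> Omega -> \bar R.
Hypothesis mZ : measurable_process Z.
Hypothesis Zoo : forall t w, Z t w < +oo.
Context d' (Omega' : measurableType d') (P' : probability Omega' R).
Variables (p : nat -> Omega' -> R) (Zi : nat -> I -> Omega' -> \bar R).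
Hypothesis ingr : max_stable_ingredients P Z P' p Zi.

(** The event says that no marked point exceeds the level one for the functional
    [max_i exp (- x_i + f (t_i))]. *)
Lemma max_stable_cdf n (t : 'I_n -> I) (x : 'I_n -> R) :
  P' (\bigcap_i [set w | max_stable p Zi (t i) w <= (x i)%:E]) =
  expeR (- \int[P]_w \big[maxe/0]_(i < n) ((expR (- x i))%:E * expeR (Z (t i) w))).
Proof.
pose y (f : path_space R I) := \big[maxe/0]_(i < n) ((expR (- x i))%:E * expeR (f (t i))).
have my : measurable_fun setT y.
  apply: measurable_bigmaxe => i; apply: emeasurable_funM => //.
  by apply: measurable_expeR; exact: measurable_eval.
have y0 f : 0 <= y f by exact: bigmaxe_ge0.
have yoo w : y (Z^~ w) < +oo.
  apply: bigmaxe_lty => i; rewrite lte_mul_pinfty ?lee_fin ?expR_ge0//.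
  by rewrite ltey expeR_eqy -ltey.
have := void_probability mZ ingr my y0 yoo => <-; congr (P' _).
have pointwise (a b : R) (z : \bar R) :
    (b%:E + z <= a%:E) = ((expR b)%:E * ((expR (- a))%:E * expeR z) <= 1).
  rewrite -lee_expeR expeRD /= muleCA -[in RHS]lee_pdivlMl ?expR_gt0//.
  by rewrite mule1 expRN invrK.
apply/seteqP; split => w /=.
  move=> wx j _; rewrite /= -lee_pdivlMl ?expR_gt0// mule1; apply/bigmax_leP; split.
    by rewrite lee_fin invr_ge0 expR_ge0.
  move=> i _; rewrite -[leRHS]mule1 lee_pdivlMl ?expR_gt0// -pointwise.
  apply: le_trans (wx i Logic.I); apply: ereal_sup_ubound; by exists j.
move=> wy i _ /=; apply: ge_ereal_sup => _ [j _ <-].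
have := wy j Logic.I; rewrite /= -lee_pdivlMl ?expR_gt0// mule1 => /bigmax_leP[_ /(_ i isT)].
by rewrite -[leRHS]mule1 lee_pdivlMl ?expR_gt0// -pointwise.
Qed.

End max_stable_cdf.

Section max_functionals.
Context {R : realType} {m : nat}.
Context d (Omega : measurableType d) (P : probability Omega R).
Variable Z : m.-tuple R -> Omega -> \bar R.
Hypothesis mZ : measurable_process Z.
Hypothesis Zoo : forall t w, Z t w < +oo.
Context d' (Omega' : measurableType d') (P' : probability Omega' R).
Variables (p : nat -> Omega' -> R) (Zi : nat -> m.-tuple R -> Omega' -> \bar R).
Hypothesis ingr : max_stable_ingredients P Z P' p Zi.
Hypothesis stat : stationary P' (max_stable p Zi).

(** This is stationarity read on the exponents of the distribution functions. *)
Lemma max_functional_shift (h : m.-tuple R) n (t : 'I_n -> m.-tuple R)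
    (a : 'I_n -> R) : (forall i, 0 < a i)%R ->
  \int[P]_w \big[maxe/0]_(i < n) ((a i)%:E * expeR (Z (tshift h (t i)) w)) =
  \int[P]_w \big[maxe/0]_(i < n) ((a i)%:E * expeR (Z (t i) w)).
Proof.
move=> a0; have [b ->] : exists b : 'I_n -> R, a = fun i => expR (- b i).
  exists (fun i => - ln (a i))%R; apply/funext => i.
  by rewrite opprK lnK// posrE.
apply: oppe_inj; apply: expeR_inj.
rewrite -!(max_stable_cdf mZ Zoo ingr _ b).
pose B : set (n.-tuple (\bar R)) := [set u | forall i, tnth u i <= (b i)%:E].
have mB : measurable B.
  rewrite (_ : B = \bigcap_(i : 'I_n) ((@tnth n (\bar R) ^~ i) @^-1` [set` `]-oo, (b i)%:E]])).
    apply: fin_bigcap_measurable => // i _.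
    rewrite -[X in measurable X]setTI; apply: measurable_tnth => //.
    exact: emeasurable_itv.
  apply/seteqP; split => u /= uB i; first by move=> _ /=; rewrite in_itv/=; exact: uB.
  by have := uB i Logic.I; rewrite /= in_itv.
have := stat (topp h) [tuple t i | i < n] mB.
rewrite translateN.
by congr (_ = _); congr (P' _); apply/seteqP; split => w wB i; have := wB i; rewrite /= !tnth_mktuple//; move=> /(_ Logic.I).
Qed.

End max_functionals.

Section tilted_cdf.
Context {R : realType}.

Lemma measurable_le_set d (T : measurableType d) (u v : T -> R) :
  measurable_fun setT u -> measurable_fun setT v ->
  measurable [set w | (v w <= u w)%R].
Proof.
move=> mu mv.
rewrite (_ : mkset _ = (fun w => v w <= u w)%R @^-1` [set true])//.
by rewrite -[X in measurable X]setTI; exact: measurable_fun_ler.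
Qed.

(** The difference quotient of [c |-> max (c * u) v] from the right at [c = 1]. *)
Let quotient (u v : R) (k : nat) : R :=
  (k.+1%:R * (Num.max ((1 + k.+1%:R^-1) * u) v - Num.max u v))%R.

Let quotient_itv u v k : (0 <= u)%R -> (0 <= quotient u v k <= u)%R.
Proof.
move=> u0; have k0 : (0 < k.+1%:R :> R)%R by [].
have ku : (u <= (1 + k.+1%:R^-1) * u)%R.
  by rewrite mulrDl mul1r lerDl mulr_ge0// invr_ge0 ltW.
rewrite /quotient; apply/andP; split.
  by rewrite mulr_ge0// subr_ge0 ge_max !le_max ku lexx orbT.
rewrite -ler_pdivlMl// lerBlDr ge_max; apply/andP; split.
  by rewrite mulrDl mul1r addrC lerD2l le_max lexx.
by rewrite (le_trans _ (_ : Num.max u v <= _)%R)// ?le_max ?lexx ?orbT// lerDr mulr_ge0// invr_ge0 ltW.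
Qed.

Let quotient_cvg u v : (0 <= u)%R ->
  quotient u v k @[k --> \oo] --> (if v <= u then u else 0)%R.
Proof.
move=> u0; apply: cvg_near_cst; case: leP => uv.
  apply: nearW => k; rewrite /quotient.
  have ku : (u <= (1 + k.+1%:R^-1) * u)%R.
    by rewrite mulrDl mul1r lerDl mulr_ge0// invr_ge0.
  rewrite (max_idPl (le_trans uv ku)) (max_idPl uv) mulrDl mul1r addrC addKr.
  by rewrite mulrA mulfV ?mul1r// pnatr_eq0.
near=> k; rewrite /quotient (max_idPr (ltW uv)) (max_idPr _) ?subrr ?mulr0//.
rewrite mulrDl mul1r -lerBrDl.
have vu : (0 < v - u)%R by rewrite subr_gt0.
rewrite mulrC ler_pdivrMr// -ler_pdivrMl// mulrC.
apply: (@le_trans _ _ k%:R); last by rewrite ler_nat.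
by near: k; exact: nbhs_infty_ger.
Unshelve. all: by end_near. Qed.

Let integral_quotient d (T : measurableType d) (mu : {measure set T -> \bar R})
    (u v : T -> R) : measurable_fun setT u -> measurable_fun setT v ->
  (forall w, 0 <= u w)%R -> (forall w, 0 <= v w)%R ->
  \int[mu]_w (u w)%:E < +oo -> \int[mu]_w (v w)%:E < +oo ->
  (forall k, \int[mu]_w (quotient (u w) (v w) k)%:E =
    k.+1%:R%:E * (\int[mu]_w (Num.max ((1 + k.+1%:R^-1) * u w) (v w))%:E%R -
      \int[mu]_w (Num.max (u w) (v w))%:E)) /\
  \int[mu]_w (quotient (u w) (v w) k)%:E @[k --> \oo] -->
    \int[mu]_w ((u w)%:E * (\1_[set w | (v w <= u w)%R] w)%:E).
Proof.
move=> mu_ mv u0 v0 uoo voo.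
have mmax c : measurable_fun setT (fun w => Num.max (c * u w)%R (v w)).
  by apply: measurable_maxr => //; exact: measurable_funM.
have max0 c w : (0 <= Num.max (c * u w) (v w))%R by rewrite le_max v0 orbT.
have maxoo c : (0 <= c)%R -> \int[mu]_w (Num.max (c * u w)%R (v w))%:E < +oo.
  move=> c0; apply: (@le_lt_trans _ _ (\int[mu]_w (c%:E * (u w)%:E + (v w)%:E))).
    apply: ge0_le_integral => //.
    - by move=> w _; rewrite lee_fin.
    - exact/measurable_EFinP.
    - apply: emeasurable_funD; last exact/measurable_EFinP.
      by apply: emeasurable_funM => //; exact/measurable_EFinP.
    move=> w _; rewrite -EFinM -EFinD lee_fin ge_max lerDl v0 lerDr.
    by rewrite mulr_ge0.
  rewrite ge0_integralD//; last 4 first.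
  - by move=> w _; rewrite -EFinM lee_fin mulr_ge0.
  - by apply: emeasurable_funM => //; exact/measurable_EFinP.
  - by move=> w _; rewrite lee_fin.
  - exact/measurable_EFinP.
  rewrite ge0_integralZl//; last 2 first.
  - exact/measurable_EFinP.
  - by move=> w _; rewrite lee_fin.
  by rewrite lte_add_pinfty// lte_mul_pinfty// lee_fin.
have imax c : (0 <= c)%R -> mu.-integrable setT (fun w => (Num.max (c * u w)%R (v w))%:E).
  move=> c0; apply/integrableP; split; first exact/measurable_EFinP.
  by under eq_integral do rewrite gee0_abs ?lee_fin//; exact: maxoo.
have mq k : measurable_fun setT (fun w => quotient (u w) (v w) k).
  apply: measurable_funM => //; apply: measurable_funB => //.
  exact: measurable_maxr.
split.
  move=> k; under eq_integral do rewrite EFinM EFinB.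
  have i1 : mu.-integrable setT (fun w => (Num.max ((1 + k.+1%:R^-1) * u w)%R (v w))%:E).
    by apply: imax; rewrite addr_ge0// invr_ge0.
  have i2 : mu.-integrable setT (fun w => (Num.max (u w) (v w))%:E).
    rewrite (_ : (fun _ => _) = (fun w => (Num.max (1 * u w)%R (v w))%:E)).
      exact: imax.
    by apply/funext => w; rewrite mul1r.
  rewrite integralZl//; last exact: integrableB.
  by rewrite integralB.
have [] // := @dominated_convergence _ _ _ mu setT measurableT
  (fun k w => (quotient (u w) (v w) k)%:E) (fun w => (u w)%:E * (\1_[set w | (v w <= u w)%R] w)%:E)
  (fun w => (u w)%:E).
- by move=> k; exact/measurable_EFinP.
- apply: emeasurable_funM; first exact/measurable_EFinP.
  by apply/measurable_EFinP; apply: measurable_indic; exact: measurable_le_set.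
- apply: aeW => w _; rewrite -EFinM; apply: cvg_EFin; first exact: nearW.
  have := @quotient_cvg (u w) (v w) (u0 w); rewrite indicE.
  rewrite (_ : (w \in [set w | (v w <= u w)%R]) = (v w <= u w)%R); last first.
    by apply/idP/idP; rewrite inE.
  by case: ifP => _; rewrite ?mulr1 ?mulr0.
- apply/integrableP; split; first exact/measurable_EFinP.
  by under eq_integral do rewrite gee0_abs ?lee_fin//.
- apply: aeW => w k _; have /andP[q0 qu] := @quotient_itv (u w) (v w) k (u0 w).
  by rewrite gee0_abs lee_fin.
Qed.

(** Both sides are right derivatives at [c = 1] of the two sides of the last
    hypothesis. *)
Lemma tilted_cdf_unique d (T : measurableType d) (mu : {measure set T -> \bar R})
    d' (T' : measurableType d') (mu' : {measure set T' -> \bar R})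
    (u v : T -> R) (u' v' : T' -> R) :
  measurable_fun setT u -> measurable_fun setT v ->
  measurable_fun setT u' -> measurable_fun setT v' ->
  (forall w, 0 <= u w)%R -> (forall w, 0 <= v w)%R ->
  (forall w, 0 <= u' w)%R -> (forall w, 0 <= v' w)%R ->
  \int[mu]_w (u w)%:E < +oo -> \int[mu]_w (v w)%:E < +oo ->
  \int[mu']_w (u' w)%:E < +oo -> \int[mu']_w (v' w)%:E < +oo ->
  (forall c : R, (0 < c)%R ->
    \int[mu]_w (Num.max (c * u w) (v w))%:E%R =
    \int[mu']_w (Num.max (c * u' w) (v' w))%:E%R) ->
  \int[mu]_w ((u w)%:E * (\1_[set w | (v w <= u w)%R] w)%:E) =
  \int[mu']_w ((u' w)%:E * (\1_[set w | (v' w <= u' w)%R] w)%:E).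
Proof.
move=> mu_ mv mu_' mv' u0 v0 u0' v0' uoo voo uoo' voo' uv.
have [q1 q2] := integral_quotient mu_ mv u0 v0 uoo voo.
have [q1' q2'] := integral_quotient mu_' mv' u0' v0' uoo' voo'.
apply: cvg_unique q2 _ => //; apply: cvg_trans q2'; apply: near_eq_cvg.
apply: nearW => k; rewrite q1 q1' uv; last by rewrite ltr_pwDl// invr_ge0.
have := uv 1%R ltr01.
by under eq_integral do rewrite mul1r; under [RHS]eq_integral do rewrite mul1r; move=> ->.
Qed.

End tilted_cdf.

(** * Change of origin under the tilted law *)

Section path_pi_system.
Context {R : realType} {I : eqType}.

Definition lower_boxes : set (set (path_space R I)) :=
  [set A | exists s : seq (I * R), A = [set f | all (fun q => f q.1 <= q.2%:E) s]].

Lemma lower_boxes_measurable : lower_boxes `<=` measurable.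
Proof.
move=> _ [s ->]; elim: s => [|q s IH]; first by rewrite (_ : mkset _ = setT)//; apply/seteqP.
rewrite (_ : mkset _ = [set f : path_space R I | f q.1 <= q.2%:E] `&`
    [set f | all (fun q => f q.1 <= q.2%:E) s]).
  apply: measurableI => //.
  rewrite (_ : mkset _ = (fun f : path_space R I => f q.1) @^-1` [set` `]-oo, q.2%:E]]).
    rewrite -[X in measurable X]setTI; apply: measurable_eval => //.
    exact: emeasurable_itv.
  by apply/seteqP; split => f /=; rewrite in_itv.
by apply/seteqP; split => f /= => [/andP[]|[] -> ->].
Qed.

Lemma lower_boxes_setI : setI_closed lower_boxes.
Proof.
move=> _ _ [s ->] [t ->]; exists (s ++ t); apply/seteqP.
by split => f /=; rewrite all_cat; [move=> [-> ->]|move=> /andP[]].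
Qed.

Lemma eval_sigma_lower_boxes : @eval_sigma R I `<=` <<s lower_boxes >>.
Proof.
apply: smallest_sub; first exact: smallest_sigma_algebra.
move=> _ [t [B [mB ->]]].
have mt : measurable_fun setT (fun f : g_sigma_algebraType lower_boxes => f t).
  apply: (measurability _ (ErealGenOInfty.measurableE R)) => //.
  move=> _ [_ [x ->] <-]; rewrite setTI.
  rewrite (_ : _ @^-1` _ = ~` [set f | all (fun q => f q.1 <= q.2%:E) [:: (t, x)]]).
    by apply: measurableC; apply: sub_sigma_algebra; exists [:: (t, x)].
  by apply/seteqP; split => f /=; rewrite in_itv/= !andbT ltNge => /negP.
by have := mt measurableT B mB; rewrite setTI.
Qed.

(** These boxes are closed under intersection and generate the sigma-algebra. *)
Lemma path_measure_unique (m1 m2 : {measure set (path_space R I) -> \bar R}) :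
  m1 setT < +oo ->
  (forall s : seq (I * R), m1 [set f | all (fun q => f q.1 <= q.2%:E) s] =
    m2 [set f | all (fun q => f q.1 <= q.2%:E) s]) ->
  forall A, eval_sigma A -> m1 A = m2 A.
Proof.
move=> m1oo m12 A /eval_sigma_lower_boxes mA.
apply: (@g_sigma_algebra_measure_unique _ R (path_space R I) lower_boxes
  lower_boxes_measurable (fun=> setT)) => //.
- by move=> _; exists [::]; apply/seteqP.
- by rewrite bigcup_const//; exists 0%N.
- exact: lower_boxes_setI.
- by move=> _ [s ->].
Qed.

End path_pi_system.

Section tilt.
Context {R : realType} {m : nat}.
Context d (Omega : measurableType d) (P : probability Omega R).
Variable Z : m.-tuple R -> Omega -> \bar R.
Hypothesis mZ : measurable_process Z.
Hypothesis Zoo : forall t w, Z t w < +oo.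
Context d' (Omega' : measurableType d') (P' : probability Omega' R).
Variables (p : nat -> Omega' -> R) (Zi : nat -> m.-tuple R -> Omega' -> \bar R).
Hypothesis ingr : max_stable_ingredients P Z P' p Zi.
Hypothesis stat : stationary P' (max_stable p Zi).
Hypothesis EZ1 : forall t, \int[P]_w expeR (Z t w) = 1.

Definition increment (h : m.-tuple R) (w : Omega) : path_space R (m.-tuple R) :=
  fun t => Z (tshift h t) w - Z h w.

Lemma measurable_increment h : measurable_fun setT (increment h).
Proof.
apply: (proj1 (@measurable_path R _ _ _ (fun t w => Z (tshift h t) w - Z h w))).
by move=> t; apply: emeasurable_funB; exact: mZ.
Qed.

Lemma mexpZ t : measurable_fun setT (fun w => expeR (Z t w)).
Proof. by apply: measurable_expeR; exact: mZ. Qed.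

Lemma expZ_lty t w : expeR (Z t w) < +oo.
Proof. by rewrite ltey expeR_eqy -ltey. Qed.

Lemma expZ_fin t w : expeR (Z t w) \is a fin_num.
Proof. by rewrite ge0_fin_numE ?expZ_lty// expeR_ge0. Qed.

(** The law of the path seen from [h], under the tilt by [exp (Z h)]. *)
Definition tilted_law (h : m.-tuple R) : {measure set (path_space R (m.-tuple R)) -> \bar R} :=
  image_measure (density P (mexpZ h) (fun w => expeR_ge0 (Z h w))) (measurable_increment h).

Let yr t w : R := fine (expeR (Z t w)).

Let yrE t w : (yr t w)%:E = expeR (Z t w).
Proof. by rewrite fineK// expZ_fin. Qed.

Let yr0 t w : (0 <= yr t w)%R.
Proof. by rewrite -lee_fin yrE expeR_ge0. Qed.

Let myr t : measurable_fun setT (yr t).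
Proof. by apply: measurableT_comp => //; exact: mexpZ. Qed.

Let top (s : seq (m.-tuple R * R)) h w : R :=
  \big[Num.max/0%R]_(i < size s) (expR (- (nth (origin, 0%R) s i).2) *
    yr (tshift h (nth (origin, 0%R) s i).1) w)%R.

Let topE s h w : (top s h w)%:E = \big[maxe/0]_(i < size s)
  ((expR (- (nth (origin, 0%R) s i).2))%:E *
    expeR (Z (tshift h (nth (origin, 0%R) s i).1) w)).
Proof.
rewrite /top (big_morph EFin (@EFin_max R) erefl).
by apply: eq_bigr => i _; rewrite EFinM yrE.
Qed.

Let mtop s h : measurable_fun setT (top s h).
Proof.
apply/measurable_EFinP; rewrite (_ : _ \o _ = fun w => \big[maxe/0]_(i < size s)
  ((expR (- (nth (origin, 0%R) s i).2))%:E *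
    expeR (Z (tshift h (nth (origin, 0%R) s i).1) w))); last first.
  by apply/funext => w; rewrite /= topE.
apply: measurable_bigmaxe => i; apply: emeasurable_funM => //.
exact: mexpZ.
Qed.

Let top0 s h w : (0 <= top s h w)%R.
Proof. by rewrite -lee_fin topE bigmaxe_ge0. Qed.

Let top_le_sum s h w : (top s h w <= \sum_(i < size s)
  expR (- (nth (origin, 0%R) s i).2) * yr (tshift h (nth (origin, 0%R) s i).1) w)%R.
Proof.
have sum_i0 i : (0 <= expR (- (nth (origin, 0%R) s i).2) *
    yr (tshift h (nth (origin, 0%R) s i).1) w)%R by rewrite mulr_ge0 ?expR_ge0.
apply/bigmax_leP; split; first exact: sumr_ge0.
by move=> i _; rewrite (bigD1 i)//= lerDl sumr_ge0.
Qed.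

Let top_int s h : \int[P]_w (top s h w)%:E < +oo.
Proof.
apply: (@le_lt_trans _ _ (\int[P]_w \sum_(i < size s)
    (expR (- (nth (origin, 0%R) s i).2))%:E * expeR (Z (tshift h (nth (origin, 0%R) s i).1) w))).
  apply: ge0_le_integral => //.
  - by move=> w _; rewrite lee_fin.
  - exact/measurable_EFinP.
  - apply: emeasurable_sum => i; apply: emeasurable_funM => //; exact: mexpZ.
  move=> w _; apply: (@le_trans _ _ (\sum_(i < size s)
    expR (- (nth (origin, 0%R) s i).2) * yr (tshift h (nth (origin, 0%R) s i).1) w)%:E%R).
    by rewrite lee_fin.
  by rewrite -sumEFin; apply: lee_sum => i _; rewrite EFinM yrE.
rewrite ge0_integral_sum//; last 2 first.
- by move=> i; apply: emeasurable_funM => //; exact: mexpZ.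
- by move=> i w _; rewrite mule_ge0 ?expeR_ge0// lee_fin expR_ge0.
apply: lte_sum_pinfty => i _.
rewrite ge0_integralZl//; last 2 first.
- exact: mexpZ.
- by move=> w _; exact: expeR_ge0.
by rewrite EZ1 mule1 ltry.
Qed.

Let tilted_law_box h s : tilted_law h [set f | all (fun q => f q.1 <= q.2%:E) s] =
  \int[P]_w ((yr h w)%:E * (\1_[set w | (top s h w <= yr h w)%R] w)%:E).
Proof.
rewrite /tilted_law image_measureE /= /density integral_mkcond.
apply: eq_integral => w _; rewrite patchE indicE yrE.
have [Zh|Zh] := eqVneq (Z h w) -oo.
  by rewrite Zh /= mul0e; case: ifP.
have Zfin : Z h w \is a fin_num by rewrite fin_numE Zh lt_eqF.
rewrite [in LHS](_ : (w \in _) = (w \in [set w | (top s h w <= yr h w)%R])).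
  by case: ifP => _; rewrite ?mule1 ?mule0.
have boxE b z : (z - Z h w <= b%:E) = ((expR (- b))%:E * expeR z <= expeR (Z h w)).
  by rewrite leeBlDr// -[LHS]lee_expeR expeRD /= expRN lee_pdivrMl ?expR_gt0.
apply/idP/idP; rewrite !inE /=.
  move=> H; apply/bigmax_leP; split => // i _.
  rewrite -lee_fin EFinM !yrE -boxE.
  exact: (elimT (all_nthP (origin, 0%R)) H i (ltn_ord i)).
move=> /bigmax_leP[_ H]; apply/(all_nthP (origin, 0%R)) => i si.
by have := H (Ordinal si) isT; rewrite -lee_fin EFinM !yrE -boxE.
Qed.

(** On a box, the tilted law is the mean of [u 1_{v <= u}] with [u = exp (Z h)] and
    [v] a weighted maximum of [exp Z]; the means of [max (c * u) v] do not
    depend on [h]. *)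
Lemma tilted_law_shift h A : eval_sigma A -> tilted_law h A = tilted_law origin A.
Proof.
move: A; apply: path_measure_unique.
  rewrite /tilted_law image_measureE preimage_setT /= /density EZ1.
  exact: ltry.
move=> s; rewrite !tilted_law_box; apply: tilted_cdf_unique => //.
- by under eq_integral do rewrite yrE; rewrite EZ1 ltry.
- by under eq_integral do rewrite yrE; rewrite EZ1 ltry.
move=> c c0.
pose t (i : 'I_(size s).+1) := if unlift ord0 i is Some j then (nth (origin, 0%R) s j).1 else origin.
pose a (i : 'I_(size s).+1) := if unlift ord0 i is Some j then expR (- (nth (origin, 0%R) s j).2) else c.
have a0 i : (0 < a i)%R by rewrite /a; case: unlift => [j|]; rewrite ?expR_gt0.
have maxE h' w : (Num.max (c * yr h' w) (top s h' w))%:E%R =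
    \big[maxe/0]_(i < (size s).+1) ((a i)%:E * expeR (Z (tshift h' (t i)) w)).
  rewrite EFin_max topE EFinM yrE big_ord_recl /a /t unlift_none tshift_origin.
  by congr maxe; apply: eq_bigr => i _; rewrite liftK.
under eq_integral do rewrite maxE; under [RHS]eq_integral do rewrite maxE.
rewrite (max_functional_shift mZ Zoo ingr stat h t a0).
by rewrite (max_functional_shift mZ Zoo ingr stat origin t a0).
Qed.

End tilt.

Section theta_law.
Context {R : realType} {m : nat}.
Context dO (Omega : measurableType dO) (P : probability Omega R).
Variable Z : m.-tuple R -> Omega -> \bar R.
Hypothesis mZ : measurable_process Z.
Hypothesis Zoo : forall t w, Z t w < +oo.
Hypothesis EZ1 : forall t, \int[P]_w expeR (Z t w) = 1.
Context dV (OmegaV : measurableType dV) (PV : probability OmegaV R).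
Variable V : m.-tuple R -> OmegaV -> \bar R.
Hypothesis mV : measurable_process V.
Hypothesis V_law : conditioned_at_origin P PV V Z.
Context dW (OmegaW : measurableType dW) (PW : probability OmegaW R).
Variable W : m.-tuple R -> OmegaW -> \bar R.
Hypothesis mW : measurable_process W.
Hypothesis W_law : tilted_at_origin PV PW W V.

Let o : m.-tuple R := origin.
Let N := [set w | -oo < Z o w].

Let mN : measurable N.
Proof.
rewrite (_ : N = setT `&` [set w | Z o w != -oo]).
  by apply: emeasurable_neq => //; exact: mZ.
by rewrite setTI; apply/seteqP; split => w /=; rewrite /N/= ltNye.
Qed.

Let expZ_N w : expeR (Z o w) = expeR (Z o w) * (\1_N w)%:E.
Proof.
rewrite indicE; have [|/negP] := boolP (w \in N); first by rewrite mule1.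
by rewrite inE /N/= ltNye => /negP; rewrite negbK => /eqP -> /=; rewrite mul0e.
Qed.

Let q := fine (P N).

Let qE : P N = q%:E. Proof. by rewrite fineK// fin_num_measure. Qed.

Let q_gt0 : (0 < q)%R.
Proof.
have q0 : (0 <= q)%R by rewrite -lee_fin -qE.
rewrite lt_neqAle q0 andbT eq_sym; apply/eqP => qN; have N0 : P N = 0 by rewrite qE qN.
have := EZ1 o; under eq_integral do rewrite expZ_N.
rewrite (_ : \int[P]_w _ = 0); first by move/eqP; rewrite eqe eq_sym oner_eq0.
under eq_integral do rewrite muleC.
rewrite -(_ : \int[P]_(w in N) expeR (Z o w) = \int[P]_w _).
  by apply: null_set_integral => //; apply: measurable_funTS; exact: mexpZ.
rewrite integral_mkcond; apply: eq_integral => w _; rewrite patchE indicE.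
by case: ifP => _; rewrite ?mul1e ?mul0e.
Qed.

Let mindN : measurable_fun setT (fun w => (\1_N w)%:E : \bar R).
Proof. exact/measurable_EFinP/measurable_indic. Qed.

Let indN0 w : 0 <= (\1_N w)%:E :> \bar R. Proof. by rewrite lee_fin. Qed.

Lemma conditioned_integral (F : path_space R (m.-tuple R) -> \bar R) :
  measurable_fun setT F -> (forall f, 0 <= F f) ->
  \int[PV]_w F (V^~ w) = (q^-1)%:E * \int[P]_w ((\1_N w)%:E * F (Z^~ w)).
Proof.
move=> mF F0; have q0 : (0 <= q^-1)%R by rewrite invr_ge0 ltW.
have mpV := proj1 (measurable_path V) mV.
have mpZ := proj1 (measurable_path Z) mZ.
rewrite -(ge0_integral_image_measure PV mpV mF F0).
transitivity (\int[mscale (NngNum q0) (image_measure (density P mindN indN0) mpZ)]_f F f).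
  apply: eq_measure_integral => A mA _.
  transitivity (PV (path_event V A)); first by [].
  rewrite (V_law mA) /path_event.
  rewrite /mscale/= muleC qE inver gt_eqF//; congr (_ * _).
  rewrite /pushforward /density -[X in P X]setIT -integral_indic//; last first.
    by apply: measurableI => //; exact: path_event_measurable.
  rewrite image_measureE /= /density [RHS]integral_mkcond; apply: eq_integral => w _.
  rewrite patchE indicI/= !indicE.
  have -> : (w \in (fun w => Z^~ w) @^-1` A) = (w \in [set w | A (Z^~ w)]) by [].
  by case: ifP => _; rewrite ?mul1r ?mul0r.
rewrite ge0_integral_mscale//; congr (_ * _).
rewrite ge0_integral_image_measure// ge0_integral_density//.
  by move=> w; rewrite ltry.
exact: (measurableT_comp mF mpZ).
Qed.

(** The constants of the conditioning and of the tilt cancel, because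
    [E (exp (Z origin)) = 1]. *)
Lemma tilted_path_law A : eval_sigma A ->
  PW (path_event W A) = \int[P]_w (expeR (Z o w) * (\1_(path_event Z A) w)%:E).
Proof.
move=> mA; rewrite (W_law mA).
have Eo : \int[PV]_w expeR (V o w) = (q^-1)%:E.
  rewrite (conditioned_integral (F := fun f => expeR (f o))).
  - by under eq_integral do rewrite muleC -expZ_N; rewrite EZ1 mule1.
  - by apply: measurable_expeR; exact: measurable_eval.
  - by move=> f; exact: expeR_ge0.
have shiftE w : expeR (V o w - lne (\int[PV]_u expeR (V o u))) = expeR (V o w) * q%:E.
  rewrite Eo lne_EFin ?invr_gt0// lnV ?posrE// EFinN oppeK expeRD/=.
  by rewrite lnK// posrE.
pose F (f : path_space R (m.-tuple R)) := expeR (f o) * q%:E * (\1_A f)%:E.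
transitivity (\int[PV]_w F (V^~ w)).
  by apply: eq_integral => w _; rewrite shiftE.
rewrite (conditioned_integral (F := F)).
- rewrite (_ : \int[P]_w _ =
      \int[P]_w (q%:E * (expeR (Z o w) * (\1_(path_event Z A) w)%:E))).
    rewrite ge0_integralZl//; last 3 first.
    - apply: emeasurable_funM; first exact: mexpZ.
      by apply/measurable_EFinP; apply: measurable_indic; exact: path_event_measurable.
    - by move=> w _; rewrite mule_ge0 ?expeR_ge0// lee_fin.
    - by rewrite lee_fin ltW.
    by rewrite muleA -EFinM mulVf ?gt_eqF// mul1e.
  apply: eq_integral => w _; rewrite /F /= [in RHS]expZ_N !indicE.
  have -> : (Z^~ w \in A) = (w \in path_event Z A) by [].
  by rewrite -!muleA [LHS]muleCA [RHS]muleCA; congr (_ * _); exact: muleCA.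
- apply: emeasurable_funM; last by apply/measurable_EFinP; exact: measurable_indic.
  apply: emeasurable_funM => //.
  by apply: measurable_expeR; exact: measurable_eval.
- by move=> f; rewrite !mule_ge0 ?expeR_ge0// lee_fin// ltW.
Qed.

Let Theta := spectral_increment W.

Lemma spectral_increment_process : measurable_process Theta.
Proof. by move=> t; apply: emeasurable_funB; exact: mW. Qed.

Lemma theta_origin_law A : eval_sigma A ->
  PW (path_event Theta A) = tilted_law P mZ origin A.
Proof.
move=> mA.
pose D (f : path_space R (m.-tuple R)) : path_space R (m.-tuple R) :=
  fun t => f t - f o.
have mD : measurable_fun setT D.
  apply: (proj1 (@measurable_path R _ _ _ (fun t (f : path_space R _) => f t - f o))).
  by move=> t; apply: emeasurable_funB; exact: measurable_eval.
have mDA : eval_sigma (D @^-1` A).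
  by rewrite eval_sigmaE -[X in measurable X]setTI; exact: mD.
rewrite -[LHS]/(PW (path_event W (D @^-1` A))) tilted_path_law//.
rewrite /tilted_law image_measureE /= /density [RHS]integral_mkcond.
have incE : increment Z origin = D \o (fun w => Z^~ w).
  apply/funext => w; apply/funext => t; rewrite /increment /D/=; congr (Z _ w - _).
  by apply: eq_from_tnth => j; rewrite !tE addr0.
apply: eq_integral => w _; rewrite patchE indicE incE.
have -> : (w \in (D \o (fun w => Z^~ w)) @^-1` A) = (w \in path_event Z (D @^-1` A)) by [].
by case: ifP => _; rewrite ?mule1 ?mule0.
Qed.

Context dX (OmegaX : measurableType dX) (PX : probability OmegaX R).
Variables (p : nat -> OmegaX -> R) (Zi : nat -> m.-tuple R -> OmegaX -> \bar R).
Hypothesis ingr : max_stable_ingredients P Z PX p Zi.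
Hypothesis stat : stationary PX (max_stable p Zi).

(** Stationarity in terms of the spectral functions: rooting [Z] at any [h],
    under the tilt by [exp (Z h)], gives the law of [Theta]. *)
Lemma theta_transfer h (F : path_space R (m.-tuple R) -> \bar R) :
  measurable_fun setT F -> (forall f, 0 <= F f) ->
  \int[PW]_w F (Theta^~ w) = \int[P]_w (expeR (Z h w) * F (increment Z h w)).
Proof.
move=> mF F0.
have mpT := proj1 (measurable_path Theta) spectral_increment_process.
rewrite -(ge0_integral_image_measure PW mpT mF F0).
transitivity (\int[tilted_law P mZ h]_f F f).
  apply: eq_measure_integral => A mA _.
  rewrite (tilted_law_shift mZ Zoo ingr stat EZ1 h mA) -theta_origin_law//.
rewrite /tilted_law ge0_integral_image_measure// ge0_integral_density//.
- by move=> w; exact: (expZ_lty Zoo).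
- exact: (measurableT_comp mF (measurable_increment mZ h)).
Qed.

End theta_law.

(** * The lattice *)

Section countable_support.
Context {R : realType}.

Lemma measurable_set1_tuple d (t : d.-tuple R) : measurable [set t].
Proof.
rewrite (_ : [set t] = [set s | forall j, [set tnth t j] (tnth s j)]).
  exact: (@measurable_tuple_forall R d (fun j => [set tnth t j])).
by apply/seteqP; split => s /= => [->//|st]; exact: eq_from_tnth.
Qed.

Lemma measurable_countable_tuple d (L : set (d.-tuple R)) :
  countable L -> measurable L.
Proof.
move=> cL; rewrite (_ : L = \bigcup_(t in L) [set t]).
  by apply: countable_bigcup_measurable => // t _; exact: measurable_set1_tuple.
by apply/seteqP; split => t /=; [exists t|move=> [s Ls ->]].
Qed.

(** A preimage of a set that excludes zero is a countable union of rectangles. *)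
Lemma measurable_countable_sections d dT (T : measurableType dT)
    (L : set (d.-tuple R)) (g : d.-tuple R -> T -> \bar R) : countable L ->
  (forall s, L s -> measurable_fun setT (g s)) ->
  (forall s w, ~ L s -> g s w = 0) ->
  measurable_fun setT (fun sw : d.-tuple R * T => g sw.1 sw.2).
Proof.
move=> cL mg g0 _ B mB; rewrite setTI.
rewrite (_ : _ @^-1` B = (\bigcup_(s in L) ([set s] `*` (g s @^-1` B))) `|`
    (if 0 \in B then (~` L) `*` setT else set0)).
  apply: measurableU.
    apply: countable_bigcup_measurable => // s Ls; apply: measurableX.
      exact: measurable_set1_tuple.
    by rewrite -[X in measurable X]setTI; exact: mg.
  by case: ifP => _ //; apply: measurableX => //; apply: measurableC;
    exact: measurable_countable_tuple.
apply/seteqP; split => -[s w] /=.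
  move=> Bg; have [Ls|nLs] := pselect (L s); first by left; exists s.
  by right; rewrite -(g0 s w nLs) mem_set.
case=> [[_ Ls [/= -> ]]|]//.
by case: ifP => // /set_mem B0 [/= nLs _]; rewrite g0.
Qed.

Lemma measurable_countable_support d (L : set (d.-tuple R))
    (g : d.-tuple R -> \bar R) : countable L ->
  (forall s, ~ L s -> g s = 0) -> measurable_fun setT g.
Proof.
move=> cL g0.
have mg : measurable_fun setT (fun sw : d.-tuple R * unit => g sw.1).
  apply: (measurable_countable_sections (g := fun s (_ : unit) => g s) cL) => [s _|s _].
    exact: measurable_cst.
  exact: g0.
have mp : measurable_fun setT (fun s : d.-tuple R => (s, tt)).
  by apply: measurable_fun_pair => //; exact: measurable_cst.
exact: (measurableT_comp mg mp).
Qed.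

Lemma countable_tuple_forall d (C : set R) : countable C ->
  countable [set t : d.-tuple R | forall j, C (tnth t j)].
Proof.
move=> cC; have [C0|/set0P C0] := eqVneq C set0.
  case: d => [|d].
    by apply: (sub_countable _ (countable1 ([tuple] : 0.-tuple R)));
      apply: subset_card_le => t _ /=; rewrite [t]tuple0.
  by rewrite (_ : mkset _ = set0)//; apply/seteqP; split => // t /= /(_ ord0); rewrite C0.
have [e eC] := countable_enumeration C0 cC.
apply: (@sub_countable _ _ _ (range (fun u : d.-tuple nat => [tuple e (tnth u j) | j < d]))).
  apply: subset_card_le => t /= tC.
  have /choice[u uE] : forall j, exists k, e k = tnth t j.
    by move=> j; have := tC j; rewrite -eC => -[k _ <-]; exists k.
  exists [tuple u j | j < d] => //; apply: eq_from_tnth => j.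
  by rewrite !tnth_mktuple.
exact: (sub_countable (card_image_le _ _)).
Qed.

End countable_support.

Section lattice.
Context {R : realType} {d : nat}.
Variable delta : R.
Hypothesis delta0 : (0 < delta)%R.
Local Notation L := (@lattice R d delta).
Local Notation mu := (@lattice_measure R d delta).

Lemma latticeP (t : d.-tuple R) :
  L t <-> forall j, exists z : int, tnth t j = (delta * z%:~R)%R.
Proof. by rewrite /lattice gt_eqF. Qed.

Lemma countable_lattice : countable L.
Proof.
rewrite (_ : L = [set t | forall j, (range (fun z : int => delta * z%:~R)%R) (tnth t j)]).
  by apply: countable_tuple_forall; exact: (sub_countable (card_image_le _ _)).
apply/seteqP; split => t; first by move=> /latticeP Lt j; have [z ->] := Lt j; exists z.
by move=> /= Lt; apply/latticeP => j; have [z _ <-] := Lt j; exists z.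
Qed.

Lemma lattice_origin : L origin.
Proof. by apply/latticeP => j; exists 0%R; rewrite tE mulr0. Qed.

Lemma lattice_tshift s t : L s -> L t -> L (tshift s t).
Proof.
move=> /latticeP Ls /latticeP Lt; apply/latticeP => j.
have [z zE] := Ls j; have [z' zE'] := Lt j; exists (z' + z)%R.
by rewrite tE zE zE' intrD mulrDr.
Qed.

Lemma lattice_topp t : L t -> L (topp t).
Proof.
move=> /latticeP Lt; apply/latticeP => j; have [z zE] := Lt j; exists (- z)%R.
by rewrite tE zE intrN mulrN.
Qed.

Lemma lattice_translate s t : L s -> L t -> L (translate s t).
Proof. by move=> Ls Lt; rewrite -tshiftN; apply: lattice_tshift => //; exact: lattice_topp. Qed.

Lemma lattice_measureE A : mu A = counting (A `&` L).
Proof. by []. Qed.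

Lemma lattice_measure_setC : mu (~` L) = 0.
Proof. by rewrite lattice_measureE setICl measure0. Qed.

Lemma lattice_sigma_finite : sigma_finite setT mu.
Proof.
have [e eL] := countable_enumeration (ex_intro _ _ lattice_origin) countable_lattice.
exists (fun n => ~` L `|` e @` `I_n.+1).
  apply/esym; rewrite -subTset => t _.
  have [Lt|nLt] := pselect (L t); last by exists 0%N => //; left.
  have [n _ ent] : (range e) t by rewrite eL.
  by exists n => //; right; exists n => //=.
move=> n; have fe : finite_set (e @` `I_n.+1) by apply: finite_image; exact: finite_II.
split.
  apply: measurableU; first by apply: measurableC; exact: measurable_lattice.
  by apply: measurable_countable_tuple; exact: finite_set_countable.
rewrite lattice_measureE setIUl setICl set0U /counting asboolT ?ltry//.
exact: sub_finite_set fe.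
Qed.

(** A copy of [lattice_measure] that carries the sigma-finite structure which
    Tonelli requires. *)
Definition lattice_counting : set (d.-tuple R) -> \bar R := mu.

Let lc0 : lattice_counting set0 = 0. Proof. exact: measure0. Qed.
Let lc_ge0 A : 0 <= lattice_counting A. Proof. exact: measure_ge0. Qed.
Let lc_add : semi_sigma_additive lattice_counting.
Proof. exact: measure_semi_sigma_additive. Qed.

HB.instance Definition _ := isMeasure.Build _ _ _ lattice_counting lc0 lc_ge0 lc_add.
HB.instance Definition _ := Measure_isSigmaFinite.Build _ _ _ lattice_counting
  lattice_sigma_finite.

Definition lattice_sf : {sigma_finite_measure set (d.-tuple R) -> \bar R} :=
  lattice_counting.

(** The measure only sees the countable set [L], on which everything is
    measurable. *)
Lemma integral_lattice_eq (f g : d.-tuple R -> \bar R) :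
  (forall s, 0 <= f s) -> (forall s, 0 <= g s) -> {in L, f =1 g} ->
  \int[mu]_s f s = \int[mu]_s g s.
Proof.
move=> f0 g0 fg; apply: ge0_ae_eq_integralT => //.
exists (~` L); split.
- by apply: measurableC; exact: measurable_lattice.
- exact: lattice_measure_setC.
- by apply: subsetC => s Ls; apply: fg; rewrite inE.
Qed.

Lemma integral_lattice_patch (f : d.-tuple R -> \bar R) : (forall s, 0 <= f s) ->
  \int[mu]_s f s = \int[mu]_s (f \_ L) s.
Proof.
move=> f0; apply: integral_lattice_eq => //; first exact: erestrict_ge0.
by move=> s sL; rewrite patchE sL.
Qed.

Lemma measurable_patch_lattice (f : d.-tuple R -> \bar R) :
  measurable_fun setT (f \_ L).
Proof.
apply: (measurable_countable_support countable_lattice) => s Ls.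
by rewrite patchE memNset.
Qed.

Lemma ge0_integral_lattice_bij (phi psi : d.-tuple R -> d.-tuple R)
    (f : d.-tuple R -> \bar R) :
  measurable_fun setT phi -> cancel phi psi -> cancel psi phi ->
  (forall s, L s -> L (phi s)) -> (forall s, L s -> L (psi s)) ->
  (forall s, 0 <= f s) ->
  \int[mu]_s f (phi s) = \int[mu]_s f s.
Proof.
move=> mphi phiK psiK Lphi Lpsi f0.
rewrite integral_lattice_patch// [RHS]integral_lattice_patch//.
rewrite (_ : _ \_ L = (f \_ L) \o phi); last first.
  apply/funext => s; rewrite /= !patchE.
  have -> : (phi s \in L) = (s \in L); last by [].
  apply/idP/idP => /set_mem sL; apply/mem_set; last exact: Lphi.
  by rewrite -(phiK s); exact: Lpsi.
rewrite -(ge0_integral_image_measure mu mphi (measurable_patch_lattice f)); last first.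
  exact: erestrict_ge0.
apply: eq_measure_integral => A mA _; rewrite image_measureE !lattice_measureE.
have -> : phi @^-1` A `&` L = psi @` (A `&` L).
  apply/seteqP; split => s /=.
    by move=> [As Ls]; exists (phi s) => //; split => //; exact: Lphi.
  by move=> [t [At Lt] <-]; rewrite psiK; split => //; exact: Lpsi.
have inj_psi : injective psi := can_inj psiK.
rewrite /counting; case: ifPn => /asboolP fA.
  have fA' : finite_set (A `&` L).
    by rewrite -(image_id (A `&` L)) -(eq_imagel (fun s _ => psiK s)) -image_comp;
      exact: finite_image.
  rewrite asboolT// fset_set_image// card_imfset//.
by rewrite asboolF// => fA'; apply: fA; exact: finite_image.
Qed.

Lemma ge0_integral_lattice_tshift s (f : d.-tuple R -> \bar R) : L s ->
  (forall t, 0 <= f t) ->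
  \int[mu]_t f (tshift s t) = \int[mu]_t f t.
Proof.
move=> Ls f0; apply: (@ge0_integral_lattice_bij (tshift s) (translate s)) => //.
- exact: measurable_tshift.
- exact: tshiftK.
- exact: translateK.
- by move=> t; exact: lattice_tshift.
- by move=> t; exact: lattice_translate.
Qed.

Lemma toppK : involutive (@topp R d).
Proof. by move=> t; apply: eq_from_tnth => j; rewrite !tE opprK. Qed.

Lemma measurable_topp : measurable_fun setT (@topp R d).
Proof.
apply/measurable_fun_tnthP => j.
rewrite (_ : _ \o _ = (fun t => - tnth t j)%R).
  by apply: measurable_funN; exact: measurable_tnth.
by apply/funext => t /=; rewrite tE.
Qed.

Lemma ge0_integral_lattice_topp (f : d.-tuple R -> \bar R) :
  (forall t, 0 <= f t) ->
  \int[mu]_t f (topp t) = \int[mu]_t f t.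
Proof.
move=> f0; apply: (@ge0_integral_lattice_bij (@topp R d) (@topp R d)) => //;
  [exact: measurable_topp|exact: toppK|exact: toppK|exact: lattice_topp|exact: lattice_topp].
Qed.

Definition box (a b : R) : set (d.-tuple R) :=
  [set t | forall j, (a <= tnth t j <= b)%R].

Definition cell : set (d.-tuple R) :=
  [set t | forall j, (0 <= tnth t j < delta)%R].

Lemma measurable_box a b : measurable (box a b).
Proof.
rewrite (_ : box a b = [set t | forall j, `[a, b]%classic (tnth t j)]).
  exact: (@measurable_tuple_forall R d (fun=> `[a, b]%classic)).
by apply/seteqP; split => t /= tab j; have := tab j; rewrite /= in_itv.
Qed.

Let cellE : cell = [set t | forall j, `[0%R, delta[%classic (tnth t j)].
Proof. by apply/seteqP; split => t /= tab j; have := tab j; rewrite /= in_itv. Qed.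

Lemma measurable_cell : measurable cell.
Proof. by rewrite cellE; exact: (@measurable_tuple_forall R d (fun=> `[0%R, delta[%classic)). Qed.

Lemma lebesgue_box a b : (a <= b)%R -> lebesgue_tuple d (box a b) = ((b - a) ^+ d)%:E%R.
Proof.
move=> ab; rewrite (_ : box a b = [set t | forall j, `[a, b]%classic (tnth t j)]).
  rewrite lebesgue_tuple_cube// lebesgue_measure_itv/= lte_fin EFin_expe.
  move: ab; rewrite le_eqVlt => /predU1P[->|->]; last by rewrite EFinB.
  by rewrite ltxx subrr.
by apply/seteqP; split => t /= tab j; have := tab j; rewrite /= in_itv.
Qed.

Lemma lebesgue_cell : lebesgue_tuple d cell = (delta ^+ d)%:E%R.
Proof.
rewrite cellE lebesgue_tuple_cube// lebesgue_measure_itv/= lte_fin delta0.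
by rewrite EFin_expe sube0.
Qed.

(** The cells attached to the lattice points tile the space. *)
Lemma cell_lattice (u : d.-tuple R) : exists t0, L t0 /\
  forall t, L t -> (cell (translate t u) <-> t = t0).
Proof.
exists [tuple (delta * (Num.floor (tnth u j / delta))%:~R)%R | j < d].
split; first by apply/latticeP => j; rewrite tnth_mktuple; exists (Num.floor (tnth u j / delta)).
have flE (z : int) j : (0 <= tnth u j - delta * z%:~R < delta)%R =
    (z%:~R <= tnth u j / delta < (z + 1)%:~R)%R.
  rewrite subr_ge0 ltrBlDr ler_pdivlMr// ltr_pdivrMr// mulrC intrD mulrDl mul1r.
  by rewrite (addrC delta).
move=> t /latticeP Lt; split=> [ut|-> j]; last first.
  by rewrite tE tnth_mktuple flE real_floor_itv// num_real.
apply: eq_from_tnth => j; rewrite tnth_mktuple; have [z zE] := Lt j.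
have := ut j; rewrite tE zE flE => zu.
by congr (_ * _%:~R)%R; apply/esym/floor_def.
Qed.

Lemma lattice_measure_cell (u : d.-tuple R) :
  \int[mu]_t (\1_cell (translate t u))%:E = 1.
Proof.
have [t0 [Lt0 t0P]] := cell_lattice u.
rewrite (integral_lattice_eq (g := fun t => (\1_[set t0] t)%:E)).
- rewrite integral_indic// ?setIT; last exact: measurable_set1_tuple.
  rewrite lattice_measureE setIidl => [|t ->//].
  by rewrite /counting asboolT// fset_set1 cardfs1.
- by move=> s; rewrite lee_fin.
- by move=> s; rewrite lee_fin.
move=> t /set_mem Lt; rewrite !indicE; congr ((nat_of_bool _)%:R%:E).
by apply/idP/idP; rewrite !inE; move/(t0P t Lt).
Qed.

Let mcell_indic : measurable_fun setT (\1_cell : _ -> R).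
Proof. by apply: measurable_indic; exact: measurable_cell. Qed.

Lemma integral_cell_translate (t : d.-tuple R) :
  \int[lebesgue_tuple d]_u (\1_cell (translate t u))%:E = (delta ^+ d)%:E%R.
Proof.
have mcell : measurable_fun setT (fun u => (\1_cell u)%:E : \bar R).
  by apply/measurable_EFinP; apply: measurable_indic; exact: measurable_cell.
rewrite (ge0_integral_lebesgue_tuple_translate t mcell); last first.
  by move=> u; rewrite lee_fin.
have mC := measurable_cell.
rewrite integral_indic// setIT; exact: lebesgue_cell.
Qed.

Local Notation lmu := lattice_sf.

Lemma measurable_cell_difference : measurable_fun setT
  (fun tu : d.-tuple R * d.-tuple R => (\1_cell (translate tu.1 tu.2))%:E : \bar R).
Proof.
have mtr : measurable_fun setT
    (fun tu : d.-tuple R * d.-tuple R => translate tu.1 tu.2).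
  apply/measurable_fun_tnthP => j.
  rewrite (_ : _ \o _ = (fun tu => tnth tu.2 j - tnth tu.1 j)%R); last first.
    by apply/funext => tu /=; rewrite tE.
  apply: measurable_funB.
    exact: (measurableT_comp (measurable_tnth j) measurable_snd).
  exact: (measurableT_comp (measurable_tnth j) measurable_fst).
by apply/measurable_EFinP; exact: (measurableT_comp mcell_indic mtr).
Qed.

(** Every lattice point of [A] owns a cell of volume [delta ^ d]. *)
Lemma lattice_measure_volume A : measurable A ->
  (delta ^+ d)%:E%R * mu A =
  \int[lebesgue_tuple d]_u \int[mu]_t ((\1_A t)%:E * (\1_cell (translate t u))%:E).
Proof.
move=> mA.
have mf : measurable_fun setT (fun tu : d.-tuple R * d.-tuple R =>
    (\1_A tu.1)%:E * (\1_cell (translate tu.1 tu.2))%:E : \bar R).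
  apply: emeasurable_funM; last exact: measurable_cell_difference.
  by apply/measurable_EFinP; apply: measurableT_comp => //; exact: measurable_indic.
have f0 (tu : d.-tuple R * d.-tuple R) :
    0 <= (\1_A tu.1)%:E * (\1_cell (translate tu.1 tu.2))%:E :> \bar R.
  by rewrite mule_ge0// lee_fin.
rewrite -[RHS](fubini_tonelli (m1 := lmu) (m2 := lebesgue_tuple d) _ mf f0)/=.
transitivity (\int[mu]_t ((delta ^+ d)%:E%R * (\1_A t)%:E)).
  rewrite ge0_integralZl//; last 2 first.
  - by apply/measurable_EFinP; exact: measurable_indic.
  - by rewrite lee_fin exprn_ge0// ltW.
  by rewrite integral_indic// setIT.
apply: eq_integral => t _; rewrite ge0_integralZl//; last first.
  apply/measurable_EFinP.
  exact: (measurableT_comp mcell_indic (measurable_translate t)).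
by rewrite integral_cell_translate muleC.
Qed.

Let covered A u := \int[mu]_t ((\1_A t)%:E * (\1_cell (translate t u))%:E).

Let msection u : measurable_fun setT (fun t => (\1_cell (translate t u))%:E : \bar R).
Proof.
exact: (measurableT_comp measurable_cell_difference (pair2_measurable u)).
Qed.

Let mA_section A u : measurable A -> measurable_fun setT
  (fun t => (\1_A t)%:E * (\1_cell (translate t u))%:E : \bar R).
Proof.
move=> mA; apply: emeasurable_funM => //.
by apply/measurable_EFinP; exact: measurable_indic.
Qed.

Let mcovered A : measurable A -> measurable_fun setT (covered A).
Proof.
move=> mA; apply: (@measurable_fun_fubini_tonelli_G _ _ _ _ _ lmu
  (fun tu => (\1_A tu.1)%:E * (\1_cell (translate tu.1 tu.2))%:E)) => [|tu].
  apply: emeasurable_funM; last exact: measurable_cell_difference.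
  by apply/measurable_EFinP; apply: measurableT_comp => //; exact: measurable_indic.
by rewrite mule_ge0// lee_fin.
Qed.

Let covered_ge0 A u : 0 <= covered A u.
Proof. by apply: integral_ge0 => t _; rewrite mule_ge0// lee_fin. Qed.

(** The cells rooted in the box are contained in the box enlarged by [delta]. *)
Lemma lattice_measure_box_le a b : (a <= b)%R ->
  (delta ^+ d)%:E%R * mu (box a b) <= ((b - a + delta) ^+ d)%:E%R.
Proof.
move=> ab; rewrite lattice_measure_volume; last exact: measurable_box.
rewrite addrAC -lebesgue_box; last by rewrite ler_wpDr// ltW.
have mB := measurable_box a (b + delta).
rewrite -[in leRHS](setIT (box a _)) -integral_indic//.
apply: ge0_le_integral => //.
- by move=> u _; exact: covered_ge0.
- by apply: mcovered; exact: measurable_box.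
- by apply/measurable_EFinP; exact: measurable_indic.
move=> u _; rewrite indicE; have [/set_mem ub|/negP ub] := boolP (u \in box a (b + delta)).
  rewrite -[leRHS](lattice_measure_cell u); apply: ge0_le_integral => //.
  - by apply: mA_section; exact: measurable_box.
  - by move=> t _; rewrite -EFinM lee_fin ler_piMl// indicE; case: (_ \in _).
rewrite /covered integral0_eq// => t _; rewrite -EFinM !indicE.
have [/set_mem tb|_] := boolP (t \in box a b); last by rewrite mul0r.
have [/set_mem cu|_] := boolP (translate t u \in cell); last by rewrite mulr0.
exfalso; apply: ub; apply/mem_set => j; have := tb j; have := cu j; rewrite tE.
move=> /andP[c1 c2] /andP[t1 t2]; rewrite subr_ge0 in c1; rewrite (le_trans t1 c1)/=.
by rewrite ltrBlDr in c2; rewrite (le_trans (ltW c2))// addrC lerD2r.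
Qed.

(** The cells rooted in the box cover the box shortened by [delta]. *)
Lemma lattice_measure_box_ge a b : (a + delta <= b)%R ->
  ((b - a - delta) ^+ d)%:E%R <= (delta ^+ d)%:E%R * mu (box a b).
Proof.
move=> ab; rewrite lattice_measure_volume; last exact: measurable_box.
rewrite -addrA -opprD -lebesgue_box//.
have mB := measurable_box (a + delta) b.
rewrite -[in leLHS](setIT (box _ b)) -integral_indic//.
apply: ge0_le_integral => //.
- by apply/measurable_EFinP; exact: measurable_indic.
- by apply: mcovered; exact: measurable_box.
move=> u _; rewrite indicE; have [/set_mem ub|/negP ub] := boolP (u \in _); last exact: covered_ge0.
rewrite -[leLHS](lattice_measure_cell u); apply: ge0_le_integral => //.
- by apply: mA_section; exact: measurable_box.
move=> t _; rewrite -EFinM lee_fin !indicE.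
have [/set_mem cu|_] := boolP (translate t u \in cell); last by rewrite mulr0.
rewrite mulr1 mem_set// => j; have := cu j; have := ub j; rewrite tE.
move=> /andP[u1 u2] /andP[c1 c2]; rewrite subr_ge0 in c1; rewrite (le_trans c1 u2) andbT.
by rewrite -(lerD2r delta) (le_trans u1)// ltW// addrC -ltrBlDr.
Qed.

(** Fubini along the tiling: the integral over [R ^ d] averages the lattice sums
    of the translates by the points of a cell. *)
Lemma ge0_integral_cell (f : d.-tuple R -> \bar R) : measurable_fun setT f ->
  (forall t, 0 <= f t) ->
  \int[lebesgue_tuple d]_u ((\1_cell u)%:E * \int[mu]_t f (tshift t u)) =
  \int[lebesgue_tuple d]_u f u.
Proof.
move=> mf f0.
have mshift : measurable_fun setT (fun tu : d.-tuple R * d.-tuple R => tshift tu.1 tu.2).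
  apply/measurable_fun_tnthP => j.
  rewrite (_ : _ \o _ = (fun tu => tnth tu.2 j + tnth tu.1 j)%R); last first.
    by apply/funext => tu /=; rewrite tE.
  apply: measurable_funD.
    exact: (measurableT_comp (measurable_tnth j) measurable_snd).
  exact: (measurableT_comp (measurable_tnth j) measurable_fst).
have mcell : measurable_fun setT (fun u => (\1_cell u)%:E : \bar R).
  by apply/measurable_EFinP; apply: measurable_indic; exact: measurable_cell.
have mg : measurable_fun setT (fun tu : d.-tuple R * d.-tuple R =>
    (\1_cell tu.2)%:E * f (tshift tu.1 tu.2)).
  apply: emeasurable_funM; first exact: (measurableT_comp mcell measurable_snd).
  exact: (measurableT_comp mf mshift).
have mh : measurable_fun setT (fun tu : d.-tuple R * d.-tuple R =>
    (\1_cell (translate tu.1 tu.2))%:E * f tu.2).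
  apply: emeasurable_funM; first exact: measurable_cell_difference.
  exact: (measurableT_comp mf measurable_snd).
transitivity (\int[lebesgue_tuple d]_u \int[mu]_t ((\1_cell u)%:E * f (tshift t u))).
  apply: eq_integral => u _; rewrite ge0_integralZl// ?lee_fin//.
  exact: (measurableT_comp (measurableT_comp mf mshift) (pair2_measurable u)).
rewrite -(fubini_tonelli (m1 := lmu) (m2 := lebesgue_tuple d) _ mg)/=; last first.
  by move=> tu; rewrite mule_ge0// lee_fin.
transitivity (\int[mu]_t \int[lebesgue_tuple d]_u ((\1_cell (translate t u))%:E * f u)).
  apply: eq_integral => t _.
  rewrite -(ge0_integral_lebesgue_tuple_tshift t (f := fun u => (\1_cell (translate t u))%:E * f u)).
  - by apply: eq_integral => u _; rewrite tshiftK.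
  - exact: (measurableT_comp mh (pair1_measurable t)).
  - by move=> u; rewrite mule_ge0// lee_fin.
rewrite (fubini_tonelli (m1 := lmu) (m2 := lebesgue_tuple d) _ mh)/=; last first.
  by move=> tu; rewrite mule_ge0// lee_fin.
apply: eq_integral => u _.
under eq_integral do rewrite muleC.
rewrite ge0_integralZl//.
have -> : \int[lmu]_t (\1_cell (translate t u))%:E = 1 by exact: lattice_measure_cell.
by rewrite mule1.
Qed.

End lattice.

(** * Sums and suprema over the lattice *)

Section ereal_ratios.
Context {R : realType}.
Implicit Types (N D W : \bar R) (r : R).

Lemma expeRB (x z : \bar R) : z \is a fin_num ->
  expeR (x - z) = expeR x * (expeR z)^-1.
Proof.
by case: z => // z _; rewrite expeRD /= inver gt_eqF ?expR_gt0// expRN.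
Qed.

Lemma ratio_cancel N D r : (0 < r)%R -> 0 < D ->
  (N * (r%:E)^-1) / (D * (r%:E)^-1) = N / D.
Proof.
move=> r0; rewrite inver gt_eqF//; have ri0 : (0 < r^-1)%R by rewrite invr_gt0.
case: D => [D| |]//; last by rewrite gt0_mulye ?lte_fin// invey !mule0.
rewrite lte_fin => D0; rewrite -EFinM !inver !gt_eqF ?mulr_gt0//.
by rewrite invfM invrK -muleA -EFinM mulrCA mulVf ?gt_eqF// mulr1.
Qed.

Lemma ratio_le1 W D : 0 <= W -> W <= D -> W / D <= 1.
Proof.
move=> W0; case: D => [D| |]; last 2 first.
- by move=> _; rewrite invey mule0 lee01.
- by rewrite leeNy_eq => /eqP WN; move: W0; rewrite WN.
case: W W0 => [W| |]// W0 WD; rewrite inver; case: eqP => [D0|/eqP D0].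
  have -> : W%:E = 0 by apply/eqP; rewrite eq_le W0 andbT (le_trans WD)// D0.
  by rewrite mul0e lee01.
have D1 : (0 < D)%R by rewrite lt_neqAle eq_sym D0 -lee_fin (le_trans W0).
by rewrite -EFinM lee_fin ler_pdivrMr// mul1r.
Qed.

Lemma ratio_self D : 0 < D -> D < +oo -> D / D = 1.
Proof.
case: D => [D| |]//; rewrite lte_fin => D0 _.
by rewrite inver gt_eqF// -EFinM divff ?gt_eqF.
Qed.

End ereal_ratios.

Section lattice_functionals.
Context {R : realType} {m : nat}.
Variable delta : R.
Hypothesis delta0 : (0 < delta)%R.
Local Notation path := (path_space R (m.-tuple R)).
Local Notation L := (@lattice R m delta).
Local Notation mu := (@lattice_measure R m delta).

Definition lattice_sum (A : set (m.-tuple R)) (f : path) : \bar R :=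
  \int[mu]_s ((\1_A s)%:E * expeR (f s)).

Definition psup (A : set (m.-tuple R)) (f : path) : \bar R :=
  ereal_sup [set expeR (f t) | t in A].

Local Notation lsum := lattice_sum.

Lemma lsum_ge0 A f : 0 <= lsum A f.
Proof. by apply: integral_ge0 => s _; rewrite mule_ge0 ?expeR_ge0// lee_fin. Qed.

Lemma measurable_lsum A : measurable_fun setT (lsum A).
Proof.
pose g (s : m.-tuple R) (f : path) : \bar R :=
  if s \in L then (\1_A s)%:E * expeR (f s) else 0.
have g0 s f : 0 <= g s f.
  by rewrite /g; case: ifP => // _; rewrite mule_ge0 ?expeR_ge0// lee_fin.
have mg : measurable_fun setT (fun sf : m.-tuple R * path => g sf.1 sf.2).
  apply: (measurable_countable_sections (countable_lattice delta0)) => [s Ls|s f Ls].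
    rewrite /g mem_set//; apply: emeasurable_funM; first exact: measurable_cst.
    by apply: measurable_expeR; exact: measurable_eval.
  by rewrite /g memNset.
rewrite (_ : lsum A = fun f => \int[lattice_sf delta0]_s g s f).
  apply: (@measurable_fun_fubini_tonelli_G _ _ _ _ _ (lattice_sf delta0)
    (fun sf => g sf.1 sf.2) mg) => sf; exact: g0.
apply/funext => f; apply: integral_lattice_eq => //.
- by move=> s; rewrite mule_ge0 ?expeR_ge0// lee_fin.
- by move=> s sL; rewrite /g sL.
Qed.

Lemma measurable_psup A : countable A -> measurable_fun setT (psup A).
Proof.
move=> cA; apply: measurable_ereal_sup_countable => // t _.
by apply: measurable_expeR; exact: measurable_eval.
Qed.

Lemma psup_ge0 A f : A !=set0 -> 0 <= psup A f.
Proof.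
move=> [t At]; apply: (@le_trans _ _ (expeR (f t))); first exact: expeR_ge0.
by apply: ereal_sup_ubound; exists t.
Qed.

Lemma le_psup A B f : A `<=` B -> psup A f <= psup B f.
Proof. by move=> AB; apply: ereal_sup_le => _ [t At <-]; exists t => //; exact: AB. Qed.

Lemma expeR_le_lsum A f t : L t -> A t -> expeR (f t) <= lsum A f.
Proof.
move=> Lt At.
have -> : expeR (f t) = \int[mu]_s ((\1_[set t] s)%:E * expeR (f t)).
  have mt := measurable_set1_tuple t.
  rewrite ge0_integralZr//; last 2 first.
  - by apply/measurable_EFinP; exact: measurable_indic.
  - exact: expeR_ge0.
  rewrite integral_indic// setIT lattice_measureE setIidl => [|s ->//].
  by rewrite /counting asboolT// fset_set1 cardfs1 mul1e.
apply: ge0_ae_le_integral.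
- by move=> s; rewrite mule_ge0 ?expeR_ge0// lee_fin.
- by move=> s; rewrite mule_ge0 ?expeR_ge0// lee_fin.
apply: aeW => s; rewrite !indicE; have [/set_mem/= ->|_] := boolP (s \in [set t]).
  by rewrite mem_set.
by rewrite mul0e mule_ge0 ?expeR_ge0// lee_fin.
Qed.

Lemma psup_le_lsum A B f : A `<=` L `&` B -> psup A f <= lsum B f.
Proof.
by move=> AB; apply: ge_ereal_sup => _ [t /AB[Lt Bt] <-]; exact: expeR_le_lsum.
Qed.

Lemma le_lsum (A B : set (m.-tuple R)) f : (forall t, L t -> A t -> B t) -> lsum A f <= lsum B f.
Proof.
move=> AB; apply: ge0_ae_le_integral.
- by move=> s; rewrite mule_ge0 ?expeR_ge0// lee_fin.
- by move=> s; rewrite mule_ge0 ?expeR_ge0// lee_fin.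
exists (~` L); split; [|exact: lattice_measure_setC|].
  by apply: measurableC; exact: measurable_lattice.
apply: subsetC => s Ls /=; rewrite lee_wpmul2r ?expeR_ge0// lee_fin !indicE ler_nat.
have [/set_mem As|//] := boolP (s \in A).
by rewrite mem_set//; exact: AB.
Qed.

Lemma lsumUC A f : lsum A f + lsum (~` A) f = lsum setT f.
Proof.
have indU (s : m.-tuple R) : (\1_A s + \1_(~` A) s = 1 :> R)%R.
  by rewrite !indicE in_setC; case: (s \in A); rewrite ?addr0 ?add0r.
have e0 B (s : m.-tuple R) : 0 <= (\1_B s)%:E * expeR (f s) :> \bar R.
  by rewrite mule_ge0 ?expeR_ge0// lee_fin.
rewrite /lsum (integral_lattice_patch delta (e0 _)).
rewrite [X in _ + X](integral_lattice_patch delta (e0 _)).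
rewrite [RHS](integral_lattice_patch delta (e0 _)).
rewrite -ge0_integralD//; last 4 first.
- by move=> s _; exact: erestrict_ge0.
- exact: (measurable_patch_lattice delta0).
- by move=> s _; exact: erestrict_ge0.
- exact: (measurable_patch_lattice delta0).
apply: eq_integral => s _; rewrite !patchE; case: ifP => _; last by rewrite adde0.
by rewrite -ge0_muleDl ?lee_fin// -EFinD indU indicT.
Qed.

End lattice_functionals.

Section rooted_functionals.
Context {R : realType} {m : nat}.
Variable delta : R.
Hypothesis delta0 : (0 < delta)%R.
Local Notation path := (path_space R (m.-tuple R)).
Local Notation L := (@lattice R m delta).
Local Notation mu := (@lattice_measure R m delta).
Local Notation lsum := (@lattice_sum R m delta).

Lemma lattice_integralZr (f : m.-tuple R -> \bar R) (c : \bar R) :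
  (forall s, 0 <= f s) -> 0 <= c ->
  \int[mu]_s (f s * c) = (\int[mu]_s f s) * c.
Proof.
move=> f0 c0; rewrite (integral_lattice_patch delta); last by move=> s; exact: mule_ge0.
rewrite [in RHS](integral_lattice_patch delta f0) -ge0_integralZr//; last 2 first.
- exact: (measurable_patch_lattice delta0).
- by move=> s _; exact: erestrict_ge0.
by apply: eq_integral => s _; rewrite !patchE; case: ifP => _; rewrite ?mul0e.
Qed.

Context dO (Omega : measurableType dO) (Z : m.-tuple R -> Omega -> \bar R).
Hypothesis Zoo : forall t w, Z t w < +oo.

Let Zfin h w : Z h w != -oo -> Z h w \is a fin_num.
Proof. by move=> Zh; rewrite fin_numE Zh lt_eqF. Qed.

Lemma lsum_increment B h w : L h -> Z h w != -oo ->
  lsum B (increment Z h w) =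
  lsum (translate h @^-1` B) (Z^~ w) * (expeR (Z h w))^-1.
Proof.
move=> Lh Zh; rewrite /lattice_sum -lattice_integralZr; last 2 first.
- by move=> s; rewrite mule_ge0 ?expeR_ge0// lee_fin.
- by rewrite inve_ge0 expeR_ge0.
rewrite -[RHS](ge0_integral_lattice_tshift delta0 Lh); last first.
  by move=> s; rewrite !mule_ge0 ?inve_ge0 ?expeR_ge0// lee_fin.
apply: eq_integral => s _; rewrite /increment expeRB ?Zfin// muleA; congr (_%:E * _ * _).
have sB : (s \in B) = (tshift h s \in translate h @^-1` B).
  by apply/idP/idP; rewrite !inE /= tshiftK.
by rewrite !indicE sB.
Qed.

Lemma psup_increment A h w : Z h w != -oo ->
  psup A (increment Z h w) = psup (tshift h @` A) (Z^~ w) * (expeR (Z h w))^-1.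
Proof.
move=> Zh; rewrite /psup.
have [r r0 rE] : exists2 r : R, (0 < r)%R & (expeR (Z h w))^-1 = r%:E.
  case: (Z h w) (Zfin Zh) => // z _ /=; exists (expR z)^-1%R.
    by rewrite invr_gt0 expR_gt0.
  by rewrite inver gt_eqF ?expR_gt0.
rewrite rE muleC -ereal_sup_pZl//; congr ereal_sup.
apply/seteqP; split => [_ [t At <-]|_ [_ [_ [t At <-] <-] <-]] /=.
  exists (expeR (Z (tshift h t) w)); first by exists (tshift h t) => //; exists t.
  by rewrite /increment expeRB ?Zfin// rE muleC.
by exists t => //; rewrite /increment expeRB ?Zfin// rE muleC.
Qed.

Lemma lsum_gt0 f h : L h -> f h != -oo -> 0 < lsum setT f.
Proof.
move=> Lh fh; apply: (@lt_le_trans _ _ (expeR (f h))).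
  by rewrite expeR_gt0// ltNye.
by apply: expeR_le_lsum.
Qed.

Let tilted_ratio h w (N N' : \bar R) : L h ->
  (Z h w != -oo -> N = N' * (expeR (Z h w))^-1) ->
  expeR (Z h w) * (N / lsum setT (increment Z h w)) =
  expeR (Z h w) * (N' / lsum setT (Z^~ w)).
Proof.
move=> Lh NN'; have [Zh|Zh] := eqVneq (Z h w) -oo; first by rewrite Zh !mul0e.
congr (_ * _); rewrite (NN' Zh) lsum_increment// preimage_setT.
have D0 := lsum_gt0 (f := Z^~ w) Lh Zh.
have := Zfin Zh; case: (Z h w) => // z _ /=; apply: ratio_cancel => //.
exact: expR_gt0.
Qed.

(** The factor [exp (- Z h)] of the increments cancels in the ratio. *)
Lemma tilted_psup_ratio A h w : L h ->
  expeR (Z h w) * (psup A (increment Z h w) / lsum setT (increment Z h w)) =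
  expeR (Z h w) * (psup (tshift h @` A) (Z^~ w) / lsum setT (Z^~ w)).
Proof. by move=> Lh; apply: tilted_ratio => // Zh; exact: psup_increment. Qed.

Lemma tilted_lsum_ratio B h w : L h ->
  expeR (Z h w) * (lsum B (increment Z h w) / lsum setT (increment Z h w)) =
  expeR (Z h w) * (lsum (translate h @^-1` B) (Z^~ w) / lsum setT (Z^~ w)).
Proof. by move=> Lh; apply: tilted_ratio => // Zh; exact: lsum_increment. Qed.

End rooted_functionals.

Section lattice_sum_finite.
Context {R : realType} {m : nat}.
Variable delta : R.
Hypothesis delta0 : (0 < delta)%R.
Local Notation path := (path_space R (m.-tuple R)).
Local Notation L := (@lattice R m delta).
Local Notation mu := (@lattice_measure R m delta).
Local Notation lsum := (@lattice_sum R m delta).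
Local Notation smu := (lattice_sf delta0).

Context dO (Omega : measurableType dO) (P : probability Omega R).
Variable Z : m.-tuple R -> Omega -> \bar R.
Hypothesis mZ : measurable_fun setT
  (fun tw : (m.-tuple R * Omega)%type => Z tw.1 tw.2).
Hypothesis Zoo : forall t w, Z t w < +oo.
Context dW (OmegaW : measurableType dW) (PW : probability OmegaW R).
Variable Theta : m.-tuple R -> OmegaW -> \bar R.
Hypothesis mTheta : measurable_process Theta.
Hypothesis transfer : forall h (F : path -> \bar R),
  measurable_fun setT F -> (forall f, 0 <= F f) ->
  \int[PW]_w F (Theta^~ w) = \int[P]_w (expeR (Z h w) * F (increment Z h w)).
Hypothesis Z_integrable :
  {ae P, forall w, \int[lebesgue_tuple m]_t expeR (Z t w) < +oo}.

Let y (tw : m.-tuple R * Omega) := expeR (Z tw.1 tw.2).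

Let my : measurable_fun setT y. Proof. exact: measurable_expeR. Qed.

Lemma tshiftC (s t : m.-tuple R) : tshift s t = tshift t s.
Proof. by apply: eq_from_tnth => j; rewrite !tE addrC. Qed.

Let Du (u : m.-tuple R) (w : Omega) := \int[mu]_s expeR (Z (tshift s u) w).

Let mDu : measurable_fun setT (fun uw : m.-tuple R * Omega => Du uw.1 uw.2).
Proof.
pose g (x : (m.-tuple R * Omega) * m.-tuple R) := y (tshift x.2 x.1.1, x.1.2).
apply: (@measurable_fun_fubini_tonelli_F _ _ _ _ R smu g) => [|x]; last first.
  exact: expeR_ge0.
apply: (measurableT_comp my); apply: measurable_fun_pair; last first.
  exact: (measurableT_comp measurable_snd measurable_fst).
apply/measurable_fun_tnthP => j.
rewrite (_ : _ \o _ = (fun x => tnth x.1.1 j + tnth x.2 j)%R); last first.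
  by apply/funext => x /=; rewrite tE.
apply: measurable_funD.
  apply: (measurableT_comp (measurable_tnth j)).
  exact: (measurableT_comp measurable_fst measurable_fst).
exact: (measurableT_comp (measurable_tnth j) measurable_snd).
Qed.

Let infinite_at (u : m.-tuple R) : set Omega := [set w | Du u w = +oo%E].

Let lsum_increment_infinite u w : Z u w != -oo ->
  lsum setT (increment Z u w) = +oo <-> Du u w = +oo.
Proof.
move=> Zu; have Zf : Z u w \is a fin_num by rewrite fin_numE Zu lt_eqF.
have -> : lsum setT (increment Z u w) = Du u w * (expeR (Z u w))^-1.
  rewrite /Du -(lattice_integralZr delta0); last 2 first.
  - by move=> s; exact: expeR_ge0.
  - by rewrite inve_ge0 expeR_ge0.
  by apply: eq_integral => s _; rewrite indicT mul1e /increment expeRB// tshiftC.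
have D0 : 0 <= Du u w by apply: integral_ge0 => s _; exact: expeR_ge0.
case: (Z u w) Zf => // z _ /=; rewrite inver gt_eqF ?expR_gt0//.
have ez : (0 < (expR z)^-1)%R by rewrite invr_gt0 expR_gt0.
split=> [|->]; last by rewrite gt0_mulye ?lte_fin.
by case: (Du u w) D0 => // r _; rewrite -EFinM.
Qed.

Let lsum_infinite_indic (f : path) : \bar R := (\1_[set f | lsum setT f = +oo%E] f)%:E.

Let m_lsum_infinite : measurable_fun setT lsum_infinite_indic.
Proof.
apply/measurable_EFinP; apply: measurable_indic.
rewrite (_ : mkset _ = lsum setT @^-1` [set +oo])//.
rewrite -[X in measurable X]setTI; apply: (measurable_lsum delta0) => //.
Qed.

Let kappa := \int[PW]_w lsum_infinite_indic (Theta^~ w).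

Let kappaE u : kappa =
  \int[P]_w (expeR (Z u w) * (\1_[set uw | Du uw.1 uw.2 = +oo%E] (u, w))%:E).
Proof.
rewrite /kappa (transfer u m_lsum_infinite); last by move=> f; rewrite lee_fin.
apply: eq_integral => w _; have [Zu|Zu] := eqVneq (Z u w) -oo.
  by rewrite Zu !mul0e.
congr (_ * _); rewrite /lsum_infinite_indic !indicE; congr ((nat_of_bool _)%:R%:E).
by apply/idP/idP; rewrite !inE /=; move/(lsum_increment_infinite Zu).
Qed.

Let minf : measurable [set uw : m.-tuple R * Omega | Du uw.1 uw.2 = +oo%E].
Proof.
rewrite (_ : mkset _ = (fun uw => Du uw.1 uw.2) @^-1` [set +oo])//.
by rewrite -[X in measurable X]setTI; exact: mDu.
Qed.

(** Averaging over the points [u] of a cell: the lattice sums at [u] integrate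
    to the integral over the whole space, so they are finite for almost all
    [u], whereas the tilted probability that they are infinite does not depend
    on [u]. *)
Let kappa0 : kappa = 0.
Proof.
pose g (uw : m.-tuple R * Omega) := (\1_(cell delta) uw.1)%:E *
  (expeR (Z uw.1 uw.2) * (\1_[set uw | Du uw.1 uw.2 = +oo%E] uw)%:E) : \bar R.
have mg : measurable_fun setT g.
  apply: emeasurable_funM.
    apply/measurable_EFinP; apply: measurableT_comp => //.
    by apply: measurable_indic; exact: measurable_cell.
  by apply: emeasurable_funM => //; apply/measurable_EFinP; exact: measurable_indic.
have g0 uw : 0 <= g uw by rewrite !mule_ge0 ?expeR_ge0// lee_fin.
have k0 : 0 <= kappa by apply: integral_ge0 => w _; rewrite lee_fin.
have gk : \int[lebesgue_tuple m]_u \int[P]_w g (u, w) = kappa * (delta ^+ m)%:E%R.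
  rewrite muleC -lebesgue_cell// -[X in lebesgue_tuple m X]setIT.
  rewrite -integral_indic//; last exact: measurable_cell.
  rewrite -ge0_integralZr//; last first.
    by apply/measurable_EFinP; apply: measurable_indic; exact: measurable_cell.
  apply: eq_integral => u _; rewrite (kappaE u) -ge0_integralZl//=.
  - apply: emeasurable_funM; first exact: (measurableT_comp my (pair1_measurable u)).
    apply/measurable_EFinP.
    by apply: (measurableT_comp _ (pair1_measurable u)); exact: measurable_indic.
  - by move=> w _; rewrite mule_ge0 ?expeR_ge0// lee_fin.
have : \int[lebesgue_tuple m]_u \int[P]_w g (u, w) = 0.
  rewrite (fubini_tonelli (m1 := lebesgue_tuple m) (m2 := P) _ mg g0).
  transitivity (\int[P]_w (cst 0 w : \bar R)); last exact: integral0.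
  apply: ge0_ae_eq_integralT => //.
    by move=> w; apply: integral_ge0.
  apply: filterS Z_integrable => w Zw.
  have myw : measurable_fun setT (fun u => y (u, w)).
    exact: (measurableT_comp my (pair2_measurable w)).
  have := ge0_integral_cell delta0 myw (fun u => expeR_ge0 _); rewrite /y/= => cellE.
  rewrite -cellE in Zw.
  have mD : measurable_fun setT (fun u => (\1_(cell delta) u)%:E * Du u w : \bar R).
    apply: emeasurable_funM.
      by apply/measurable_EFinP; apply: measurable_indic; exact: measurable_cell.
    exact: (measurableT_comp mDu (pair2_measurable w)).
  have D0 u : 0 <= (\1_(cell delta) u)%:E * Du u w.
    by rewrite mule_ge0 ?lee_fin//; apply: integral_ge0 => s _; exact: expeR_ge0.
  have : (lebesgue_tuple m).-integrable setT (fun u => (\1_(cell delta) u)%:E * Du u w).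
    by apply/integrableP; split => //; under eq_integral do rewrite gee0_abs//.
  move/integrable_ae => /(_ measurableT) fin_ae.
  transitivity (\int[lebesgue_tuple m]_u (cst 0 u : \bar R)); last exact: integral0.
  apply: ge0_ae_eq_integralT => //.
  apply: filterS fin_ae => u /(_ Logic.I); rewrite /g/= !indicE.
  case: (u \in cell delta) => /= [|_]; last by rewrite mul0e.
  rewrite !mul1e => Dfin; rewrite memNset ?mule0//= => Dinf.
  by rewrite Dinf in Dfin.
rewrite gk => /eqP; rewrite mule_eq0 => /orP[/eqP//|].
by rewrite eqe gt_eqF// exprn_gt0.
Qed.

Lemma theta_lsum_finite : {ae PW, forall w, lsum setT (Theta^~ w) < +oo}.
Proof.
have mpT := proj1 (measurable_path Theta) mTheta.
exists [set w | lsum setT (Theta^~ w) = +oo%E]; split.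
- rewrite (_ : mkset _ = (lsum setT \o (fun w => Theta^~ w : path)) @^-1` [set +oo])//.
  rewrite -[X in measurable X]setTI.
  exact: (measurableT_comp (measurable_lsum delta0 setT) mpT).
- have mS : measurable [set w | lsum setT (Theta^~ w) = +oo%E].
    rewrite (_ : mkset _ = (lsum setT \o (fun w => Theta^~ w : path)) @^-1` [set +oo])//.
    rewrite -[X in measurable X]setTI.
    exact: (measurableT_comp (measurable_lsum delta0 setT) mpT).
  have <- : \int[PW]_w (\1_[set w | lsum setT (Theta^~ w) = +oo%E] w)%:E =
      PW [set w | lsum setT (Theta^~ w) = +oo] by rewrite integral_indic// setIT.
  by rewrite -kappa0.
- move=> w /= /negP; rewrite ltey negbK => /eqP.
  done.
Qed.

(** The tilt by [exp (Z h)] brings this from [Theta] wherever [Z h] is finite;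
    where [Z h] is minus infinity for all [h] in the lattice, the sum is zero. *)
Lemma Z_lsum_finite : {ae P, forall w, lsum setT (Z^~ w) < +oo}.
Proof.
have mpZ : measurable_fun setT (fun w => Z^~ w : path).
  by apply/measurable_path => t; exact: (measurableT_comp mZ (pair1_measurable t)).
pose F h w := expeR (Z h w) * (\1_[set w | lsum setT (Z^~ w) = +oo%E] w)%:E.
have mF h : measurable_fun setT (F h).
  apply: emeasurable_funM; first exact: (measurableT_comp my (pair1_measurable h)).
  apply/measurable_EFinP; apply: measurable_indic.
  rewrite (_ : mkset _ = (lsum setT \o (fun w => Z^~ w : path)) @^-1` [set +oo])//.
  rewrite -[X in measurable X]setTI.
  exact: (measurableT_comp (measurable_lsum delta0 setT) mpZ).
have F0 h : L h -> {ae P, forall w, F h w = 0}.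
  move=> Lh; have F0 w : 0 <= F h w by rewrite mule_ge0 ?expeR_ge0// lee_fin.
  have IF : \int[P]_w `|F h w| = 0.
    rewrite -kappa0 (kappaE h); apply: eq_integral => w _.
    rewrite gee0_abs// /F; congr (_ * _); rewrite !indicE; congr ((nat_of_bool _)%:R%:E).
    suff DE : lsum setT (Z^~ w) = Du h w by apply/idP/idP; rewrite !inE /= DE.
    rewrite /lattice_sum -(ge0_integral_lattice_tshift delta0 Lh).
      by apply: eq_integral => s _; rewrite indicT mul1e tshiftC.
    by move=> s; rewrite mule_ge0 ?expeR_ge0// lee_fin.
  by move/(ae_eq_integral_abs _ measurableT (mF h)) : IF; apply: filterS => w /(_ Logic.I).
have [e eL] : exists e : nat -> m.-tuple R, range e = L.
  by apply: countable_enumeration; [exists origin; exact: lattice_origin|exact: countable_lattice].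
have : {ae P, forall w, forall n, F (e n) w = 0}.
  apply: ae_foralln => n; have Le : L (e n) by rewrite -eL; exists n.
  exact: F0.
apply: filterS => w Fw; rewrite ltey; apply/eqP => Dinf.
suff : lsum setT (Z^~ w) = 0 by rewrite Dinf.
rewrite /lattice_sum (integral_lattice_eq (g := cst 0))//; first exact: integral0.
- by move=> s; rewrite mule_ge0 ?expeR_ge0// lee_fin.
move=> s /set_mem; rewrite -eL => -[n _ <-] /=.
by have := Fw n; rewrite /F indicE mem_set// mule1 => ->; rewrite mule0.
Qed.

End lattice_sum_finite.

(** * Suprema over cubes of lattice points *)

Section lattice_pickands_bounds.
Context {R : realType} {m : nat}.
Variable delta : R.
Hypothesis delta0 : (0 < delta)%R.
Local Notation path := (path_space R (m.-tuple R)).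
Local Notation L := (@lattice R m delta).
Local Notation mu := (@lattice_measure R m delta).
Local Notation lsum := (@lattice_sum R m delta).
Local Notation smu := (lattice_sf delta0).

Context dO (Omega : measurableType dO) (P : probability Omega R).
Variable Z : m.-tuple R -> Omega -> \bar R.
Hypothesis mZ : measurable_fun setT
  (fun tw : (m.-tuple R * Omega)%type => Z tw.1 tw.2).
Hypothesis Zoo : forall t w, Z t w < +oo.
Context dW (OmegaW : measurableType dW) (PW : probability OmegaW R).
Variable Theta : m.-tuple R -> OmegaW -> \bar R.
Hypothesis mTheta : measurable_process Theta.
Hypothesis transfer : forall h (F : path -> \bar R),
  measurable_fun setT F -> (forall f, 0 <= F f) ->
  \int[PW]_w F (Theta^~ w) = \int[P]_w (expeR (Z h w) * F (increment Z h w)).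

(** Such ratios do not change when [exp Theta] is multiplied by a constant, so
    that [Theta] can be replaced in them by [Z] rooted at any lattice point. *)
Definition sup_share A : \bar R :=
  \int[PW]_w (psup A (Theta^~ w) / lsum setT (Theta^~ w)).

Definition sum_share B : \bar R :=
  \int[PW]_w (lsum B (Theta^~ w) / lsum setT (Theta^~ w)).

Let minv_lsum : measurable_fun setT (fun f : path => (lsum setT f)^-1).
Proof.
by apply: measurable_inve; [exact: lsum_ge0|exact: measurable_lsum].
Qed.

Let mpZ : measurable_fun setT (fun w => Z^~ w : path).
Proof.
by apply/measurable_path => t; exact: (measurableT_comp mZ (pair1_measurable t)).
Qed.

Let my : measurable_fun setT (fun tw : m.-tuple R * Omega => expeR (Z tw.1 tw.2)).
Proof. exact: measurable_expeR. Qed.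

Let inv_ge0 (f : path) : 0 <= (lsum setT f)^-1.
Proof. by rewrite inve_ge0 lsum_ge0. Qed.

Lemma sup_shareE A s : countable A -> A !=set0 -> L s ->
  sup_share A = \int[P]_w (expeR (Z s w) *
    (psup (tshift s @` A) (Z^~ w) / lsum setT (Z^~ w))).
Proof.
move=> cA A0 Ls; rewrite /sup_share.
rewrite (transfer s (F := fun f => psup A f / lsum setT f)).
- by apply: eq_integral => w _; exact: (tilted_psup_ratio delta0).
- by apply: emeasurable_funM => //; exact: measurable_psup.
- by move=> f; rewrite mule_ge0 ?psup_ge0.
Qed.

Lemma sum_shareE B s : L s ->
  sum_share B = \int[P]_w (expeR (Z s w) *
    (lsum (translate s @^-1` B) (Z^~ w) / lsum setT (Z^~ w))).
Proof.
move=> Ls; rewrite /sum_share.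
rewrite (transfer s (F := fun f => lsum B f / lsum setT f)).
- by apply: eq_integral => w _; exact: (tilted_lsum_ratio delta0).
- by apply: emeasurable_funM => //; exact: (measurable_lsum delta0).
- by move=> f; rewrite mule_ge0 ?lsum_ge0.
Qed.

Lemma integral_lsum_mul B (X : Omega -> \bar R) : measurable B ->
  measurable_fun setT X -> (forall w, 0 <= X w) ->
  \int[P]_w (lsum B (Z^~ w) * X w) =
  \int[mu]_s ((\1_B s)%:E * \int[P]_w (expeR (Z s w) * X w)).
Proof.
move=> mB mX X0.
have mBZ : measurable_fun setT (fun sw : m.-tuple R * Omega =>
    (\1_B sw.1)%:E * expeR (Z sw.1 sw.2) : \bar R).
  apply: emeasurable_funM => //; apply/measurable_EFinP.
  by apply: measurableT_comp => //; exact: measurable_indic.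
have mf : measurable_fun setT (fun sw : m.-tuple R * Omega =>
    (\1_B sw.1)%:E * expeR (Z sw.1 sw.2) * X sw.2).
  by apply: emeasurable_funM => //; exact: measurableT_comp.
transitivity (\int[P]_w \int[smu]_s ((\1_B s)%:E * expeR (Z s w) * X w)).
  apply: eq_integral => w _; rewrite -(lattice_integralZr delta0)//.
  by move=> s; rewrite mule_ge0 ?expeR_ge0// lee_fin.
rewrite -(fubini_tonelli (m1 := smu) (m2 := P) _ mf)/=; last first.
  by move=> sw; rewrite !mule_ge0 ?expeR_ge0// lee_fin.
apply: eq_integral => s _; rewrite -ge0_integralZl//.
- by apply: eq_integral => w _; rewrite muleA.
- apply: emeasurable_funM => //; exact: (measurableT_comp my (pair1_measurable s)).
- by move=> w _; rewrite mule_ge0 ?expeR_ge0.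
Qed.

Let le_on_lattice (f g : m.-tuple R -> \bar R) :
  (forall s, 0 <= f s) -> (forall s, 0 <= g s) ->
  (forall s, L s -> f s <= g s) -> \int[mu]_s f s <= \int[mu]_s g s.
Proof.
move=> f0 g0 fg; apply: ge0_ae_le_integral => //.
exists (~` L); split; [|exact: lattice_measure_setC|exact: subsetC].
by apply: measurableC; exact: measurable_lattice.
Qed.

Let integral_share B (c : \bar R) : measurable B -> 0 <= c ->
  \int[mu]_s ((\1_B s)%:E * c) = mu B * c.
Proof.
move=> mB c0; rewrite (lattice_integralZr delta0)//.
by rewrite integral_indic// setIT.
Qed.

Let sup_share_ge0 A : A !=set0 -> 0 <= sup_share A.
Proof. by move=> A0; apply: integral_ge0 => w _; rewrite mule_ge0 ?psup_ge0. Qed.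

Let sum_share_ge0 B : 0 <= sum_share B.
Proof. by apply: integral_ge0 => w _; rewrite mule_ge0 ?lsum_ge0. Qed.

Let cst_share_ge0 B (c : Omega -> \bar R) s : (forall w, 0 <= c w) ->
  0 <= (\1_B s)%:E * \int[P]_w (expeR (Z s w) * c w).
Proof.
move=> c0; rewrite mule_ge0 ?lee_fin//; apply: integral_ge0 => w _.
by rewrite mule_ge0 ?expeR_ge0.
Qed.

(** Share the supremum over [C] between the points [s] of the lattice in proportion
    to [exp (Z s)], keep the points of [B], and root [Z] at each of them. *)
Lemma mean_psup_ge A B C : countable A -> A !=set0 -> countable C -> measurable B ->
  (forall s t, L s -> B s -> A t -> C (tshift s t)) ->
  C !=set0 ->
  mu B * sup_share A <= \int[P]_w psup C (Z^~ w).
Proof.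
move=> cA A0 cC mB ABC C0.
have mC : measurable_fun setT (fun w => psup C (Z^~ w)).
  exact: (measurableT_comp (measurable_psup cC) mpZ).
have mratio : measurable_fun setT (fun w => psup C (Z^~ w) / lsum setT (Z^~ w)).
  by apply: emeasurable_funM => //; exact: (measurableT_comp minv_lsum mpZ).
have ratio0 w : 0 <= psup C (Z^~ w) / lsum setT (Z^~ w).
  by rewrite mule_ge0 ?psup_ge0.
apply: (@le_trans _ _ (\int[P]_w (lsum B (Z^~ w) * (psup C (Z^~ w) / lsum setT (Z^~ w))))); last first.
  apply: ge0_le_integral => //.
  - by move=> w _; rewrite mule_ge0 ?lsum_ge0.
  - by apply: emeasurable_funM => //; exact: (measurableT_comp (measurable_lsum delta0 _) mpZ).
  move=> w _; rewrite muleCA -[leRHS]mule1 lee_wpmul2l ?psup_ge0//.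
  by apply: ratio_le1; [exact: lsum_ge0|exact: le_lsum].
rewrite integral_lsum_mul// -integral_share ?sup_share_ge0//.
apply: le_on_lattice => [s|s|s Ls].
- by rewrite mule_ge0 ?lee_fin ?sup_share_ge0.
- exact: cst_share_ge0.
have [Bs|nBs] := pselect (B s); last by rewrite indicE memNset// !mul0e.
rewrite lee_wpmul2l ?lee_fin// (sup_shareE cA A0 Ls); apply: ge0_le_integral => //.
- move=> w _; rewrite mule_ge0 ?expeR_ge0// mule_ge0// psup_ge0//.
  by have [t At] := A0; exists (tshift s t); exists t.
- apply: emeasurable_funM; first exact: (measurableT_comp my (pair1_measurable s)).
  apply: emeasurable_funM; last exact: (measurableT_comp minv_lsum mpZ).
  apply: (measurableT_comp (measurable_psup _) mpZ).
  exact: (sub_countable (card_image_le _ _)).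
- by apply: emeasurable_funM => //; exact: (measurableT_comp my (pair1_measurable s)).
move=> w _; rewrite lee_wpmul2l ?expeR_ge0// lee_wpmul2r//; apply: le_psup.
by move=> _ [t At <-]; exact: ABC.
Qed.

Hypothesis D_finite : {ae P, forall w, lsum setT (Z^~ w) < +oo}.

(** In the same decomposition, the share of the points outside [B] is at most the
    sum of [exp Z] over [Q] times the relative weight of these points, and it is now
    the terms of that sum at which [Z] is rooted. *)
Lemma mean_psup_le (B B' C Q : set (m.-tuple R)) : countable C -> C !=set0 -> C `<=` L `&` Q ->
  measurable B -> measurable Q ->
  (forall s t, L s -> L t -> Q t -> ~ B s -> B' (translate t s)) ->
  \int[P]_w psup C (Z^~ w) <= mu B * sup_share L + mu Q * sum_share B'.
Proof.
move=> cC C0 CLQ mB mQ BB'.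
have cL : countable L := countable_lattice delta0.
have L0 : L !=set0 by exists origin; exact: lattice_origin.
have mC : measurable_fun setT (fun w => psup C (Z^~ w)).
  exact: (measurableT_comp (measurable_psup cC) mpZ).
have mlsum A : measurable_fun setT (fun w => lsum A (Z^~ w)).
  exact: (measurableT_comp (measurable_lsum delta0 _) mpZ).
have minv : measurable_fun setT (fun w => (lsum setT (Z^~ w))^-1).
  exact: (measurableT_comp minv_lsum mpZ).
pose X1 w := psup C (Z^~ w) / lsum setT (Z^~ w).
pose X2 w := lsum (~` B) (Z^~ w) / lsum setT (Z^~ w).
have X10 w : 0 <= X1 w by rewrite mule_ge0 ?psup_ge0.
have X20 w : 0 <= X2 w by rewrite mule_ge0 ?lsum_ge0.
have mX1 : measurable_fun setT X1 by exact: emeasurable_funM.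
have mX2 : measurable_fun setT X2 by exact: emeasurable_funM.
apply: (@le_trans _ _ (\int[P]_w (lsum B (Z^~ w) * X1 w + lsum Q (Z^~ w) * X2 w))).
  apply: ge0_ae_le_integral.
  - by move=> w; exact: psup_ge0.
  - by move=> w; rewrite adde_ge0// mule_ge0 ?lsum_ge0.
  apply: filterS D_finite => w Doo.
  have SQ : psup C (Z^~ w) <= lsum Q (Z^~ w) by apply: psup_le_lsum => t /CLQ.
  have SD : psup C (Z^~ w) <= lsum setT (Z^~ w) by apply: psup_le_lsum => t /CLQ[].
  have := lsum_ge0 delta setT (Z^~ w); rewrite le_eqVlt => /predU1P[D0|D0].
    rewrite (le_trans SD)// -D0 adde_ge0// mule_ge0 ?lsum_ge0//.
  rewrite -[leLHS]mule1 -(ratio_self D0 Doo) -{1}(lsumUC delta0 B).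
  rewrite ge0_muleDl ?lsum_ge0// ge0_muleDr ?mule_ge0 ?lsum_ge0//.
  apply: leeD; first by rewrite /X1 muleCA.
  by apply: lee_wpmul2r SQ; exact: X20.
rewrite ge0_integralD//; last 4 first.
- by move=> w _; rewrite mule_ge0 ?lsum_ge0.
- exact: emeasurable_funM.
- by move=> w _; rewrite mule_ge0 ?lsum_ge0.
- exact: emeasurable_funM.
rewrite !integral_lsum_mul// -!integral_share ?sup_share_ge0//.
apply: leeD; apply: le_on_lattice => [s|s|s Ls]; do ?exact: cst_share_ge0.
- by rewrite mule_ge0 ?lee_fin ?sup_share_ge0.
- rewrite lee_wpmul2l ?lee_fin// (sup_shareE cL L0 Ls); apply: ge0_le_integral => //.
  + by move=> w _; rewrite mule_ge0 ?expeR_ge0.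
  + by apply: emeasurable_funM => //; exact: (measurableT_comp my (pair1_measurable s)).
  + apply: emeasurable_funM; first exact: (measurableT_comp my (pair1_measurable s)).
    apply: emeasurable_funM => //; apply: (measurableT_comp (measurable_psup _) mpZ).
    exact: (sub_countable (card_image_le _ _)).
  move=> w _; rewrite lee_wpmul2l ?expeR_ge0// lee_wpmul2r//; apply: le_psup => t /CLQ[Lt _].
  by exists (translate s t); [exact: lattice_translate|exact: translateK].
- by rewrite mule_ge0 ?lee_fin.
have [Qs|nQs] := pselect (Q s); last by rewrite indicE memNset// !mul0e.
rewrite lee_wpmul2l ?lee_fin// (sum_shareE _ Ls); apply: ge0_le_integral => //.
+ by move=> w _; rewrite mule_ge0 ?expeR_ge0.
+ by apply: emeasurable_funM => //; exact: (measurableT_comp my (pair1_measurable s)).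
+ apply: emeasurable_funM; first exact: (measurableT_comp my (pair1_measurable s)).
  exact: emeasurable_funM.
move=> w _; rewrite lee_wpmul2l ?expeR_ge0// lee_wpmul2r//; apply: le_lsum => t Lt Bt.
exact: BB'.
Qed.

End lattice_pickands_bounds.

Section limits_at_infinity.
Context {R : realType}.

Lemma cvg_ratio_expr (c : R) (d : nat) :
  (((T + c) / T) ^+ d)%R @[T --> +oo%R] --> (1%R : R).
Proof.
rewrite -[X in _ --> X](expr1n R d); apply: (@cvg_comp _ _ _ (fun T => (T + c) / T)%R (fun x => x ^+ d)%R); last exact: exprn_continuous.
have cT : (1 + c * T^-1)%R @[T --> +oo%R] --> (1%R : R).
  rewrite -[X in _ --> X]addr0; apply: cvgD; first exact: cvg_cst.
  rewrite -[X in _ --> X](mulr0 c); apply: cvgMr; 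
  apply/cvgrPdist_lt => e e0; near=> T.
  have T0 : (0 < T)%R by near: T; exact: nbhs_pinfty_gt.
  rewrite sub0r normrN gtr0_norm ?invr_gt0// invf_plt ?posrE//.
  by near: T; apply: nbhs_pinfty_gt; exact: num_real.
apply: cvg_trans cT; apply: near_eq_cvg; near=> T.
have T0 : (T != 0)%R by rewrite gt_eqF//; near: T; exact: nbhs_pinfty_gt.
by rewrite mulrDl divff.
Unshelve. all: by end_near. Qed.

(** The bounds at a fixed margin [k] leave a gap in the limit, which closes when
    [k] grows. *)
Lemma squeeze_family (b : R -> R) (lo up : nat -> R -> R) (l u : nat -> R) (e : R) :
  (forall k, \forall T \near +oo%R, (lo k T <= b T <= up k T)%R) ->
  (forall k, lo k T @[T --> +oo%R] --> l k) ->
  (forall k, up k T @[T --> +oo%R] --> u k) ->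
  l @ \oo --> e -> u @ \oo --> e -> b T @[T --> +oo%R] --> e.
Proof.
move=> bb lol upu le ue; apply/cvgrPdist_lt => eps eps0.
have [k [lk uk]] : exists k, (e - eps < l k)%R /\ (u k < e + eps)%R.
  have [k] : exists k, (e - eps < l k)%R && (u k < e + eps)%R; last by case/andP; exists k.
  near \oo => k; exists k; apply/andP; split.
    near: k; apply: cvgr_gt le _ _; by rewrite ltrBlDr ltrDl.
  by near: k; apply: cvgr_lt ue _ _; rewrite ltrDl.
near=> T; rewrite ltr_distlC.
have /andP[lb bu] : (lo k T <= b T <= up k T)%R by near: T.
apply/andP; split.
  apply: lt_le_trans lb; near: T; have := lol k; move=> /cvgr_gt; exact.
by apply: le_lt_trans bu _; near: T; have := upu k; move=> /cvgr_lt; exact.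
Unshelve. all: by end_near. Qed.

End limits_at_infinity.

Section psup_limits.
Context {R : realType} {m : nat}.
Local Notation path := (path_space R (m.-tuple R)).

Lemma psup_cvg (A : nat -> set (m.-tuple R)) (B : set (m.-tuple R)) (f : path) :
  (forall k l, (k <= l)%N -> A k `<=` A l) -> \bigcup_k A k = B ->
  psup (A k) f @[k --> \oo] --> psup B f.
Proof.
move=> ndA AB; rewrite (_ : psup B f = ereal_sup (range (fun k => psup (A k) f))).
  by apply: ereal_nondecreasing_cvgn => k l kl; apply: le_psup; exact: ndA.
apply/eqP; rewrite eq_le; apply/andP; split.
  apply: ge_ereal_sup => _ [t Bt <-]; move: Bt; rewrite -AB => -[k _ At].
  apply: (@le_trans _ _ (psup (A k) f)); first by apply: ereal_sup_ubound; exists t.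
  by apply: ereal_sup_ubound; exists k.
by apply: ge_ereal_sup => _ [k _ <-]; apply: le_psup => t At; rewrite -AB; exists k.
Qed.

Lemma le_box (a b c d : R) : (c <= a)%R -> (b <= d)%R -> @box R m a b `<=` box c d.
Proof.
move=> ca bd t tab j; have /andP[ta tb] := tab j.
by rewrite (le_trans ca ta) (le_trans tb bd).
Qed.

Definition growing_box (k : nat) : set (m.-tuple R) := box (- k%:R)%R k%:R.

Lemma growing_box_nd k l : (k <= l)%N -> growing_box k `<=` growing_box l.
Proof. by move=> kl; apply: le_box; rewrite ?lerN2 ler_nat. Qed.

Lemma growing_box_near (t : m.-tuple R) : \forall k \near \oo, growing_box k t.
Proof.
have : \forall k \near \oo, forall j, (`|tnth t j| <= k%:R)%R.
  by apply: filter_forall => j; exact: nbhs_infty_ger.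
by apply: filterS => k tk j; rewrite -ler_norml.
Qed.

Lemma bigcup_growing_box : \bigcup_k growing_box k = setT.
Proof.
apply/seteqP; split => // t _; have [k _ /(_ k (leqnn k)) tk] := growing_box_near t.
by exists k.
Qed.

End psup_limits.

Section shares.
Context {R : realType} {m : nat}.
Variable delta : R.
Hypothesis delta0 : (0 < delta)%R.
Local Notation path := (path_space R (m.-tuple R)).
Local Notation L := (@lattice R m delta).
Local Notation mu := (@lattice_measure R m delta).
Local Notation lsum := (@lattice_sum R m delta).
Context dW (OmegaW : measurableType dW) (PW : probability OmegaW R).
Variable Theta : m.-tuple R -> OmegaW -> \bar R.
Hypothesis mTheta : measurable_process Theta.
Hypothesis D_finite : {ae PW, forall w, lsum setT (Theta^~ w) < +oo}.
Hypothesis Theta_origin : {ae PW, forall w, Theta origin w = 0}.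
Local Notation sup_share := (sup_share delta PW Theta).
Local Notation sum_share := (sum_share delta PW Theta).

Let mpT : measurable_fun setT (fun w => Theta^~ w : path).
Proof. exact/measurable_path. Qed.

Let minv : measurable_fun setT (fun w => (lsum setT (Theta^~ w))^-1).
Proof.
apply: measurable_inve; first by move=> w; exact: lsum_ge0.
exact: (measurableT_comp (measurable_lsum delta0 _) mpT).
Qed.

Let inv_ge0 w : 0 <= (lsum setT (Theta^~ w))^-1.
Proof. by rewrite inve_ge0 lsum_ge0. Qed.

Let mpsup_ratio A : countable A ->
  measurable_fun setT (fun w => psup A (Theta^~ w) / lsum setT (Theta^~ w)).
Proof.
move=> cA; apply: emeasurable_funM => //.
exact: (measurableT_comp (measurable_psup cA) mpT).
Qed.

Let mlsum_ratio A :
  measurable_fun setT (fun w => lsum A (Theta^~ w) / lsum setT (Theta^~ w)).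
Proof.
apply: emeasurable_funM => //.
exact: (measurableT_comp (measurable_lsum delta0 _) mpT).
Qed.

Let cL : countable L := countable_lattice delta0.

Let sub_countable_lattice A : A `<=` L -> countable A.
Proof. by move=> AL; exact: (sub_countable (subset_card_le AL) cL). Qed.

Lemma sup_share_le1 A : A `<=` L -> A !=set0 -> 0 <= sup_share A <= 1.
Proof.
move=> AL A0; rewrite integral_ge0/= => [|w _]; last by rewrite mule_ge0 ?psup_ge0.
apply: (@le_trans _ _ (\int[PW]_w cst 1 w)).
  apply: ge0_le_integral => //.
  - by move=> w _; rewrite mule_ge0 ?psup_ge0.
  - exact: (mpsup_ratio (sub_countable_lattice AL)).
  move=> w _; apply: ratio_le1; first exact: psup_ge0.
  by apply: psup_le_lsum => t /AL.
by rewrite integral_cst// mul1e; exact: probability_le1.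
Qed.

Lemma sum_share_le1 B : 0 <= sum_share B <= 1.
Proof.
rewrite integral_ge0/= => [|w _]; last by rewrite mule_ge0 ?lsum_ge0.
apply: (@le_trans _ _ (\int[PW]_w cst 1 w)).
  apply: ge0_le_integral => //.
  - by move=> w _; rewrite mule_ge0 ?lsum_ge0.
  move=> w _; apply: ratio_le1; first exact: lsum_ge0.
  exact: le_lsum.
by rewrite integral_cst// mul1e; exact: probability_le1.
Qed.

Let D_ge1 w : Theta origin w = 0 -> 1 <= lsum setT (Theta^~ w).
Proof.
move=> T0; rewrite -expeR0 -T0; apply: expeR_le_lsum => //.
exact: lattice_origin.
Qed.

Let inv_fin w : Theta origin w = 0 -> (lsum setT (Theta^~ w))^-1 \is a fin_num.
Proof.
move=> /D_ge1; case: (lsum _ _) => [r| |]//; rewrite ?invey// lee_fin => r1.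
by rewrite inver gt_eqF// (lt_le_trans ltr01).
Qed.

Lemma sup_share_gt0 : 0 < sup_share L.
Proof.
have L0 : L !=set0 by exists origin; exact: lattice_origin.
have /andP[s0 _] := sup_share_le1 (@subset_refl _ L) L0.
rewrite lt_neqAle s0 andbT eq_sym; apply/eqP => s00.
have : \int[PW]_w `|psup L (Theta^~ w) / lsum setT (Theta^~ w)| = 0.
  by rewrite -s00; apply: eq_integral => w _; rewrite gee0_abs// mule_ge0 ?psup_ge0.
move/(ae_eq_integral_abs _ measurableT (mpsup_ratio cL)) => z.
have : {ae PW, forall w, False}.
  apply: filterS3 z D_finite Theta_origin => w /(_ Logic.I) + Doo T0.
  apply/eqP; rewrite mule_eq0 inve_eq0 (lt_eqF Doo) orbF gt_eqF//.
  apply: (@lt_le_trans _ _ 1) => //; rewrite -expeR0 -T0.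
  by apply: ereal_sup_ubound; exists origin => //; exact: lattice_origin.
move=> [N [mN N0 /(_ _ _)]]; move=> sub.
have NT : N = setT by apply/seteqP; split => // w _; exact: sub.
by move: N0; rewrite NT probability_setT => /eqP; rewrite eqe oner_eq0.
Qed.

Lemma sup_share_cvg : sup_share (L `&` growing_box k) @[k --> \oo] --> sup_share L.
Proof.
have Lk0 k : (L `&` growing_box k) !=set0.
  by exists origin; split; [exact: lattice_origin|move=> j; rewrite tE oppr_le0 ler0n].
have Lk k : L `&` growing_box k `<=` L by move=> t [].
have [] // := @dominated_convergence _ _ _ PW setT measurableT
  (fun k w => psup (L `&` growing_box k) (Theta^~ w) / lsum setT (Theta^~ w))
  (fun w => psup L (Theta^~ w) / lsum setT (Theta^~ w)) (cst 1).
- by move=> k; exact: (mpsup_ratio (sub_countable_lattice (Lk k))).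
- exact: mpsup_ratio.
- apply: filterS Theta_origin => w T0 _; apply: cvgeZr; first exact: inv_fin.
  apply: psup_cvg => [k l kl t [Lt kt]|].
    by split => //; exact: (growing_box_nd kl).
  by rewrite -setI_bigcupr bigcup_growing_box setIT.
- exact: finite_measure_integrable_cst.
- apply: aeW => w k _; rewrite gee0_abs ?mule_ge0 ?psup_ge0//.
  apply: ratio_le1; first exact: psup_ge0.
  by apply: psup_le_lsum => t [].
Qed.

Let sum_tail_cvg w : lsum setT (Theta^~ w) < +oo ->
  lsum (~` growing_box k) (Theta^~ w) @[k --> \oo] --> 0.
Proof.
move=> Doo.
pose f k := (fun s : m.-tuple R => (\1_(~` growing_box k) s)%:E * expeR (Theta s w)) \_ L.
have e0 B (s : m.-tuple R) : 0 <= (\1_B s)%:E * expeR (Theta s w) :> \bar R.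
  by rewrite mule_ge0 ?expeR_ge0// lee_fin.
have mf k : measurable_fun setT (f k) by exact: (measurable_patch_lattice delta0).
have -> : (fun k => lsum (~` growing_box k) (Theta^~ w)) = (fun k => \int[mu]_s f k s).
  by apply/funext => k; rewrite /lattice_sum (integral_lattice_patch delta (e0 _)).
rewrite -(integral0 mu setT).
have [] // := @dominated_convergence _ _ _ mu setT measurableT
  f (cst 0) ((fun s => expeR (Theta s w)) \_ L).
- apply: aeW => s _; apply: cvg_near_cst; apply: filterS (growing_box_near s) => k ks.
  rewrite /f patchE; case: ifP => // _; rewrite indicE memNset ?mul0e//; move=> n; exact: (n ks).
- apply/integrableP; split; first exact: (measurable_patch_lattice delta0).
  rewrite (_ : \int[_]_x _ = lsum setT (Theta^~ w))//.
  rewrite /lattice_sum (integral_lattice_patch delta (e0 _)); apply: eq_integral => s _.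
  rewrite gee0_abs; last by apply: erestrict_ge0 => t _; exact: expeR_ge0.
  by rewrite !patchE indicT mul1e.
- apply: aeW => s k _; rewrite gee0_abs /f; last exact: erestrict_ge0.
  rewrite !patchE; case: ifP => // _; rewrite -[leRHS]mul1e lee_wpmul2r ?expeR_ge0//.
  by rewrite lee_fin indicE; case: (_ \in _).
Qed.

Lemma sum_share_tail_cvg : sum_share (~` growing_box k) @[k --> \oo] --> 0.
Proof.
rewrite -(integral0 PW setT).
have [] // := @dominated_convergence _ _ _ PW setT measurableT
  (fun k w => lsum (~` growing_box k) (Theta^~ w) / lsum setT (Theta^~ w))
  (cst 0) (cst 1).
- apply: filterS2 D_finite Theta_origin => w Doo T0 _.
  rewrite -[X in _ --> X](mul0e (lsum setT (Theta^~ w))^-1).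
  by apply: cvgeZr; [exact: inv_fin|exact: sum_tail_cvg].
- exact: finite_measure_integrable_cst.
- apply: aeW => w k _; rewrite gee0_abs ?mule_ge0 ?lsum_ge0//.
  apply: ratio_le1; first exact: lsum_ge0.
  exact: le_lsum.
Qed.

End shares.

(** * The discrete Pickands constant *)

Section lattice_pickands.
Context {R : realType} {m : nat}.
Variable delta : R.
Hypothesis delta0 : (0 < delta)%R.
Local Notation path := (path_space R (m.-tuple R)).
Local Notation L := (@lattice R m delta).
Local Notation mu := (@lattice_measure R m delta).
Local Notation lsum := (@lattice_sum R m delta).

Context dO (Omega : measurableType dO) (P : probability Omega R).
Variable Z : m.-tuple R -> Omega -> \bar R.
Hypothesis mZ : measurable_fun setT
  (fun tw : (m.-tuple R * Omega)%type => Z tw.1 tw.2).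
Hypothesis Zoo : forall t w, Z t w < +oo.
Hypothesis Z_integrable :
  {ae P, forall w, \int[lebesgue_tuple m]_t expeR (Z t w) < +oo}.
Context dW (OmegaW : measurableType dW) (PW : probability OmegaW R).
Variable Theta : m.-tuple R -> OmegaW -> \bar R.
Hypothesis mTheta : measurable_process Theta.
Hypothesis transfer : forall h (F : path -> \bar R),
  measurable_fun setT F -> (forall f, 0 <= F f) ->
  \int[PW]_w F (Theta^~ w) = \int[P]_w (expeR (Z h w) * F (increment Z h w)).
Local Notation sup_share := (sup_share delta PW Theta).
Local Notation sum_share := (sum_share delta PW Theta).

Lemma theta_origin : {ae PW, forall w, Theta origin w = 0}.
Proof.
pose S : set path := [set f | f origin != 0].
have mS : measurable S.
  rewrite (_ : S = ~` ((fun f : path => f origin) @^-1` [set 0])); last first.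
    by apply/seteqP; split => f /eqP.
  apply: measurableC; rewrite -[X in measurable X]setTI.
  exact: (measurable_eval (I := m.-tuple R)).
have mSW : measurable [set w | S (Theta^~ w)].
  rewrite -[X in measurable X]setTI; apply: (proj1 (measurable_path Theta) mTheta) => //.
exists [set w | S (Theta^~ w)]; split => //; last by move=> w /= /eqP.
have -> : PW [set w | S (Theta^~ w)] = \int[PW]_w (\1_S (Theta^~ w : path))%:E.
  rewrite integral_indic ?setIT//.
rewrite (@transfer origin (fun f => (\1_S f)%:E)); last 2 first.
- by apply/measurable_EFinP; exact: measurable_indic.
- by move=> f; rewrite lee_fin.
apply: integral0_eq => w _; have [Zo|Zo] := eqVneq (Z origin w) -oo; first by rewrite Zo mul0e.
rewrite indicE memNset ?mule0// => /eqP; apply.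
by rewrite /increment tshift_origin subee// fin_numE Zo lt_eqF.
Qed.

Let D_W : {ae PW, forall w, lsum setT (Theta^~ w) < +oo}.
Proof. exact: (theta_lsum_finite delta0 mZ Zoo mTheta transfer Z_integrable). Qed.

Let D_Z : {ae P, forall w, lsum setT (Z^~ w) < +oo}.
Proof. exact: (Z_lsum_finite delta0 mZ Zoo transfer Z_integrable). Qed.

Let cL : countable L := countable_lattice delta0.
Let L0 : L !=set0. Proof. by exists origin; exact: lattice_origin. Qed.
Let cLI A : countable (L `&` A).
Proof. by apply: (sub_countable (subset_card_le _) cL) => t []. Qed.

Let Lk0 k : (L `&` growing_box k) !=set0.
Proof.
by exists origin; split; [exact: lattice_origin|move=> j; rewrite tE oppr_le0 ler0n].
Qed.

Let Lcube0 (T : R) : (0 <= T)%R -> (L `&` cube T) !=set0.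
Proof.
by move=> T0; exists origin; split; [exact: lattice_origin|move=> j; rewrite tE lexx].
Qed.

Let a (T : R) := \int[P]_w psup (L `&` cube T) (Z^~ w).

Let dd : (0 < delta ^+ m)%R. Proof. exact: exprn_gt0. Qed.

Let mean_lower k (T : R) : (k%:R + k%:R + delta <= T)%R ->
  ((T - (k%:R + k%:R + delta)) ^+ m)%:E * sup_share (L `&` growing_box k) <=
  (delta ^+ m)%:E * a T.
Proof.
move=> kT; have T0 : (0 <= T)%R.
  by apply: le_trans kT; rewrite !addr_ge0// ltW.
have /andP[s0 _] := sup_share_le1 delta0 PW mTheta (@subIsetl _ L (growing_box k)) (Lk0 k).
have bk : (k%:R + delta <= T - k%:R)%R by rewrite lerBrDr addrAC.
have := @lattice_measure_box_ge R m delta delta0 k%:R (T - k%:R)%R bk.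
rewrite (_ : T - k%:R - k%:R - delta = T - (k%:R + k%:R + delta))%R; last by rewrite !opprD !addrA.
move=> H; apply: (le_trans (lee_wpmul2r s0 H)); rewrite -muleA lee_wpmul2l ?lee_fin ?(ltW dd)//.
apply: (mean_psup_ge delta0 mZ Zoo transfer (cLI _) (Lk0 k) (cLI _) (measurable_box _ _)); last by exact: Lcube0.
- move=> s t Ls Bs [Lt kt]; split; first exact: lattice_tshift.
  move=> j; have /andP[s1 s2] := Bs j; have /andP[t1 t2] := kt j; rewrite tE.
  by rewrite -(addNr (k%:R : R)%R) lerD//= -(subrK k%:R T) addrC lerD.
Qed.

Let mean_upper k (T : R) : (0 <= T)%R ->
  (delta ^+ m)%:E * a T <=
  ((T + (k%:R + k%:R + delta)) ^+ m)%:E * sup_share L +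
  ((T + delta) ^+ m)%:E * sum_share (~` growing_box k).
Proof.
move=> T0.
have /andP[s0 _] := sup_share_le1 delta0 PW mTheta (@subset_refl _ L) L0.
have /andP[t0 _] := sum_share_le1 delta0 PW mTheta (~` growing_box k).
have bk : (- k%:R <= T + k%:R)%R by rewrite (@le_trans _ _ 0%R)// ?oppr_le0 ?addr_ge0.
have H1 := @lattice_measure_box_le R m delta delta0 _ _ bk.
have H2 := @lattice_measure_box_le R m delta delta0 _ _ T0.
rewrite (_ : T + k%:R - - k%:R + delta = T + (k%:R + k%:R + delta))%R in H1; last by rewrite opprK !addrA.
rewrite subr0 in H2.
apply: le_trans (leeD (lee_wpmul2r s0 H1) (lee_wpmul2r t0 H2)).
rewrite -!muleA -ge0_muleDr ?mule_ge0//; last first.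
rewrite lee_wpmul2l ?lee_fin ?(ltW dd)//.
apply: (mean_psup_le delta0 mZ Zoo transfer D_Z) => //; do ?exact: measurable_box.
- exact: Lcube0.
- move=> s t Ls Lt Qt Bs kst; apply: Bs => j.
  have /andP[t1 t2] := Qt j; have := kst j; rewrite tE => /andP[s1 s2].
  apply/andP; split; first by apply: le_trans s1 _; rewrite gerBl.
  by move: s2; rewrite lerBlDl => /le_trans -> //; rewrite lerD2r.
Qed.

(** Most points of a large cube are far from its boundary, so that the cost of
    replacing the cube by the whole lattice, seen from a random point of it
    chosen with weight [exp Z], disappears in the limit. *)
Lemma lattice_pickands_cvg :
  pickands_mean P Z delta T @[T --> +oo%R] -->
  ((delta ^+ m)^-1)%:E * sup_share L.
Proof.
have s01 A : A `<=` L -> A !=set0 -> sup_share A \is a fin_num.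
  move=> AL A0; have /andP[s0 s1] := sup_share_le1 delta0 PW mTheta AL A0.
  by rewrite ge0_fin_numE// (le_lt_trans s1)// ltry.
have t01 A : sum_share A \is a fin_num.
  have /andP[s0 s1] := sum_share_le1 delta0 PW mTheta A.
  by rewrite ge0_fin_numE// (le_lt_trans s1)// ltry.
have a0 T : (0 <= T)%R -> 0 <= a T.
  by move=> T0; apply: integral_ge0 => w _; apply: psup_ge0; exact: Lcube0.
have aoo T : (0 <= T)%R -> a T \is a fin_num.
  move=> T0; rewrite ge0_fin_numE ?a0//.
  have := mean_upper 0%N T0; rewrite -(fineK (s01 _ (@subset_refl _ L) L0)) -(fineK (t01 _)).
  have := a0 T T0; case: (a T) => // [r _ _|_]; first exact: ltry.
  by rewrite gt0_muley// -!EFinM -EFinD.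
pose e := fine (sup_share L).
pose ek k := fine (sup_share (L `&` growing_box k)).
pose tk k := fine (sum_share (~` growing_box k)).
pose b T := (delta ^+ m * (T ^- m * fine (a T)))%R.
have be : b T @[T --> +oo%R] --> e.
  apply: (@squeeze_family _ b
    (fun k T => ((T - (k%:R + k%:R + delta)) / T) ^+ m * ek k)%R
    (fun k T => ((T + (k%:R + k%:R + delta)) / T) ^+ m * e + ((T + delta) / T) ^+ m * tk k)%R
    ek (fun k => e + tk k)%R).
  - move=> k; near=> T.
    have T0 : (0 < T)%R by near: T; exact: nbhs_pinfty_gt.
    have kT : (k%:R + k%:R + delta <= T)%R by near: T; apply: nbhs_pinfty_ge; exact: num_real.
    have lo := mean_lower kT; have up := mean_upper k (ltW T0).
    rewrite -(fineK (s01 _ (@subIsetl _ L (growing_box k)) (Lk0 k))) -(fineK (aoo _ (ltW T0))) -!EFinM lee_fin in lo.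
    rewrite -(fineK (s01 _ (@subset_refl _ L) L0)) -(fineK (t01 _)) -(fineK (aoo _ (ltW T0))) -!EFinM -EFinD lee_fin in up.
    rewrite /b mulrCA !exprMn exprVn -!mulrA ![(T ^- m * _)%R]mulrC !mulrA -mulrDl.
    by rewrite !ler_pM2r ?invr_gt0 ?exprn_gt0// lo up.
  - move=> k; rewrite -[X in _ --> X]mul1r; apply: cvgM; [exact: cvg_ratio_expr|exact: cvg_cst].
  - move=> k; rewrite (_ : e + tk k = 1 * e + 1 * tk k)%R; last by rewrite !mul1r.
    by apply: cvgD; (apply: cvgM; last exact: cvg_cst); exact: cvg_ratio_expr.
  - apply: fine_cvg; rewrite fineK; last exact: s01.
    exact: (sup_share_cvg delta0 mTheta theta_origin).
  - rewrite -[X in _ --> X]addr0; apply: cvgD; first exact: cvg_cst.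
    apply: (@fine_cvg _ _ _ _ _ 0%R).
    exact: (sum_share_tail_cvg delta0 mTheta D_W theta_origin).
rewrite -(fineK (s01 _ (@subset_refl _ L) L0)) -EFinM -/e.
apply: (@cvg_trans _ ((((delta ^+ m)^-1 * b T)%:E) @[T --> +oo%R])).
  apply: near_eq_cvg; near=> T.
  have T0 : (0 < T)%R by near: T; exact: nbhs_pinfty_gt.
  rewrite /b mulrA mulVf ?gt_eqF// mul1r /pickands_mean EFinM fineK//.
  exact: aoo (ltW T0).
apply: cvg_EFin; first by apply: nearW.
by apply: cvgMr.
Unshelve. all: by end_near. Qed.

End lattice_pickands.

(** * Peaks of the lattice field *)

Section lattice_peaks.
Context {R : realType} {m : nat}.
Variable delta : R.
Hypothesis delta0 : (0 < delta)%R.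
Local Notation path := (path_space R (m.-tuple R)).
Local Notation L := (@lattice R m delta).
Local Notation mu := (@lattice_measure R m delta).
Local Notation lsum := (@lattice_sum R m delta).

Definition peak (s : m.-tuple R) : set path := [set f | forall t, L t -> f t <= f s].

Lemma measurable_peak s : measurable (peak s).
Proof.
rewrite (_ : peak s = ~` \bigcup_(t in L) ~` [set f : path | f t <= f s]); last first.
  apply/seteqP; split => f /=; first by move=> fs [t Lt]; apply; exact: fs.
  by move=> nf t Lt; apply: contrapT => ft; apply: nf; exists t.
apply: measurableC; apply: countable_bigcup_measurable => [|t _]; first exact: countable_lattice.
apply: measurableC; rewrite -[X in measurable X]setTI.
by apply: measurable_lee => //; exact: measurable_eval.
Qed.

Lemma lattice_fubini dW (OmegaW : measurableType dW) (PW : probability OmegaW R)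
    (g : m.-tuple R -> OmegaW -> \bar R) :
  (forall s, L s -> measurable_fun setT (g s)) -> (forall s w, 0 <= g s w) ->
  \int[PW]_w \int[mu]_s g s w = \int[mu]_s \int[PW]_w g s w.
Proof.
move=> mg g0.
pose k s w := if s \in L then g s w else 0.
have k0 s w : 0 <= k s w by rewrite /k; case: ifP.
have mk : measurable_fun setT (fun sw : m.-tuple R * OmegaW => k sw.1 sw.2).
  apply: (measurable_countable_sections (countable_lattice delta0)) => [s Ls|s w Ls].
    by rewrite /k mem_set//; exact: mg.
  by rewrite /k memNset.
transitivity (\int[PW]_w \int[lattice_sf delta0]_s k s w).
  apply: eq_integral => w _; apply: integral_lattice_eq => // s sL.
  by rewrite /k sL.
rewrite -(fubini_tonelli (m1 := lattice_sf delta0) (m2 := PW) _ mk)/=; last by move=> sw; exact: k0.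
apply: integral_lattice_eq => [s|s|s sL]; do ?by apply: integral_ge0.
by apply: eq_integral => w _; rewrite /k sL.
Qed.

Lemma finite_set_max (T : choiceType) (A : set T) (g : T -> \bar R) : finite_set A -> A !=set0 ->
  exists2 s, A s & forall t, A t -> g t <= g s.
Proof.
move=> /finite_seqP[l ->]; elim: l => [[]//|x [|x' l] IH] _.
  by exists x => [|t]; rewrite /= inE ?eqxx// => /eqP ->.
have [|s sl gs] := IH; first by exists x'; rewrite /= inE eqxx.
have [xs|sx] := leP (g x) (g s).
  exists s => [|t]; rewrite /= inE; first by apply/orP; right.
  by move=> /orP[/eqP ->//|]; exact: gs.
exists x => [|t]; rewrite /= inE ?eqxx// => /orP[/eqP ->//|/gs].
by move=> /le_trans; apply; exact: ltW.
Qed.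

(** Only finitely many terms of a summable family are at least one. *)
Lemma peak_exists (f : path) : f origin = 0 -> lsum setT f < +oo ->
  exists2 s, L s & peak s f.
Proof.
move=> f0 Doo; pose A := L `&` [set s | 0 <= f s].
have finA : finite_set A.
  have mA : measurable A.
    apply: measurable_countable_tuple.
    by apply: (sub_countable (subset_card_le _) (countable_lattice delta0)) => t [].
  have : mu A < +oo.
    apply: le_lt_trans Doo; rewrite -[A in mu A]setIT -integral_indic//.
    apply: ge0_ae_le_integral => [s|s|]; do ?by rewrite ?mule_ge0 ?expeR_ge0// lee_fin.
    apply: aeW => s; rewrite indicT mul1e indicE.
    have [/set_mem[_ /= fs]|_] := boolP (s \in A); last exact: expeR_ge0.
    by rewrite -expeR0 lee_expeR.
  rewrite lattice_measureE setIidl => [|s []//]; rewrite /counting.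
  by case: asboolP.
have [|s [Ls fs] sm] := finite_set_max f finA.
  by exists origin; split; [exact: lattice_origin|rewrite /= f0].
exists s => // t Lt; have [ft|ft] := leP 0 (f t); first exact: sm.
exact: le_trans (ltW ft) fs.
Qed.

Lemma psup_peak (f : path) s : L s -> peak s f -> psup L f = expeR (f s).
Proof.
move=> Ls fs; apply/eqP; rewrite eq_le; apply/andP; split.
  by apply: ge_ereal_sup => _ [t Lt <-]; rewrite lee_expeR; exact: fs.
by apply: ereal_sup_ubound; exists s.
Qed.

Lemma lsum_unique_peak (f : path) (c : \bar R) s : L s -> peak s f ->
  (forall t, L t -> peak t f -> t = s) -> 0 <= c ->
  \int[mu]_t (expeR (f t) * ((\1_(peak t) f)%:E * c)) = psup L f * c.
Proof.
move=> Ls fs uniq c0; rewrite (psup_peak Ls fs).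
have mt := measurable_set1_tuple s.
rewrite (integral_lattice_eq (g := fun t => (\1_[set s] t)%:E * (expeR (f s) * c))).
- rewrite ge0_integralZr ?mule_ge0 ?expeR_ge0//; last first.
    by apply/measurable_EFinP; exact: measurable_indic.
  rewrite integral_indic// setIT lattice_measureE setIidl => [|t ->//].
  by rewrite /counting asboolT// fset_set1 cardfs1 mul1e.
- by move=> t; rewrite !mule_ge0 ?expeR_ge0 ?lee_fin.
- by move=> t; rewrite !mule_ge0 ?expeR_ge0 ?lee_fin.
move=> t /set_mem Lt; have [->|ts] := eqVneq t s.
  by rewrite !indicE !mem_set// !mul1e.
rewrite !indicE memNset; last by move=> /(uniq _ Lt) /eqP; apply/negP.
by rewrite memNset ?mul0e ?mule0//; move=> /eqP; apply/negP.
Qed.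

Context dO (Omega : measurableType dO) (P : probability Omega R).
Variable Z : m.-tuple R -> Omega -> \bar R.
Hypothesis Zoo : forall t w, Z t w < +oo.

Lemma tilted_peak_ratio s u h w : L h ->
  expeR (Z h w) * (expeR (increment Z h w s) *
    ((\1_(peak u) (increment Z h w))%:E * (lsum setT (increment Z h w))^-1)) =
  expeR (Z (tshift h s) w) * ((\1_(peak (tshift h u)) (Z^~ w : path))%:E *
    (expeR (Z h w) * (lsum setT (Z^~ w))^-1)).
Proof.
move=> Lh; have [Zh|Zh] := eqVneq (Z h w) -oo; first by rewrite Zh !mul0e !mule0.
have Zfin : Z h w \is a fin_num by rewrite fin_numE Zh lt_eqF.
have pk : (increment Z h w \in peak u) = ((Z^~ w : path) \in peak (tshift h u)).
  apply/idP/idP; rewrite !inE => pk t Lt.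
    have := pk (translate h t) (lattice_translate delta0 Lh Lt).
    by rewrite /increment translateK leeBlDr// subeK.
  by rewrite /increment leeBlDr// subeK//; apply: pk; exact: lattice_tshift.
rewrite !indicE pk; case: (_ \in _); last by rewrite !mul0e !mule0.
rewrite !mul1e lsum_increment// preimage_setT [in LHS]/increment expeRB//.
have D0 := lsum_gt0 (f := Z^~ w) Lh Zh.
have := Zfin; case: (Z h w) => // z _ /=; set r := expR z.
have r0 : (0 < r)%R := expR_gt0 z.
have E := ratio_cancel (expeR (Z (tshift h s) w)) r0 D0.
by rewrite [RHS]muleCA E.
Qed.

End lattice_peaks.

Section peak_probability.
Context {R : realType} {m : nat}.
Variable delta : R.
Hypothesis delta0 : (0 < delta)%R.
Local Notation path := (path_space R (m.-tuple R)).
Local Notation L := (@lattice R m delta).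
Local Notation mu := (@lattice_measure R m delta).
Local Notation lsum := (@lattice_sum R m delta).
Local Notation peak := (@peak R m delta).

Context dO (Omega : measurableType dO) (P : probability Omega R).
Variable Z : m.-tuple R -> Omega -> \bar R.
Hypothesis Zoo : forall t w, Z t w < +oo.
Context dW (OmegaW : measurableType dW) (PW : probability OmegaW R).
Variable Theta : m.-tuple R -> OmegaW -> \bar R.
Hypothesis mTheta : measurable_process Theta.
Hypothesis transfer : forall h (F : path -> \bar R),
  measurable_fun setT F -> (forall f, 0 <= F f) ->
  \int[PW]_w F (Theta^~ w) = \int[P]_w (expeR (Z h w) * F (increment Z h w)).
Hypothesis D_finite : {ae PW, forall w, lsum setT (Theta^~ w) < +oo}.
Hypothesis Theta_origin : {ae PW, forall w, Theta origin w = 0}.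

Let G s u (f : path) : \bar R :=
  expeR (f s) * ((\1_(peak u) f)%:E * (lsum setT f)^-1).

Let G0 s u f : 0 <= G s u f.
Proof. by rewrite !mule_ge0 ?expeR_ge0 ?lee_fin ?inve_ge0 ?lsum_ge0. Qed.

Let mG s u : measurable_fun setT (G s u).
Proof.
apply: emeasurable_funM; first by apply: measurable_expeR; exact: measurable_eval.
apply: emeasurable_funM.
  by apply/measurable_EFinP; apply: measurable_indic; exact: measurable_peak.
by apply: measurable_inve; [exact: lsum_ge0|exact: measurable_lsum].
Qed.

Let mpT : measurable_fun setT (fun w => Theta^~ w : path).
Proof. exact/measurable_path. Qed.

(** Exchanging the roles of the origin and of [s]: both sides are the mean of
    [exp (Z origin) exp (Z s) / D] on the event that [Z] peaks at the origin. *)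
Lemma peak_exchange s : L s ->
  \int[PW]_w G s origin (Theta^~ w) = \int[PW]_w G (topp s) (topp s) (Theta^~ w).
Proof.
move=> Ls; rewrite (transfer origin (mG _ _) (G0 _ _)) (transfer s (mG _ _) (G0 _ _)).
apply: eq_integral => w _; rewrite /G.
rewrite (tilted_peak_ratio delta0 Zoo); last exact: lattice_origin.
rewrite (tilted_peak_ratio delta0 Zoo _ _ _ Ls).
have oE (t : m.-tuple R) : tshift origin t = t by rewrite tshiftC tshift_origin.
have sE : tshift s (topp s) = origin.
  by apply: eq_from_tnth => j; rewrite !tE addNr.
by rewrite !oE sE !(muleCA (expeR (Z s w))) muleCA.
Qed.

Hypothesis Theta_ac : abs_continuous_fdd PW Theta.

Lemma theta_neq0 s : s != origin -> {ae PW, forall w, Theta s w != 0}.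
Proof.
move=> s0; pose B : set (1.-tuple (\bar R)) := [set x | tnth x ord0 = 0].
have mB : measurable B.
  rewrite (_ : B = (@tnth 1 (\bar R) ^~ ord0) @^-1` [set 0])//.
  by rewrite -[X in measurable X]setTI; exact: measurable_tnth.
have mN : measurable [set w | Theta s w = 0].
  by rewrite (_ : mkset _ = Theta s @^-1` [set 0])// -[X in measurable X]setTI; exact: mTheta.
exists [set w | Theta s w = 0]; split => //; last by move=> w /= /negP; rewrite negbK => /eqP.
have := Theta_ac (t := [tuple s]) _ _ mB; rewrite /= inE eq_sym s0 => /(_ isT isT).
rewrite (_ : mkset _ = [set x : 1.-tuple R | tnth x ord0 = 0%R]); last first.
  by apply/seteqP; split => x; rewrite /B/= tnth_mktuple; [case|move=> ->].
move=> /(_ lebesgue_tuple_hyperplane0); rewrite (_ : mkset _ = [set w | Theta s w = 0])//.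
by apply/seteqP; split => w; rewrite /B/= tnth_mktuple (tnth_nth s).
Qed.

Lemma theta_neq s t : s != origin -> t != origin -> s != t ->
  {ae PW, forall w, Theta s w != Theta t w}.
Proof.
move=> s0 t0 st; pose B : set (2.-tuple (\bar R)) := [set x | tnth x ord0 = tnth x (lift ord0 ord0)].
have mB : measurable B.
  by rewrite -[B]setTI; apply: measurable_eqe => //; exact: measurable_tnth.
have mN : measurable [set w | Theta s w = Theta t w].
  by rewrite -[X in measurable X]setTI; apply: measurable_eqe => //; exact: mTheta.
exists [set w | Theta s w = Theta t w]; split => //; last by move=> w /= /negP; rewrite negbK => /eqP.
have := Theta_ac (t := [tuple s; t]) _ _ mB; rewrite /= !inE negb_or ![origin == _]eq_sym s0 t0 st.
move=> /(_ isT isT).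
rewrite (_ : mkset _ = [set x : 2.-tuple R | tnth x ord0 = tnth x (lift ord0 ord0)]); last first.
  by apply/seteqP; split => x; rewrite /B/= !tnth_mktuple; [case|move=> ->].
move=> /(_ lebesgue_tuple_diagonal); rewrite (_ : mkset _ = [set w | Theta s w = Theta t w])//.
by apply/seteqP; split => w; rewrite /B/= !tnth_mktuple !(tnth_nth s).
Qed.

Lemma peak_unique : {ae PW, forall w s t, L s -> L t ->
  peak s (Theta^~ w) -> peak t (Theta^~ w) -> s = t}.
Proof.
have [e eL] : exists e : nat -> m.-tuple R, range e = L.
  by apply: countable_enumeration; [exists origin; exact: lattice_origin|exact: countable_lattice].
have : {ae PW, forall w, forall i, forall j, e i != e j -> Theta (e i) w != Theta (e j) w}.
  apply: ae_foralln => i; apply: ae_foralln => j.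
  have [->|ij] := eqVneq (e i) (e j); first by apply: aeW.
  have [i0|i0] := eqVneq (e i) origin.
    have [j0|j0] := eqVneq (e j) origin; first by rewrite i0 j0 eqxx in ij.
    by apply: filterS2 Theta_origin (theta_neq0 j0) => w w0 wj _; rewrite i0 w0 eq_sym.
  have [j0|j0] := eqVneq (e j) origin.
    by apply: filterS2 Theta_origin (theta_neq0 i0) => w w0 wi _; rewrite j0 w0.
  by apply: filterS (theta_neq i0 j0 ij) => w wij _.
apply: filterS => w ww s t Ls Lt ps pt.
move: (Ls) (Lt); rewrite -eL => -[i _ iE] [j _ jE]; apply/eqP/negPn/negP => st.
have := ww i j; rewrite iE jE => /(_ st) /negP; apply.
by rewrite eq_le (ps _ Lt) (pt _ Ls).
Qed.

(** By the exchange, the probability of a peak at the origin is the mean of the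
    number of peaks, each weighted by [exp Theta / D] at the peak. *)
Lemma peak_probability :
  PW [set w | ereal_sup [set Theta t w | t in L] = 0] = sup_share delta PW Theta L.
Proof.
have Lo : L origin by exact: lattice_origin.
have mS : measurable [set w | ereal_sup [set Theta t w | t in L] = 0].
  rewrite (_ : mkset _ = (fun w => ereal_sup [set Theta t w | t in L]) @^-1` [set 0])//.
  rewrite -[X in measurable X]setTI; apply: measurable_ereal_sup_countable => //.
  - exact: countable_lattice.
have -> : PW [set w | ereal_sup [set Theta t w | t in L] = 0] =
    \int[PW]_w (\1_[set w | ereal_sup [set Theta t w | t in L] = 0] w)%:E.
  by rewrite integral_indic// setIT.
transitivity (\int[PW]_w \int[mu]_s G s origin (Theta^~ w)).
  apply: ge0_ae_eq_integralT => [w|w|]; first by rewrite lee_fin.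
    by apply: integral_ge0 => s _; exact: G0.
  apply: filterS2 D_finite Theta_origin => w Doo T0.
  rewrite (lattice_integralZr delta0); last 2 first.
  - by move=> s; exact: expeR_ge0.
  - by rewrite mule_ge0 ?inve_ge0 ?lsum_ge0// lee_fin.
  have -> : \int[mu]_s expeR (Theta s w) = lsum setT (Theta^~ w).
    by apply: eq_integral => s _; rewrite indicT mul1e.
  have D0 : 0 < lsum setT (Theta^~ w) by have := lsum_gt0 (f := Theta^~ w) Lo; rewrite T0; exact.
  rewrite muleCA ratio_self// mule1 !indicE; congr ((nat_of_bool _)%:R%:E).
  apply/idP/idP; rewrite !inE /peak/=.
    by move=> s0 t Lt; rewrite T0 -s0; apply: ereal_sup_ubound; exists t.
  move=> pk; apply/eqP; rewrite eq_le; apply/andP; split.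
    by apply: ge_ereal_sup => _ [t Lt <-]; rewrite -T0; exact: pk.
  by rewrite -T0; apply: ereal_sup_ubound; exists origin.
rewrite (lattice_fubini delta0); last 2 first.
- by move=> s Ls; exact: (measurableT_comp (mG _ _) mpT).
- by move=> s w; exact: G0.
pose H s := \int[PW]_w G s s (Theta^~ w).
have H0 s : 0 <= H s by apply: integral_ge0 => w _; exact: G0.
rewrite (integral_lattice_eq (g := fun s => H (topp s))); last 3 first.
- by move=> s; apply: integral_ge0 => w _; exact: G0.
- by move=> s; exact: H0.
- by move=> s /set_mem Ls; exact: peak_exchange.
rewrite (ge0_integral_lattice_topp delta0 H0) -(lattice_fubini delta0); last 2 first.
- by move=> s Ls; exact: (measurableT_comp (mG _ _) mpT).
- by move=> s w; exact: G0.
apply: ge0_ae_eq_integralT => [w|w|].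
- by apply: integral_ge0 => s _; exact: G0.
- by rewrite mule_ge0 ?inve_ge0 ?lsum_ge0 ?psup_ge0//; exists origin.
apply: filterS3 D_finite Theta_origin peak_unique => w Doo T0 pu.
have [s Ls ps] := peak_exists delta0 T0 Doo.
apply: (lsum_unique_peak Ls ps); last by rewrite inve_ge0 lsum_ge0.
by move=> t Lt pt; exact: pu.
Qed.

End peak_probability.

(** * Cadlag functions of several variables *)

Section cadlag_functions.
Context {R : realType} {m : nat}.
Implicit Types (t s h : m.-tuple R) (f : m.-tuple R -> \bar R).

Lemma cadlag_orthant f t (up : 'I_m -> bool) : cadlag f -> exists l : \bar R,
  [/\ l != +oo, (forall j, up j) -> l = f t &
  forall A, nbhs l A -> exists2 e : R, (0 < e)%R & forall s, orthant t up s ->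
    (forall j, `|tnth s j - tnth t j| < e)%R -> A (f s)].
Proof.
move=> /(_ t up)[l [loo fl lt]]; exists l; split => // A /fl[e /= e0 eA].
by exists e => // s ts se; apply: (eA s); split.
Qed.

Lemma cadlag_right f t A : cadlag f -> nbhs (f t) A -> exists2 e : R, (0 < e)%R &
  forall s, (forall j, tnth t j <= tnth s j < tnth t j + e)%R -> A (f s).
Proof.
move=> cf fA; have [l [_ lE lA]] := cadlag_orthant t xpredT cf.
rewrite -lE// in fA; have [e e0 eA] := lA _ fA; exists e => // s ts; apply: eA => j.
  by have /andP[] := ts j.
have /andP[ts1 ts2] := ts j.
by rewrite ger0_norm ?subr_ge0// ltrBlDl.
Qed.

Lemma cadlag_lty f t : cadlag f -> f t < +oo.
Proof.
move=> cf; have [l [loo lE _]] := cadlag_orthant t xpredT cf.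
by rewrite -lE// ltey.
Qed.

Lemma cadlag_locally_bounded f t : cadlag f -> exists2 n : nat, (0 < n)%N &
  forall s, (forall j, `|tnth s j - tnth t j| < n%:R^-1)%R -> f s <= n%:R%:E%R.
Proof.
move=> cf.
pose Q n (up : {ffun 'I_m -> bool}) := forall s, orthant t up s ->
  (forall j, `|tnth s j - tnth t j| < n%:R^-1)%R -> f s <= n%:R%:E%R.
have [n n0 fn] : exists2 n, (0 < n)%N & forall up, Q n up.
  suff : \forall n \near \oo, (0 < n)%N /\ forall up, Q n up.
    by move=> [n _ /(_ n (leqnn n))[n0 Qn]]; exists n.
  near=> n; split; first by near: n; exact: nbhs_infty_gt.
  near: n; apply: filter_forall => up.
  have [l [loo _ lA]] := cadlag_orthant t up cf.
  have [M lM] : exists M : R, l < M%:E.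
    case: l loo {lA} => [r| |]// _; last by exists 0%R; rewrite ltNyr.
    by exists (r + 1)%R; rewrite lte_fin ltrDl.
  have [e e0 eM] := lA _ (open_ereal_lt' lM).
  near=> n => s ts sn; apply: (@le_trans _ _ M%:E).
    apply/ltW/eM => // j; apply: lt_le_trans (sn j) _.
    rewrite invf_ple ?posrE//; last by rewrite ltr0n; near: n; exact: nbhs_infty_gt.
    by near: n; exact: nbhs_infty_ger.
  by rewrite lee_fin; near: n; exact: nbhs_infty_ger.
exists n => // s sn; apply: (fn [ffun j => (tnth t j <= tnth s j)%R]) => // j.
by rewrite ffunE; case: leP.
Unshelve. all: by end_near. Qed.

(** A cadlag function is bounded above near every point, because it has limits
    in each of the finitely many orthants, and the cube is compact. *)
Lemma cadlag_bounded f (T : R) : cadlag f ->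
  exists n : nat, forall t, cube T t -> f t <= n%:R%:E%R.
Proof.
move=> cf; pose K : set 'rV[R]_m := [set v | forall j, `[0%R, T]%classic (v ord0 j)].
have cK : compact K := @rV_compact R m (fun=> `[0%R, T]%classic) (fun=> @segment_compact R 0%R T).
pose tup (v : 'rV[R]_m) := [tuple v ord0 j | j < m].
have : \forall n \near \oo, K `<=` (fun v => f (tup v) <= n%:R%:E%R).
  move/compact_near_coveringP : cK; apply => v _.
  have [n n0 fn] := cadlag_locally_bounded (tup v) cf.
  exists (ball v n%:R^-1%R, [set k | (n <= k)%N]); first split.
  - by apply: nbhsx_ballx; rewrite invr_gt0 ltr0n.
  - by exists n.
  move=> [u k] [uv nk] /=; apply: (@le_trans _ _ n%:R%:E%R); last first.
    by rewrite lee_fin ler_nat.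
  by apply: fn => j; rewrite !tnth_mktuple distrC; exact: (proj2 uv).
move=> [n _ /(_ n (leqnn n)) fn]; exists n => t tT.
have := fn (\row_j tnth t j)%R; rewrite /K/tup/=.
have -> : [tuple (\row_j0 tnth t j0)%R ord0 j | j < m] = t.
  by apply: eq_from_tnth => j; rewrite tnth_mktuple mxE.
by apply => j; rewrite mxE /= in_itv /=; exact: tT.
Qed.

(** Right-continuity recovers the values of a cadlag function on [A] from those
    on [D], up to arbitrarily small errors. *)
Definition right_dense (D A : set (m.-tuple R)) :=
  D `<=` A /\ forall t (e : R), A t -> (0 < e)%R ->
  exists2 s, D s & (forall j, tnth t j <= tnth s j < tnth t j + e)%R.

Lemma psup_right_dense D A (f : path_space R (m.-tuple R)) : cadlag f -> right_dense D A ->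
  psup A f = psup D f.
Proof.
move=> cf [DA AD]; apply/eqP; rewrite eq_le (le_psup _ DA) andbT.
apply: ge_ereal_sup => _ [t At <-]; rewrite leNgt; apply/negP => Dt.
have [s0 Ds0 _] := AD t 1%R At ltr01.
have D0 : 0 <= psup D f by apply: psup_ge0; exists s0.
have DK : expeR (lne (psup D f)) = psup D f by rewrite lneK// in_itv/= D0 leey.
have : lne (psup D f) < f t by rewrite -lte_expeR DK.
move=> /open_ereal_gt' /(cadlag_right cf)[e e0 es].
have [s Ds ts] := AD t e At e0; have := es s ts.
rewrite -lte_expeR DK; apply/negP; rewrite -leNgt.
by apply: ereal_sup_ubound; exists s.
Qed.

Lemma right_dense_tshift h D A : right_dense D A -> right_dense (tshift h @` D) (tshift h @` A).
Proof.
move=> [DA AD]; split; first exact: image_subset.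
move=> _ e [t At <-] e0; have [s Ds ts] := AD t e At e0.
exists (tshift h s); first by exists s.
by move=> j; rewrite !tE addrAC !lerD2r ltrD2r.
Qed.

Definition rational_points : set (m.-tuple R) := [set t | forall j, range (@ratr R) (tnth t j)].

Lemma countable_rational_points : countable rational_points.
Proof. by apply: countable_tuple_forall; exact: (sub_countable (card_image_le _ _)). Qed.

Let rational_right (x e : R) : (0 < e)%R -> exists2 q : rat, (x <= ratr q)%R & (ratr q < x + e)%R.
Proof.
move=> e0; have /rat_in_itvoo[q] : (x < x + e)%R by rewrite ltrDl.
by rewrite in_itv/= => /andP[xq qx]; exists q => //; exact: ltW.
Qed.

Lemma rational_points_dense : right_dense rational_points setT.
Proof.
split => // t e _ e0.
have /choice[q qe] j : exists q : rat, (tnth t j <= ratr q < tnth t j + e)%R.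
  by have [q q1 q2] := rational_right (tnth t j) e0; exists q; rewrite q1.
exists [tuple ratr (q j) | j < m] => j; rewrite tnth_mktuple//.
Qed.

(** The rationals are completed by the side [T], as a point with a coordinate equal
    to [T] cannot be approached within the cube from larger values of it. *)
Definition cube_skeleton (T : R) : set (m.-tuple R) :=
  cube T `&` [set t | forall j, range (oapp (@ratr R) T) (tnth t j)].

Lemma countable_cube_skeleton T : countable (cube_skeleton T).
Proof.
apply: (@sub_countable _ _ _ [set t : m.-tuple R | forall j, range (oapp (@ratr R) T) (tnth t j)]).
  by apply: subset_card_le => t [].
by apply: countable_tuple_forall; exact: (sub_countable (card_image_le _ _)).
Qed.

Lemma cube_skeleton_dense T : right_dense (cube_skeleton T) (cube T).
Proof.
split; first by move=> t [].
move=> t e tT e0.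
have /choice[q qe] j : exists q : R, [/\ (tnth t j <= q < tnth t j + e)%R, (0 <= q <= T)%R
    & range (oapp (@ratr R) T) q].
  have /andP[t0] := tT j; rewrite le_eqVlt => /predU1P[tE|ltT].
    exists T; have T0 : (0 <= T)%R by rewrite -tE.
    by rewrite tE ltrDl e0 !lexx T0; split => //; exists None.
  have me0 : (0 < Num.min e (T - tnth t j))%R by rewrite lt_min e0 subr_gt0.
  have [x x1 x2] := rational_right (tnth t j) me0.
  exists (ratr x); split; last by exists (Some x).
  - by rewrite x1/= (lt_le_trans x2)// lerD2l ge_min lexx.
  - rewrite (le_trans t0 x1)/= ltW// (lt_le_trans x2)// -lerBrDl ge_min lexx orbT//.
exists [tuple q j | j < m].
  by split => j; rewrite tnth_mktuple; have [] := qe j.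
by move=> j; rewrite tnth_mktuple; have [] := qe j.
Qed.

End cadlag_functions.

(** * The integral of a cadlag path *)

Section path_integral.
Context {R : realType} {m : nat}.
Local Notation path := (path_space R (m.-tuple R)).
Local Notation leb := (@lebesgue_tuple R m).
Implicit Types (t s h : m.-tuple R) (f : path).

(** The first point of the grid of step [1 / n.+1] whose coordinates are all
    larger than those of [t]. *)
Definition round_up n t : m.-tuple R :=
  [tuple (n.+1%:R^-1 * (Num.floor (n.+1%:R * tnth t j) + 1)%:~R)%R | j < m].

Let n1 n : (0 < n.+1%:R :> R)%R. Proof. by rewrite ltr0n. Qed.

Lemma round_upP n t j :
  (tnth t j < tnth (round_up n t) j <= tnth t j + n.+1%:R^-1)%R.
Proof.
rewrite tnth_mktuple; set x := (n.+1%:R * tnth t j)%R.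
have /andP[fx xf] := floor_itv x.
rewrite !(mulrC n.+1%:R^-1%R) ltr_pdivlMr// ler_pdivrMr// mulrDl mulVf ?gt_eqF//.
by rewrite ![(tnth t j * _)%R]mulrC xf intrD lerD2r.
Qed.

Lemma lattice_round_up n t : lattice n.+1%:R^-1 (round_up n t).
Proof.
apply/latticeP; first by rewrite invr_gt0.
by move=> j; exists (Num.floor (n.+1%:R * tnth t j) + 1)%R; rewrite tnth_mktuple.
Qed.

Lemma round_up_fiber n s : lattice n.+1%:R^-1 s ->
  round_up n @^-1` [set s] =
  [set t | forall j, `[(tnth s j - n.+1%:R^-1)%R, tnth s j[%classic (tnth t j)].
Proof.
move=> Ls; apply/seteqP; split => t /=.
  move=> <- j; have /andP[t1 t2] := round_upP n t j.
  by rewrite in_itv/= t1 lerBlDr t2.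
have /latticeP : (0 < n.+1%:R^-1 :> R)%R by rewrite invr_gt0.
move=> /(_ m s) [/(_ Ls) Lsj _] st; apply: eq_from_tnth => j; rewrite tnth_mktuple.
have [z sE] := Lsj j; have := st j; rewrite sE in_itv/= => /andP[t1 t2].
rewrite (@floor_def _ _ (z - 1)) ?subrK//; apply/andP; split.
  rewrite -(ler_pM2l (_ : 0 < n.+1%:R^-1)%R) ?invr_gt0// mulrA mulVf ?gt_eqF// mul1r.
  by rewrite intrB mulrBr mulr1.
by rewrite -(ltr_pM2l (_ : 0 < n.+1%:R^-1)%R) ?invr_gt0// mulrA mulVf ?gt_eqF// mul1r.
Qed.

Lemma measurable_round_up_eval n :
  measurable_fun setT (fun tf : m.-tuple R * path => tf.2 (round_up n tf.1)).
Proof.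
have i0 : (0 < n.+1%:R^-1 :> R)%R by rewrite invr_gt0.
move=> _ B mB; rewrite setTI.
rewrite (_ : _ @^-1` B = \bigcup_(s in lattice n.+1%:R^-1)
   ((round_up n @^-1` [set s]) `*` [set f : path | B (f s)])); last first.
  apply/seteqP; split => [[t f] /= Bf|[t f] [s _ [/= <-]]//].
  by exists (round_up n t) => //; exact: lattice_round_up.
apply: countable_bigcup_measurable; first exact: countable_lattice.
move=> s Ls; apply: measurableX.
  by rewrite round_up_fiber//; apply: (@measurable_tuple_forall R m
    (fun j => `[(tnth s j - n.+1%:R^-1)%R, tnth s j[%classic)).
by rewrite -[X in measurable X]setTI; exact: measurable_eval.
Qed.

(** The Lebesgue integral of [exp f], written so that only countably many
    values of a right-continuous [f] are used: the integral itself need not be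
    measurable with respect to the evaluation maps. *)
Definition path_integral f : \bar R :=
  \int[leb]_t expeR (limn_esup (fun n => f (round_up n t))).

Lemma path_integral_ge0 f : 0 <= path_integral f.
Proof. by apply: integral_ge0 => t _; exact: expeR_ge0. Qed.

Lemma measurable_path_integral : measurable_fun setT path_integral.
Proof.
have mg : measurable_fun setT (fun tf : m.-tuple R * path =>
    expeR (limn_esup (fun n => tf.2 (round_up n tf.1)))).
  by apply: measurable_expeR; apply: measurable_fun_limn_esup => n; exact: measurable_round_up_eval.
apply: (@measurable_fun_fubini_tonelli_G _ _ _ _ _ leb _ mg) => tf; exact: expeR_ge0.
Qed.

Lemma cadlag_round_up (f : m.-tuple R -> \bar R) h t : cadlag f ->
  f (tshift h (round_up n t)) @[n --> \oo] --> f (tshift h t).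
Proof.
move=> cf A fA; have [e e0 eA] := cadlag_right cf fA.
have [N _ Ne] := near_infty_natSinv_lt (PosNum e0).
exists N => // n Nn; apply: eA => j; have /andP[t1 t2] := round_upP n t j.
rewrite !tE lerD2r (ltW t1)/= addrAC ltrD2r (le_lt_trans t2)// ltrD2l.
exact: Ne.
Qed.

Lemma path_integral_cadlag f : cadlag f -> path_integral f = \int[leb]_t expeR (f t).
Proof.
move=> cf; apply: eq_integral => t _; congr expeR.
have oE (u : m.-tuple R) : tshift origin u = u by rewrite tshiftC tshift_origin.
have := cadlag_round_up cf (h := origin) (t := t); under eq_fun do rewrite oE.
by rewrite oE => /cvg_limn_einf_sup[].
Qed.

Lemma path_integral_increment dO (Omega : measurableType dO) (Z : m.-tuple R -> Omega -> \bar R) h w :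
  cadlag (Z^~ w) -> measurable_fun setT (fun t => Z t w) -> Z h w != -oo ->
  path_integral (increment Z h w) =
  (\int[leb]_t expeR (Z t w)) * (expeR (Z h w))^-1.
Proof.
move=> cZ mZ Zh.
have Zfin : Z h w \is a fin_num by rewrite fin_numE Zh lt_eqF// (cadlag_lty h cZ).
rewrite -ge0_integralZr//; last 3 first.
- exact: measurable_expeR.
- by move=> t _; exact: expeR_ge0.
- by rewrite inve_ge0 expeR_ge0.
rewrite -(ge0_integral_lebesgue_tuple_tshift h); last 2 first.
- apply: emeasurable_funM; first exact: measurable_expeR.
  exact: measurable_cst.
- by move=> t; rewrite mule_ge0 ?inve_ge0 ?expeR_ge0.
apply: eq_integral => t _; rewrite -expeRB//; congr expeR.
have ZC : Z h w @[_ --> \oo] --> Z h w by exact: cvg_cst.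
have := cvgeB _ (cadlag_round_up cZ (h := h) (t := t)) ZC.
rewrite fin_num_adde_defl ?fin_numN// => /(_ _ isT) /cvg_limn_einf_sup[_].
exact.
Qed.

(** By right-continuity, [f] exceeds a real number on a box of positive volume. *)
Lemma integral_cadlag_gt0 (f : m.-tuple R -> \bar R) h : cadlag f ->
  measurable_fun setT f -> f h != -oo -> 0 < \int[leb]_t expeR (f t).
Proof.
move=> cf mf fh.
have [c cfh] : exists c : R, c%:E < f h.
  case: (f h) (cadlag_lty h cf) fh => // r _ _.
  by exists (r - 1)%R; rewrite lte_fin ltrBlDr ltrDl.
have [e e0 ce] := cadlag_right cf (open_ereal_gt' cfh).
rewrite -(ge0_integral_lebesgue_tuple_tshift h); last 2 first.
- exact: measurable_expeR.
- by move=> t; exact: expeR_ge0.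
apply: (@lt_le_trans _ _ (\int[leb]_t ((\1_(cell e) t)%:E * expeR c%:E))).
  rewrite ge0_integralZr ?expeR_ge0//; last first.
    by apply/measurable_EFinP; apply: measurable_indic; exact: measurable_cell.
  rewrite integral_indic ?setIT//; last exact: measurable_cell.
  have cellE : leb (cell e) = (e ^+ m)%:E by exact: lebesgue_cell.
  have : 0 < leb (cell e) by rewrite cellE lte_fin exprn_gt0.
  by move=> l0; apply: mule_gt0; [exact: l0|rewrite lte_fin expR_gt0].
apply: ge0_ae_le_integral.
- by move=> t; rewrite mule_ge0 ?expeR_ge0// lee_fin.
- by move=> t; exact: expeR_ge0.
apply: aeW => t; rewrite indicE; have [/set_mem te|_] := boolP (t \in cell e); last first.
  by rewrite mul0e expeR_ge0.
rewrite mul1e lee_expeR; apply/ltW/ce => j; have /andP[t1 t2] := te j.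
by rewrite tE lerDr t1 addrC ltrD2l.
Qed.

End path_integral.

(** * Suprema over countable sets *)

Section countable_suprema.
Context {R : realType} {m : nat}.
Local Notation path := (path_space R (m.-tuple R)).
Context d (Omega : measurableType d) (P : probability Omega R).
Variable Z : m.-tuple R -> Omega -> \bar R.
Hypothesis mZ : measurable_process Z.
Hypothesis Zoo : forall t w, Z t w < +oo.
Context d' (Omega' : measurableType d') (P' : probability Omega' R).
Variables (p : nat -> Omega' -> R) (Zi : nat -> m.-tuple R -> Omega' -> \bar R).
Hypothesis ingr : max_stable_ingredients P Z P' p Zi.

Let finite_max (c : R) (e : nat -> m.-tuple R) n w :=
  \big[maxe/0]_(i < n) (c%:E * expeR (Z (e i) w)).

Let finite_max_ge0 c e n w : 0 <= finite_max c e n w.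
Proof. exact: bigmaxe_ge0. Qed.

Let measurable_finite_max c e n : measurable_fun setT (finite_max c e n).
Proof.
by apply: measurable_bigmaxe => i; apply: emeasurable_funM => //; exact: measurable_expeR.
Qed.

Let finite_max_cvg (c : R) (e : nat -> m.-tuple R) : (0 < c)%R ->
  \int[P]_w finite_max c e n w @[n --> \oo] --> c%:E * \int[P]_w psup (range e) (Z^~ w).
Proof.
move=> c0; have mps : measurable_fun setT (fun w => psup (range e) (Z^~ w)).
  apply: (measurableT_comp (measurable_psup _) (proj1 (measurable_path Z) mZ)).
  exact: (sub_countable (card_image_le _ _)).
have e0 : range e !=set0 by exists (e 0%N); exists 0%N.
rewrite -ge0_integralZl//; last 2 first.
- by move=> w _; exact: psup_ge0.
- by rewrite lee_fin ltW.
have nd w : nondecreasing_seq (finite_max c e ^~ w).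
  move=> k l kl; apply/bigmax_leP; split => [|i _]; first exact: finite_max_ge0.
  exact: (le_bigmax _ _ (widen_ord kl i)).
have lim w : c%:E * psup (range e) (Z^~ w) = limn (finite_max c e ^~ w).
  rewrite (cvg_lim _ (ereal_nondecreasing_cvgn (nd w)))//.
  rewrite /psup -ereal_sup_pZl//; apply/eqP; rewrite eq_le; apply/andP; split.
    apply: ge_ereal_sup => _ [_ [_ [n _ <-] <-] <-].
    apply: (@le_trans _ _ (finite_max c e n.+1 w)); last by apply: ereal_sup_ubound; exists n.+1.
    exact: (le_bigmax _ _ (@ord_max n)).
  apply: ge_ereal_sup => _ [n _ <-]; apply/bigmax_leP; split => [|i _].
    apply: (@le_trans _ _ (c%:E * expeR (Z (e 0%N) w))).
      by rewrite mule_ge0 ?expeR_ge0// lee_fin ltW.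
    by apply: ereal_sup_ubound; exists (expeR (Z (e 0%N) w)) => //; exists (e 0%N) => //; exists 0%N.
  by apply: ereal_sup_ubound; exists (expeR (Z (e i) w)) => //; exists (e i) => //; exists i.
under [X in _ --> X]eq_integral do rewrite lim.
by apply: cvg_monotone_convergence => // w _; exact: nd.
Qed.

(** Suprema over [D] are increasing limits of maxima over finite sets. *)
Lemma mean_psup_shift h (D : set (m.-tuple R)) : stationary P' (max_stable p Zi) ->
  countable D -> D !=set0 ->
  \int[P]_w psup (tshift h @` D) (Z^~ w) = \int[P]_w psup D (Z^~ w).
Proof.
move=> stat cD D0; have [e <-] := countable_enumeration D0 cD.
have := @finite_max_cvg 1%R e ltr01; rewrite mul1e => eE.
have := @finite_max_cvg 1%R (fun n => tshift h (e n)) ltr01; rewrite mul1e.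
rewrite (_ : range (fun n => tshift h (e n)) = tshift h @` range e); last first.
  apply/seteqP; split => [_ [n _ <-]|_ [_ [n _ <-] <-]]; last by exists n.
  by exists (e n); [exists n|].
under eq_fun => n do rewrite /finite_max (max_functional_shift mZ Zoo ingr stat h (fun i : 'I_n => e i) (a := fun=> 1%R) (fun=> ltr01)).
by move/(cvg_lim (@ereal_hausdorff R)) => <-; move/(cvg_lim (@ereal_hausdorff R)) : eE => <-.
Qed.

Lemma measurable_max_stable t : measurable_fun setT (max_stable p Zi t).
Proof.
have [[mp _] mZi _ _] := ingr.
apply: measurable_ereal_sup_countable => // i _.
apply: emeasurable_funD; last exact: mZi.
exact/measurable_EFinP.
Qed.

(** The max-stable process stays below [x] on a countable set [D] with
    probability [exp (- exp (- x) E sup_D exp Z)], which vanishes if the mean is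
    infinite. *)
Lemma mean_psup_finite (D : set (m.-tuple R)) : countable D -> D !=set0 ->
  {ae P', forall w, exists n : nat, forall t, D t -> max_stable p Zi t w <= n%:R%:E} ->
  \int[P]_w psup D (Z^~ w) < +oo.
Proof.
move=> cD D0 bounded; rewrite ltey; apply/eqP => inf.
have [e eD] := countable_enumeration D0 cD.
pose S (N : nat) := \bigcap_i [set w | max_stable p Zi (e i) w <= N%:R%:E].
have mS1 N i : measurable [set w | max_stable p Zi (e i) w <= N%:R%:E].
  by rewrite -[X in measurable X]setTI; apply: measurable_lee => //; exact: measurable_max_stable.
have mS N : measurable (S N) by exact: bigcapT_measurable.
have S0 N : P' (S N) = 0.
  apply/eqP/negPn/negP => SN.
  have SN0 : 0 < P' (S N) by rewrite lt_neqAle eq_sym SN/= measure_ge0.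
  have Sfin : P' (S N) \is a fin_num by exact: fin_num_measure.
  have c0 : (0 < expR (- N%:R) :> R)%R by exact: expR_gt0.
  have le n : \int[P]_w finite_max (expR (- N%:R)) e n w <= - lne (P' (S N)).
    rewrite -leeN2 oppeK -lee_expeR lneK ?in_itv/= ?measure_ge0 ?leey//.
    rewrite -(max_stable_cdf mZ Zoo ingr (fun i : 'I_n => e i) (fun=> N%:R%R)).
    apply: le_measure; rewrite ?inE//.
    - by apply: fin_bigcap_measurable => // i _; exact: mS1.
    - by move=> w Sw i _; exact: Sw.
  have cv := @finite_max_cvg _ e c0; rewrite eD inf gt0_muley ?lte_fin// in cv.
  have : +oo <= - lne (P' (S N)).
    by rewrite -(cvg_lim (@ereal_hausdorff R) cv); apply: lime_le; [apply/cvg_ex; exists +oo|exact: nearW].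
  rewrite leye_eq => /eqP; case: (P' (S N)) SN0 => // r; rewrite lte_fin => r0.
  by rewrite lne_EFin.
have : {ae P', forall w, False}.
  have nS : {ae P', forall w, forall N, ~ S N w}.
    apply: ae_foralln => N; exists (S N); split; [exact: mS|exact: S0|by move=> w /= /contrapT].
  apply: filterS2 bounded nS => w [N wN] /(_ N); apply => i _; apply: wN.
  by rewrite -eD; exists i.
move=> [N [mN N0 sub]].
have NT : N = setT by apply/seteqP; split => // w _; exact: sub.
by move: N0; rewrite NT probability_setT => /eqP; rewrite eqe oner_eq0.
Qed.

End countable_suprema.

(** * The lower bound in continuous time *)

Section continuous_pickands_lower_bound.
Context {R : realType} {m : nat}.
Local Notation path := (path_space R (m.-tuple R)).
Local Notation leb := (@lebesgue_tuple R m).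
Context dO (Omega : measurableType dO) (P : probability Omega R).
Variable Z : m.-tuple R -> Omega -> \bar R.
Hypothesis mZ : measurable_fun setT
  (fun tw : (m.-tuple R * Omega)%type => Z tw.1 tw.2).
Hypothesis Zoo : forall t w, Z t w < +oo.
Hypothesis Z_integrable :
  {ae P, forall w, \int[leb]_t expeR (Z t w) < +oo}.
Context dW (OmegaW : measurableType dW) (PW : probability OmegaW R).
Variable Theta : m.-tuple R -> OmegaW -> \bar R.
Hypothesis mTheta : measurable_process Theta.
Hypothesis transfer : forall h (F : path -> \bar R),
  measurable_fun setT F -> (forall f, 0 <= F f) ->
  \int[PW]_w F (Theta^~ w) = \int[P]_w (expeR (Z h w) * F (increment Z h w)).
Hypothesis Theta_origin : {ae PW, forall w, Theta origin w = 0}.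
Hypothesis Z_cadlag : cadlag_paths P Z.

Let I w := \int[leb]_t expeR (Z t w).

Let my : measurable_fun setT (fun tw : m.-tuple R * Omega => expeR (Z tw.1 tw.2)).
Proof. exact: measurable_expeR. Qed.

Let mI : measurable_fun setT I.
Proof.
exact: (@measurable_fun_fubini_tonelli_G _ _ _ _ _ leb _ my (fun tw => expeR_ge0 _)).
Qed.

Let I_ge0 w : 0 <= I w. Proof. by apply: integral_ge0 => t _; exact: expeR_ge0. Qed.

Let minvI : measurable_fun setT (fun w => (I w)^-1).
Proof. exact: measurable_inve. Qed.

Let invI_ge0 w : 0 <= (I w)^-1. Proof. by rewrite inve_ge0. Qed.

Let mpZ : measurable_fun setT (fun w => Z^~ w : path).
Proof.
by apply/measurable_path => t; exact: (measurableT_comp mZ (pair1_measurable t)).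
Qed.

Let mpT : measurable_fun setT (fun w => Theta^~ w : path).
Proof. exact/measurable_path. Qed.

Let mZw w : measurable_fun setT (fun t => Z t w).
Proof. exact: (measurableT_comp mZ (pair2_measurable w)). Qed.

Let minvJ : measurable_fun setT (fun f : path => (path_integral f)^-1).
Proof. by apply: measurable_inve; [exact: path_integral_ge0|exact: measurable_path_integral]. Qed.

Let invJ_ge0 (f : path) : 0 <= (path_integral f)^-1.
Proof. by rewrite inve_ge0 path_integral_ge0. Qed.

(** The analogue of [sup_share] for the points of the space. *)
Definition path_share A : \bar R :=
  \int[PW]_w (psup A (Theta^~ w) / path_integral (Theta^~ w)).

Lemma path_share_ge0 A : A !=set0 -> 0 <= path_share A.
Proof. by move=> A0; apply: integral_ge0 => w _; rewrite mule_ge0 ?psup_ge0. Qed.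

Lemma path_shareE A s : countable A -> A !=set0 ->
  path_share A = \int[P]_w (expeR (Z s w) * (psup (tshift s @` A) (Z^~ w) / I w)).
Proof.
move=> cA A0; rewrite /path_share.
rewrite (transfer s (F := fun f => psup A f / path_integral f)); last 2 first.
- by apply: emeasurable_funM => //; exact: measurable_psup.
- by move=> f; rewrite mule_ge0 ?psup_ge0.
apply: ge0_ae_eq_integralT.
- by move=> w; rewrite !mule_ge0 ?expeR_ge0 ?psup_ge0.
- move=> w; rewrite !mule_ge0 ?expeR_ge0 ?psup_ge0//.
  by have [t At] := A0; exists (tshift s t); exists t.
apply: filterS Z_cadlag => w cZ.
have [Zs|Zs] := eqVneq (Z s w) -oo; first by rewrite Zs !mul0e.
rewrite (psup_increment Zoo)// (path_integral_increment cZ (mZw w) Zs).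
have I0 := integral_cadlag_gt0 cZ (mZw w) Zs.
congr (_ * _); have := cadlag_lty s cZ; case: (Z s w) Zs => // z _ _.
by apply: ratio_cancel => //; exact: expR_gt0.
Qed.

(** The tilt by [exp (Z origin)] only keeps the paths of [Z] that are finite at
    the origin, and the integral of [exp Z] is then positive. *)
Lemma path_integral_theta : {ae PW, forall w, 0 < path_integral (Theta^~ w) < +oo}.
Proof.
pose S : set path := path_integral @^-1` (~` `]0%E, +oo%E[).
have mS : measurable S.
  rewrite -[S]setTI; apply: measurable_path_integral => //; apply: measurableC.
  exact: emeasurable_itv.
have mSW : measurable [set w | S (Theta^~ w)].
  by rewrite -[X in measurable X]setTI; apply: mpT.
exists [set w | S (Theta^~ w)]; split; [exact: mSW| |by move=> w nS; rewrite /S/= in_itv/=].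
have -> : PW [set w | S (Theta^~ w)] = \int[PW]_w (\1_S (Theta^~ w : path))%:E.
  rewrite integral_indic ?setIT//.
rewrite (@transfer origin (fun f => (\1_S f)%:E)); last 2 first.
- by apply/measurable_EFinP; exact: measurable_indic.
- by move=> f; rewrite lee_fin.
rewrite -(integral0 P setT); apply: ge0_ae_eq_integralT => //.
  by move=> w; rewrite mule_ge0 ?expeR_ge0// lee_fin.
apply: filterS2 Z_cadlag Z_integrable => w cZ Ioo.
have [Zo|Zo] := eqVneq (Z origin w) -oo; first by rewrite Zo mul0e.
rewrite indicE memNset ?mule0// => /= => SZ; apply: SZ.
rewrite /= in_itv/= path_integral_increment//.
have I0 := integral_cadlag_gt0 cZ (mZw w) Zo.
have := cadlag_lty origin cZ; case: (Z origin w) Zo => // z _ _ /=.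
rewrite inver gt_eqF ?expR_gt0//; apply/andP; split.
  by rewrite mule_gt0 ?lte_fin ?invr_gt0 ?expR_gt0.
apply: lte_mul_pinfty; [exact: ltW| |exact: ltry].
by rewrite ge0_fin_numE ?ltW.
Qed.

Lemma path_share_cvg (D : set (m.-tuple R)) : countable D -> D origin ->
  path_share (D `&` growing_box k) @[k --> \oo] --> path_share D.
Proof.
move=> cD Do; have cDk k : countable (D `&` growing_box k).
  by apply: (sub_countable (subset_card_le _) cD) => t [].
have Dk0 k : (D `&` growing_box k) !=set0.
  by exists origin; split => // j; rewrite tE oppr_le0 ler0n.
have D0 : D !=set0 by exists origin.
pose g k w := psup (D `&` growing_box k) (Theta^~ w) / path_integral (Theta^~ w).
have g0 k w : 0 <= g k w by rewrite mule_ge0 ?psup_ge0.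
have gnd w : nondecreasing_seq (g ^~ w).
  move=> k l kl; rewrite lee_wpmul2r//; apply: le_psup => t [Dt kt].
  by split => //; exact: (growing_box_nd kl).
have -> : path_share D = \int[PW]_w limn (g ^~ w).
  apply: ge0_ae_eq_integralT => [w|w|].
  - by rewrite mule_ge0 ?psup_ge0.
  - by apply: lime_ge; [exact: ereal_nondecreasing_is_cvgn|exact: nearW].
  apply: filterS path_integral_theta => w /andP[J0 Joo]; apply/esym/cvg_lim => //.
  apply: cvgeZr.
    have : path_integral (Theta^~ w) \is a fin_num by rewrite ge0_fin_numE// ltW.
    by case: (path_integral _) J0 => // r; rewrite lte_fin => r0; rewrite inver gt_eqF.
  apply: psup_cvg => [k l kl t [Dt kt]|].
    by split => //; exact: (growing_box_nd kl).
  by rewrite -setI_bigcupr bigcup_growing_box setIT.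
apply: cvg_monotone_convergence => // [k|k w _|w _]; [|exact: g0|exact: gnd].
by apply: emeasurable_funM; [exact: (measurableT_comp (measurable_psup (cDk k)) mpT)|exact: (measurableT_comp minvJ mpT)].
Qed.

Lemma path_share_gt0 D : countable D -> D origin -> 0 < path_share D.
Proof.
move=> cD Do; have D0 : D !=set0 by exists origin.
rewrite lt_neqAle path_share_ge0// andbT eq_sym; apply/eqP => s0.
have mD : measurable_fun setT (fun w => psup D (Theta^~ w) / path_integral (Theta^~ w)).
  by apply: emeasurable_funM; [exact: (measurableT_comp (measurable_psup cD) mpT)|exact: (measurableT_comp minvJ mpT)].
have : \int[PW]_w `|psup D (Theta^~ w) / path_integral (Theta^~ w)| = 0.
  by rewrite -s0; apply: eq_integral => w _; rewrite gee0_abs// mule_ge0 ?psup_ge0.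
move/(ae_eq_integral_abs _ measurableT mD) => z.
have : {ae PW, forall w, False}.
  apply: filterS3 z path_integral_theta Theta_origin => w /(_ Logic.I) + /andP[J0 Joo] T0.
  apply/eqP; rewrite mule_eq0 inve_eq0 (lt_eqF Joo) orbF gt_eqF//.
  apply: (@lt_le_trans _ _ 1) => //; rewrite -expeR0 -T0.
  by apply: ereal_sup_ubound; exists origin.
move=> [N [mN N0 sub]].
have NT : N = setT by apply/seteqP; split => // w _; exact: sub.
by move: N0; rewrite NT probability_setT => /eqP; rewrite eqe oner_eq0.
Qed.

(** The supremum over the cube is shared between the points [s] of the space in
    proportion to [exp (Z s)]. *)
Lemma mean_psup_ge_volume A B (T : R) : countable A -> A !=set0 -> (0 <= T)%R ->
  measurable B -> (forall s t, B s -> A t -> cube T (tshift s t)) ->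
  leb B * path_share A <= \int[P]_w psup (cube_skeleton T) (Z^~ w).
Proof.
move=> cA A0 T0 mB BA.
have cC := @countable_cube_skeleton R m T.
have C0 : (@cube_skeleton R m T) !=set0.
  have [] := (proj2 (@cube_skeleton_dense R m T)) origin 1%R _ ltr01.
    by move=> j; rewrite tE lexx.
  by move=> s Cs _; exists s.
have mC : measurable_fun setT (fun w => psup (cube_skeleton T) (Z^~ w)).
  exact: (measurableT_comp (measurable_psup cC) mpZ).
pose X w := psup (cube_skeleton T) (Z^~ w) / I w.
have X0 w : 0 <= X w by rewrite mule_ge0 ?psup_ge0.
have mX : measurable_fun setT X by exact: emeasurable_funM.
have mBZ : measurable_fun setT (fun sw : m.-tuple R * Omega =>
    (\1_B sw.1)%:E * expeR (Z sw.1 sw.2) : \bar R).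
  apply: emeasurable_funM => //; apply/measurable_EFinP.
  by apply: measurableT_comp => //; exact: measurable_indic.
have mf : measurable_fun setT (fun sw : m.-tuple R * Omega =>
    (\1_B sw.1)%:E * expeR (Z sw.1 sw.2) * X sw.2).
  by apply: emeasurable_funM => //; exact: measurableT_comp.
have f0 (sw : m.-tuple R * Omega) : 0 <= (\1_B sw.1)%:E * expeR (Z sw.1 sw.2) * X sw.2.
  by rewrite mule_ge0 ?X0// mule_ge0 ?expeR_ge0// lee_fin.
apply: (@le_trans _ _ (\int[P]_w \int[leb]_s ((\1_B s)%:E * expeR (Z s w) * X w))); last first.
  apply: ge0_ae_le_integral.
  - by move=> w; apply: integral_ge0 => s _; exact: (f0 (s, w)).
  - by move=> w; exact: psup_ge0.
  apply: aeW => w; rewrite ge0_integralZr//; last 2 first.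
  - exact: (measurableT_comp mBZ (pair2_measurable w)).
  - by move=> s _; rewrite mule_ge0 ?expeR_ge0// lee_fin.
  rewrite muleCA -[leRHS]mule1 lee_wpmul2l ?psup_ge0//.
  apply: ratio_le1; first by apply: integral_ge0 => s _; rewrite mule_ge0 ?expeR_ge0// lee_fin.
  apply: ge0_ae_le_integral => [s|s|].
  - by rewrite mule_ge0 ?expeR_ge0// lee_fin.
  - exact: expeR_ge0.
  apply: aeW => s; rewrite indicE; case: (_ \in _); rewrite ?mul1e ?mul0e//.
  exact: expeR_ge0.
rewrite -(fubini_tonelli (m1 := leb) (m2 := P) _ mf)//=.
have -> : leb B * path_share A = \int[leb]_s ((\1_B s)%:E * path_share A).
  rewrite ge0_integralZr ?path_share_ge0//; last first.
    by apply/measurable_EFinP; exact: measurable_indic.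
  by rewrite integral_indic// setIT.
apply: ge0_ae_le_integral.
- by move=> s; rewrite mule_ge0 ?path_share_ge0// lee_fin.
- by move=> s; apply: integral_ge0 => w _; exact: (f0 (s, w)).
apply: aeW => s; have [Bs|nBs] := pselect (B s); last first.
  by rewrite indicE memNset// mul0e; apply: integral_ge0 => w _; rewrite !mul0e.
rewrite !indicE mem_set// mul1e (path_shareE s cA A0).
have sA0 : tshift s @` A !=set0 by have [t At] := A0; exists (tshift s t); exists t.
apply: ge0_ae_le_integral.
- by move=> w; rewrite !mule_ge0 ?expeR_ge0 ?psup_ge0.
- by move=> w; rewrite mule_ge0 ?X0// mule_ge0 ?expeR_ge0// lee_fin.
apply: filterS Z_cadlag => w cZ; rewrite mul1e lee_wpmul2l ?expeR_ge0// lee_wpmul2r//.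
rewrite -(psup_right_dense cZ (@cube_skeleton_dense R m T)); apply: le_psup => _ [t At <-].
exact: BA.
Qed.

End continuous_pickands_lower_bound.

(** * Existence of the continuous limit *)

Section subadditive_limit.
Context {R : realType}.

(** The upper limit of [b] is at most each [b S], hence at most their infimum. *)
Lemma subadditive_cvg (b : R -> R) (d : nat) :
  (forall T, 0 < T -> 0 <= b T)%R ->
  (forall S T, 0 < S -> 0 < T -> b T <= ((T + S) / T) ^+ d * b S)%R ->
  exists l : R, b T @[T --> +oo%R] --> l.
Proof.
move=> b0 sub; pose A := [set b S | S in [set S : R | (0 < S)%R]].
have lA : has_inf A.
  split; first by exists (b 1%R); exists 1%R => /=.
  by exists 0%R => _ [S S0 <-]; exact: b0.
exists (inf A); apply/cvgrPdist_lt => e e0.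
have [_ [S S0 <-] bS] := inf_adherent e0 lA.
have cS : (((T + S) / T) ^+ d * b S)%R @[T --> +oo%R] --> b S.
  rewrite -[X in _ --> X]mul1r; apply: cvgM; last exact: cvg_cst.
  exact: cvg_ratio_expr.
near=> T; have T0 : (0 < T)%R by near: T; exact: nbhs_pinfty_gt.
have lT : (inf A <= b T)%R by apply: ge_inf; [exact: lA.2|exists T].
rewrite distrC ger0_norm ?subr_ge0// ltrBlDl (le_lt_trans (sub S T S0 T0))//.
by near: T; have := cS; move=> /cvgr_lt; exact.
Unshelve. all: by end_near. Qed.

End subadditive_limit.

Section continuous_pickands.
Context {R : realType} {m : nat}.
Local Notation path := (path_space R (m.-tuple R)).
Context dO (Omega : measurableType dO) (P : probability Omega R).
Variable Z : m.-tuple R -> Omega -> \bar R.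
Hypothesis mZ : measurable_process Z.
Hypothesis Zoo : forall t w, Z t w < +oo.
Context d' (Omega' : measurableType d') (P' : probability Omega' R).
Variables (p : nat -> Omega' -> R) (Zi : nat -> m.-tuple R -> Omega' -> \bar R).
Hypothesis ingr : max_stable_ingredients P Z P' p Zi.
Hypothesis stat : stationary P' (max_stable p Zi).
Hypothesis zeta_cadlag : cadlag_paths P' (max_stable p Zi).
Hypothesis Z_cadlag : cadlag_paths P Z.

Let a (T : R) := \int[P]_w psup (cube_skeleton T) (Z^~ w).

Lemma cube_skeleton_nonempty (T : R) : (0 <= T)%R -> (@cube_skeleton R m T) !=set0.
Proof.
move=> T0; have [] := (proj2 (@cube_skeleton_dense R m T)) origin 1%R _ ltr01.
  by move=> j; rewrite tE lexx.
by move=> s Cs _; exists s.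
Qed.

Lemma mean_cube_finite (T : R) : (0 <= T)%R -> a T \is a fin_num.
Proof.
move=> T0; rewrite ge0_fin_numE; last first.
  by apply: integral_ge0 => w _; apply: psup_ge0; exact: cube_skeleton_nonempty.
apply: (mean_psup_finite mZ Zoo ingr).
- exact: countable_cube_skeleton.
- exact: cube_skeleton_nonempty.
apply: filterS zeta_cadlag => w cz; have [n nb] := cadlag_bounded T cz.
by exists n => t [tT _]; exact: nb.
Qed.

Lemma pickands_mean_cube (T : R) : (0 <= T)%R ->
  pickands_mean P Z 0 T = (T ^- m)%:E * a T.
Proof.
move=> T0; rewrite /pickands_mean; congr (_ * _).
apply: ge0_ae_eq_integralT => [w|w|].
- apply: (@psup_ge0 _ _ _ (Z^~ w)); exists origin; split; first by rewrite /lattice eqxx.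
  by move=> j; rewrite tE lexx.
- by apply: psup_ge0; exact: cube_skeleton_nonempty.
apply: filterS Z_cadlag => w cZ.
by rewrite -(psup_right_dense cZ (@cube_skeleton_dense R m T)) /psup /lattice eqxx setTI.
Qed.

(** The cube is covered by [N ^ m] cubes of side [S], for which stationarity gives
    equal means. *)
Lemma cube_subadditive (N : nat) (S T : R) : (0 < S)%R -> (0 <= T)%R ->
  (T < S * N%:R)%R -> a T <= (N%:R ^+ m)%:E * a S.
Proof.
move=> S0 T0 TN.
pose corner (i : {ffun 'I_m -> 'I_N}) : m.-tuple R := [tuple (S * (i j)%:R)%R | j < m].
pose A i := tshift (corner i) @` (@cube_skeleton R m S).
have cA i : countable (A i).
  by apply: (sub_countable (card_image_le _ _)); exact: countable_cube_skeleton.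
have S1 : (@cube_skeleton R m S) !=set0 by apply: cube_skeleton_nonempty; exact: ltW.
have A0 i : A i !=set0 by have [t St] := S1; exists (tshift (corner i) t); exists t.
have mA i : measurable_fun setT (fun w => psup (A i) (Z^~ w)).
  exact: (measurableT_comp (measurable_psup (cA i)) (proj1 (measurable_path Z) mZ)).
apply: (@le_trans _ _ (\int[P]_w \sum_i psup (A i) (Z^~ w))).
  apply: ge0_ae_le_integral => [w|w|].
  - by apply: psup_ge0; exact: cube_skeleton_nonempty.
  - by apply: sume_ge0 => i _; exact: psup_ge0.
  apply: filterS Z_cadlag => w cZ; apply: ge_ereal_sup => _ [t [tT _] <-].
  have tr j : (Num.truncn (tnth t j / S) < N)%N.
    have /andP[t1 t2] := tT j.
    by rewrite truncn_lt_nat ?divr_ge0 ?(ltW S0)// ltr_pdivrMr// mulrC (le_lt_trans t2).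
  pose i : {ffun 'I_m -> 'I_N} := [ffun j => Ordinal (tr j)].
  apply: (@le_trans _ _ (psup (A i) (Z^~ w))); last first.
    by rewrite (bigD1 i)//= leeDl// sume_ge0// => k _; exact: psup_ge0.
  rewrite -(psup_right_dense cZ (right_dense_tshift (corner i) (@cube_skeleton_dense R m S))).
  apply: ereal_sup_ubound; exists t => //; exists (translate (corner i) t); last exact: translateK.
  move=> j; rewrite !tE tnth_mktuple ffunE/=; have /andP[t1 t2] := tT j.
  have /andP[u1 u2] := truncn_itv (divr_ge0 t1 (ltW S0)).
  rewrite subr_ge0 lerBlDr mulrC -ler_pdivlMr// u1/=.
  by rewrite -[X in (_ <= X + _)%R]mul1r -mulrDl -ler_pdivrMr// addrC natr1 ltW.
rewrite ge0_integral_sum//; last by move=> i w _; exact: psup_ge0.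
rewrite (eq_bigr (fun=> a S)); last first.
  move=> i _; apply: (mean_psup_shift mZ Zoo ingr) => //.
  exact: countable_cube_skeleton.
rewrite -(fineK (mean_cube_finite (ltW S0))) sumEFin sumr_const card_ffun !card_ord.
by rewrite -(mulr_natl (fine (a S))) natrX EFinM.
Qed.

Lemma continuous_pickands_cvg : exists l : R, pickands_mean P Z 0 T @[T --> +oo%R] --> l%:E.
Proof.
pose b (T : R) := (T ^- m * fine (a T))%R.
have bE T : (0 <= T)%R -> pickands_mean P Z 0 T = (b T)%:E.
  by move=> T0; rewrite pickands_mean_cube// /b EFinM fineK// mean_cube_finite.
have a0 T : (0 <= T)%R -> (0 <= fine (a T))%R.
  move=> T0; apply: fine_ge0; apply: integral_ge0 => w _; apply: psup_ge0.
  exact: cube_skeleton_nonempty.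
have [l bl] : exists l : R, b T @[T --> +oo%R] --> l.
  apply: (@subadditive_cvg _ b m) => [T T0|S T S0 T0].
    by rewrite mulr_ge0 ?a0 ?invr_ge0 ?exprn_ge0 ?ltW.
  have [N [TN NT]] : exists N : nat, (T < S * N%:R /\ N%:R <= (T + S) / S)%R.
    have TS0 : (0 <= T / S)%R by rewrite divr_ge0 ?ltW.
    have /andP[u1 u2] := truncn_itv TS0; exists (Num.truncn (T / S)).+1; split.
      by rewrite mulrC -ltr_pdivrMr.
    by rewrite mulrDl divff ?gt_eqF// -natr1 lerD2r.
  have := cube_subadditive S0 (ltW T0) TN.
  rewrite -(fineK (mean_cube_finite (ltW T0))) -(fineK (mean_cube_finite (ltW S0))) -EFinM lee_fin => h.
  apply: (@le_trans _ _ (T ^- m * (((T + S) / S) ^+ m * fine (a S)))%R); last first.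
    by rewrite /b !exprMn !exprVn -!mulrA mulrCA.
  rewrite /b ler_wpM2l ?invr_ge0 ?exprn_ge0 ?(ltW T0)// (le_trans h)//.
  rewrite ler_wpM2r ?a0 ?(ltW S0)//; apply: lerXn2r; rewrite ?nnegrE ?ler0n//.
  by rewrite divr_ge0 ?addr_ge0 // ltW.
exists l; apply: (@cvg_trans _ ((b T)%:E @[T --> +oo%R])).
  apply: near_eq_cvg; near=> T.
  have T0 : (0 <= T)%R by near: T; apply: nbhs_pinfty_ge; exact: num_real.
  by rewrite bE.
by apply: cvg_EFin; [exact: nearW|].
Unshelve. all: by end_near. Qed.

End continuous_pickands.

(** * Values of the constants *)

Section pickands_values.
Context {R : realType}.

Lemma inve_pMl (c : R) (D : \bar R) : (0 < c)%R -> 0 <= D ->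
  (c%:E * D)^-1 = (c^-1)%:E * D^-1.
Proof.
move=> c0; case: D => [D| |]// D0; last by rewrite gt0_muley ?lte_fin// invey mule0.
have [->|Dn0] := eqVneq D 0%R; first by rewrite mule0 inve0 gt0_muley// lte_fin invr_gt0.
by rewrite -EFinM !inver mulf_eq0 gt_eqF//= (negbTE Dn0) -EFinM invfM.
Qed.

Lemma probability1_ae d (T : measurableType d) (P : probability T R) (A : set T) :
  measurable A -> P A = 1 -> {ae P, forall w, A w}.
Proof.
move=> mA PA; exists (~` A); split => //; first exact: measurableC.
by rewrite probability_setC// PA subee.
Qed.

Lemma ge0_integral_expZ_measurable m dO (Omega : measurableType dO)
    (Z : m.-tuple R -> Omega -> \bar R) :
  measurable_fun setT (fun tw : (m.-tuple R * Omega)%type => Z tw.1 tw.2) ->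
  measurable [set w | \int[lebesgue_tuple m]_t expeR (Z t w) < +oo].
Proof.
move=> mZ; rewrite (_ : mkset _ = ((fun w => \int[lebesgue_tuple m]_t expeR (Z t w)) @^-1` [set` `]-oo, +oo%E[])).
  rewrite -[X in measurable X]setTI.
  have my := measurable_expeR mZ.
  have := (@measurable_fun_fubini_tonelli_G _ _ _ _ _ (lebesgue_tuple m) _ my (fun tw => expeR_ge0 _)).
  by apply => //; exact: emeasurable_itv.
by apply/seteqP; split => w /=; rewrite in_itv.
Qed.

Context {m : nat}.
Local Notation path := (path_space R (m.-tuple R)).
Context dO (Omega : measurableType dO) (P : probability Omega R).
Variable Z : m.-tuple R -> Omega -> \bar R.
Hypothesis mZ : measurable_fun setT
  (fun tw : (m.-tuple R * Omega)%type => Z tw.1 tw.2).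
Hypothesis Zoo : forall t w, Z t w < +oo.
Hypothesis Z_integrable :
  {ae P, forall w, \int[lebesgue_tuple m]_t expeR (Z t w) < +oo}.
Context dW (OmegaW : measurableType dW) (PW : probability OmegaW R).
Variable Theta : m.-tuple R -> OmegaW -> \bar R.
Hypothesis mTheta : measurable_process Theta.
Hypothesis transfer : forall h (F : path -> \bar R),
  measurable_fun setT F -> (forall f, 0 <= F f) ->
  \int[PW]_w F (Theta^~ w) = \int[P]_w (expeR (Z h w) * F (increment Z h w)).

Let mpT : measurable_fun setT (fun w => Theta^~ w : path).
Proof. exact/measurable_path. Qed.

Lemma sup_share_integral delta : (0 < delta)%R ->
  \int[PW]_w (ereal_sup [set expeR (Theta t w) | t in lattice delta]
             / ((delta ^+ m)%:E * \int[lattice_measure delta]_s expeR (Theta s w))) =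
  ((delta ^+ m)^-1)%:E * sup_share delta PW Theta (lattice delta).
Proof.
move=> delta0; have L0 : (@lattice R m delta) !=set0 by exists origin; exact: lattice_origin.
rewrite -ge0_integralZl//; last 3 first.
- apply: emeasurable_funM.
    exact: (measurableT_comp (measurable_psup (countable_lattice delta0)) mpT).
  apply: measurable_inve => [w|]; first exact: lsum_ge0.
  exact: (measurableT_comp (measurable_lsum delta0 _) mpT).
- by move=> w _; rewrite mule_ge0 ?psup_ge0 ?inve_ge0 ?lsum_ge0.
- by rewrite lee_fin invr_ge0 exprn_ge0 ?ltW.
apply: eq_integral => w _; rewrite inve_pMl ?exprn_gt0//; last first.
  by apply: integral_ge0 => s _; exact: expeR_ge0.
rewrite muleCA; congr (_ * (_ / _)).
by apply: eq_integral => s _; rewrite indicT mul1e.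
Qed.

Hypothesis Z_cadlag : cadlag_paths P Z.
Hypothesis Theta_cadlag : cadlag_paths PW Theta.

Lemma path_share_integral :
  \int[PW]_w (ereal_sup [set expeR (Theta t w) | t in setT]
              / \int[lebesgue_tuple m]_s expeR (Theta s w)) =
  path_share PW Theta (@rational_points R m).
Proof.
have rat0 : (@rational_points R m) origin by move=> j; rewrite tE; exists 0%R => //; rewrite rmorph0.
apply: ge0_ae_eq_integralT => [w|w|].
- rewrite mule_ge0 ?inve_ge0//; last by apply: integral_ge0 => s _; exact: expeR_ge0.
  by apply: (@psup_ge0 _ _ _ (Theta^~ w)); exists origin.
- by rewrite mule_ge0 ?psup_ge0 ?inve_ge0 ?path_integral_ge0//; exists origin.
apply: filterS Theta_cadlag => w cT.
by rewrite -(psup_right_dense cT (@rational_points_dense R m)) path_integral_cadlag.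
Qed.

(** Up to a boundary effect, the cube of side [T] contains the translates by its
    points of any bounded set of rational points. *)
Lemma path_share_le_limit (l : R) :
  (forall T, (0 <= T)%R -> \int[P]_w psup (@cube_skeleton R m T) (Z^~ w) \is a fin_num) ->
  pickands_mean P Z 0 T @[T --> +oo%R] --> l%:E ->
  path_share PW Theta (@rational_points R m) <= l%:E.
Proof.
move=> afin pl.
have crat := @countable_rational_points R m.
have rat0 : (@rational_points R m) origin by move=> j; rewrite tE; exists 0%R => //; rewrite rmorph0.
have sl := path_share_cvg mZ Z_integrable mTheta transfer Z_cadlag crat rat0.
rewrite -(cvg_lim (@ereal_hausdorff R) sl); apply: lime_le; first by apply/cvg_ex; exists (path_share PW Theta (@rational_points R m)).
apply: nearW => k; pose A := @rational_points R m `&` growing_box k.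
have cA : countable A by apply: (sub_countable (subset_card_le _) crat) => t [].
have A0 : A !=set0 by exists origin; split => // j; rewrite tE oppr_le0 ler0n.
have vol T : (k%:R + k%:R <= T)%R ->
    ((T - (k%:R + k%:R)) ^+ m)%:E * path_share PW Theta A <= \int[P]_w psup (@cube_skeleton R m T) (Z^~ w).
  move=> kT; have T0 : (0 <= T)%R by apply: le_trans kT; rewrite addr_ge0.
  rewrite opprD addrA -lebesgue_box; last by rewrite lerBrDr.
  apply: (mean_psup_ge_volume mZ Zoo transfer Z_cadlag) => //; first exact: measurable_box.
  move=> s t Bs [_ kt] j; have /andP[s1 s2] := Bs j; have /andP[t1 t2] := kt j; rewrite tE.
  by rewrite -(addNr (k%:R : R)%R) lerD//= -(subrK k%:R T) addrC lerD.
have s0 := path_share_ge0 PW Theta A0.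
have sfin : path_share PW Theta A \is a fin_num.
  rewrite ge0_fin_numE//; have := vol (k%:R + k%:R + 1)%R.
  rewrite lerDl ler01 addrAC subrr add0r expr1n mul1e => /(_ isT) /le_lt_trans; apply.
  by rewrite -ge0_fin_numE ?afin ?addr_ge0//; apply: integral_ge0 => w _; apply: psup_ge0; apply: cube_skeleton_nonempty; rewrite !addr_ge0.
rewrite -(fineK sfin) lee_fin leNgt; apply/negP => ls.
pose c := ((l + fine (path_share PW Theta A)) / 2)%R.
have /andP[lc cs] : (l < c < fine (path_share PW Theta A))%R by rewrite !midf_lt.
have rs : (((T + - (k%:R + k%:R)) / T) ^+ m * fine (path_share PW Theta A))%R @[T --> +oo%R] --> fine (path_share PW Theta A).
  rewrite -[X in _ --> X]mul1r; apply: cvgM; last exact: cvg_cst.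
  exact: cvg_ratio_expr.
have : \forall T \near (pinfty_nbhs R), False; last by case/filter_ex.
have pc : \forall T \near (pinfty_nbhs R), pickands_mean P Z 0 T < c%:E.
  by apply: (pl [set x | x < c%:E]); apply: open_ereal_lt'; rewrite lte_fin.
near=> T.
have T0 : (0 < T)%R by near: T; exact: nbhs_pinfty_gt.
have kT : (k%:R + k%:R <= T)%R by near: T; apply: nbhs_pinfty_ge; exact: num_real.
have pT : pickands_mean P Z 0 T < c%:E by near: T.
have cT : (c < ((T + - (k%:R + k%:R)) / T) ^+ m * fine (path_share PW Theta A))%R.
  by near: T; have := rs; move=> /cvgr_gt; exact.
have := vol T kT; rewrite -(fineK sfin) -EFinM.
move: pT; rewrite (pickands_mean_cube Z_cadlag (ltW T0)) -(fineK (afin _ (ltW T0))) -EFinM lte_fin lee_fin => pT v.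
have := lt_trans pT cT; rewrite exprMn exprVn mulrC -mulrA [ltRHS]mulrCA mulrC ltr_pM2l ?invr_gt0 ?exprn_gt0//.
by rewrite ltNge v.
Unshelve. all: by end_near. Qed.

End pickands_values.

(** * The theorem *)

Theorem theorem5p1 (R : realType) (d : nat) (d_ge1 : (1 <= d)%N)
  (* the random field Z, jointly measurable, with values in [-oo, +oo[ *)
  (dO : measure_display) (Omega : measurableType dO) (P : probability Omega R)
  (Z : d.-tuple R -> Omega -> \bar R)
  (Z_measurable : measurable_fun setT
     (fun tw : (d.-tuple R * Omega)%type => Z tw.1 tw.2))
  (Z_lty : forall t w, Z t w < +oo)
  (* the associated max-stable process *)
  (dX : measure_display) (OmegaX : measurableType dX) (PX : probability OmegaX R)
  (p : nat -> OmegaX -> R) (Zi : nat -> d.-tuple R -> OmegaX -> \bar R)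
  (zeta_ingredients : max_stable_ingredients P Z PX p Zi)
  (zeta_stationary : stationary PX (max_stable p Zi))
  (unit_Gumbel : forall t, \int[P]_w expeR (Z t w) = 1)
  (* V_0, its tilt V_0^[0], and Theta = V_0^[0] - V_0^[0](0) *)
  (dV : measure_display) (OmegaV : measurableType dV) (PV : probability OmegaV R)
  (V : d.-tuple R -> OmegaV -> \bar R) (V_process : measurable_process V)
  (V_law : conditioned_at_origin P PV V Z)
  (dW : measure_display) (OmegaW : measurableType dW) (PW : probability OmegaW R)
  (W : d.-tuple R -> OmegaW -> \bar R) (W_process : measurable_process W)
  (W_law : tilted_at_origin PV PW W V)
  (Theta : d.-tuple R -> OmegaW -> \bar R)
  (Theta_def : Theta = spectral_increment W)
  (Z_integrable :
     P [set w | \int[lebesgue_tuple d]_t expeR (Z t w) < +oo] = 1) :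
  (forall delta : R, (0 < delta)%R ->
     [/\ cvg (pickands_mean P Z delta T @[T --> +oo%R]),
         pickands P Z delta =
           \int[PW]_w (ereal_sup [set expeR (Theta t w) | t in lattice delta]
             / ((delta ^+ d)%:E
                * \int[lattice_measure delta]_s expeR (Theta s w))),
         0 < pickands P Z delta < +oo
       & abs_continuous_fdd PW Theta ->
         pickands P Z delta =
           ((delta ^+ d)^-1)%:E
           * PW [set w | ereal_sup [set Theta t w | t in lattice delta] = 0]])
  /\
  (cadlag_paths PX (max_stable p Zi) ->
   (* versions of Z and Theta with cadlag sample paths *)
   cadlag_paths P Z -> cadlag_paths PW Theta ->
   let E := \int[PW]_w (ereal_sup [set expeR (Theta t w) | t in setT]
              / \int[lebesgue_tuple d]_s expeR (Theta s w)) in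
     [/\ cvg (pickands_mean P Z 0 T @[T --> +oo%R]),
         E <= pickands P Z 0
       & 0 < E < +oo]).
Proof.
have mZ : measurable_process Z.
  by move=> t; exact: (measurableT_comp Z_measurable (pair1_measurable t)).
have Z_ae : {ae P, forall w, \int[lebesgue_tuple d]_t expeR (Z t w) < +oo}.
  by apply: probability1_ae => //; exact: ge0_integral_expZ_measurable.
have transfer h (F : path_space R (d.-tuple R) -> \bar R) :
    measurable_fun setT F -> (forall f, 0 <= F f) ->
    \int[PW]_w F (Theta^~ w) = \int[P]_w (expeR (Z h w) * F (increment Z h w)).
  rewrite Theta_def; exact: (theta_transfer mZ Z_lty unit_Gumbel V_process V_law
    W_process W_law zeta_ingredients zeta_stationary).
have mTheta : measurable_process Theta.
  by rewrite Theta_def; exact: spectral_increment_process.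
have Theta0 := theta_origin Z_lty mTheta transfer.
split => [delta delta0|zeta_cadlag Z_cadlag Theta_cadlag E].
  have limit := lattice_pickands_cvg delta0 Z_measurable Z_lty Z_ae mTheta transfer.
  have D_fin := theta_lsum_finite delta0 Z_measurable Z_lty mTheta transfer Z_ae.
  have value : pickands P Z delta =
      ((delta ^+ d)^-1)%:E * sup_share delta PW Theta (lattice delta).
    exact: (cvg_lim (@ereal_hausdorff R) limit).
  have dd : (0 < (delta ^+ d)^-1)%R by rewrite invr_gt0 exprn_gt0.
  split.
  - by apply/cvg_ex; eexists; exact: limit.
  - by rewrite sup_share_integral.
  - have L0 : (@lattice R d delta) !=set0 by exists origin; exact: lattice_origin.
    have /andP[_ s1] := sup_share_le1 delta0 PW mTheta (@subset_refl _ _) L0.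
    have s0 := sup_share_gt0 delta0 mTheta D_fin Theta0.
    rewrite value mule_gt0//= (@le_lt_trans _ _ (((delta ^+ d)^-1)%:E * 1))//.
      by rewrite lee_wpmul2l// lee_fin ltW.
    by rewrite mule1 ltry.
  - move=> ac; rewrite value.
    by rewrite (peak_probability delta0 Z_lty mTheta transfer D_fin Theta0 ac).
have [l pl] := continuous_pickands_cvg mZ Z_lty zeta_ingredients zeta_stationary
  zeta_cadlag Z_cadlag.
have El : E <= l%:E.
  rewrite /E path_share_integral//.
  apply: (path_share_le_limit Z_measurable Z_lty Z_ae mTheta transfer Z_cadlag) pl.
  by move=> T; exact: (mean_cube_finite mZ Z_lty zeta_ingredients zeta_cadlag).
split.
- by apply/cvg_ex; exists l%:E.
- by rewrite (_ : pickands P Z 0 = l%:E)//; exact: (cvg_lim (@ereal_hausdorff R) pl).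
- rewrite (le_lt_trans El) ?ltry// andbT /E path_share_integral//.
  apply: (path_share_gt0 Z_measurable Z_ae mTheta transfer Theta0 Z_cadlag).
    exact: countable_rational_points.
  by move=> j; rewrite tE; exists 0%R => //; rewrite rmorph0.
Qed.
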